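(* Let $B=A^{coH}\subseteq A$ be a faithfully flat Hopf--Galois extension, with corresponding Ehresmann--Schauenburg bialgebroid $\mathcal{C}(A,H)$. Then there is a group morphism $Ad:\mathcal{B}(\mathcal{C}(A,H))\to\mathrm{Aut}(\mathcal{C}(A,H))$ and an action $\triangleright$ of $\mathrm{Aut}(\mathcal{C}(A,H))$ on $\mathcal{B}(\mathcal{C}(A,H))$ that give a crossed module structure to the pair of groups $\big(\mathcal{B}(\mathcal{C}(A,H)),\mathrm{Aut}(\mathcal{C}(A,H))\big)$.
   Context: All vector spaces, (unital associative) algebras and Hopf algebras are over $\mathbb{C}$, and $\otimes=\otimes_{\mathbb{C}}$. $H$ is a Hopf algebra and $A$ is a right $H$-comodule algebra, i.e. an algebra with a right coaction $\delta^A:A\to A\otimes H$, $\delta^A(a)=a_{(0)}\otimes a_{(1)}$, which is a unital algebra map. $B=A^{coH}=\{b\in A:\delta^A(b)=b\otimes 1_H\}$. The extension $B\subseteq A$ is $H$-Hopf--Galois if the canonical map $\chi:A\otimes_B A\to A\otimes H$, $a'\otimes_B a\mapsto a'a_{(0)}\otimes a_{(1)}$, is bijective; it is faithfully flat if $A$ is faithfully flat as a right $B$-module. The translation map is $\tau:H\to A\otimes_B A$, $\tau(h)=\chi^{-1}(1_A\otimes h)=h^{<1>}\otimes_B h^{<2>}$ (sum understood). Ehresmann--Schauenburg bialgebroid: $\mathcal{C}(A,H)=(A\otimes A)^{coH}=\{a\otimes\tilde a\in A\otimes A: a_{(0)}\otimes\tilde a_{(0)}\otimes a_{(1)}\tilde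 a_{(1)}=a\otimes\tilde a\otimes 1_H\}$ (elements are written $a\otimes\tilde a$ with sums understood). Its product is $(x\otimes\tilde x)(y\otimes\tilde y)=xy\otimes\tilde y\tilde x$ with unit $1_A\otimes 1_A$; source $s(b)=b\otimes 1_A$ and target $t(b)=1_A\otimes b$; $B$-bimodule structure $b\triangleright X\triangleleft\tilde b=s(b)t(\tilde b)X$; coproduct $\Delta(a\otimes\tilde a)=a_{(0)}\otimes\tau(a_{(1)})\otimes\tilde a\in\mathcal{C}(A,H)\otimes_B\mathcal{C}(A,H)$, written $\Delta(X)=X_{(1)}\otimes_B X_{(2)}$; counit $\varepsilon(a\otimes\tilde a)=a\tilde a\in B$. Bisections: a bisection is a linear map $\sigma:\mathcal{C}(A,H)\to B$ such that (1) $\sigma(1_A\otimes 1_A)=1_B$; (2) $\sigma(s(b)t(\tilde b)X)=b\,\sigma(X)\,\tilde b$; (3) $\sigma(X\,s(\sigma(Y)))=\sigma(XY)$, for all $b,\tilde b\in B$ and $X,Y\in\mathcal{C}(A,H)$. The set $\mathcal{B}(\mathcal{C}(A,H))$ of bisections is a group under the convolution product $\sigma_1\ast\sigma_2(X)=\sigma_1(X_{(1)})\,\sigma_2(X_{(2)})$, with unit $\varepsilon$. Automorphisms: $\mathrm{Aut}(\mathcal{C}(A,H))$ is the group (under map composition) of pairs $(\Phi,\varphi)$ of algebra automorphisms $\Phi:\mathcal{C}(A,H)\to\mathcal{C}(A,H)$ and $\varphi:B\to B$ such that $\Phi\circ s=s\circ\varphi$, $\Phi\circ t=t\circ\varphi$,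 $(\Phi\otimes_B\Phi)\circ\Delta=\Delta\circ\Phi$ and $\varepsilon\circ\Phi=\varphi\circ\varepsilon$ (the map $\varphi$ is determined by $\Phi$ as $\varphi=\varepsilon\circ\Phi\circ s$). Crossed module: a crossed module $(M,N,\mu,\alpha)$ consists of two groups $M,N$ and group homomorphisms $\mu:M\to N$ and $\alpha:N\to\mathrm{Aut}(M)$, $n\mapsto\alpha_n$, such that $\mu(\alpha_n(m))=n\mu(m)n^{-1}$ for all $n\in N,m\in M$, and $\alpha_{\mu(m)}(m')=m\,m'\,m^{-1}$ for all $m,m'\in M$. In the claim $M=\mathcal{B}(\mathcal{C}(A,H))$, $N=\mathrm{Aut}(\mathcal{C}(A,H))$, $\mu=Ad$ and $\alpha=\triangleright$. *)

(* Defs.v *)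
From HB Require Import structures.
From mathcomp Require Import all_boot all_algebra.
From mathcomp Require Import generic_quotient.
From mathcomp Require Import boolp classical_sets reals complex.

Set Implicit Arguments.
Unset Strict Implicit.
Unset Printing Implicit Defensive.

Import GRing.Theory.

Local Open Scope ring_scope.
Local Open Scope quotient_scope.

(* [tens ra la] is M ⊗_S N for k-vector spaces M, N with a right action [ra]
   and a left action [la] of S.  Its elements are formal sums of pairs, i.e.
   lists standing for \sum_i x_i ⊗ y_i; two of them are identified when every
   k-bilinear S-balanced map to a k-vector space takes the same value on
   both, which is the universal property of M ⊗_S N. *)
Section Tensor.
Variables (k : fieldType) (S : Type) (M N : lmodType k).
Variables (ra : M -> S -> M) (la : S -> N -> N).

Definition balanced (V : lmodType k) (f : M -> N -> V) : Prop :=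
  [/\ forall x, linear (f x), forall y, linear (f^~ y)
    & forall x s y, f (ra x s) y = f x (la s y)].

Definition eval_sum (V : lmodType k) (f : M -> N -> V) (u : seq (M * N)) : V :=
  \sum_(p <- u) f p.1 p.2.

Definition tens_rel (u v : seq (M * N)) : bool :=
  `[< forall (V : lmodType k) (f : M -> N -> V),
        balanced f -> eval_sum f u = eval_sum f v >].

Lemma tens_rel_equiv : equiv_class_of tens_rel.
Proof.
split=> [u|u v|v u w].
- by apply/asboolP.
- by apply/asbool_equiv_eq; split=> h V f fb; rewrite h.
- by move=> /asboolP h1 /asboolP h2; apply/asboolP=> V f fb; rewrite h1 ?h2.
Qed.

Canonical tens_equiv := EquivRelPack tens_rel_equiv.

Definition tens := {eq_quot tens_rel}.
HB.instance Definition _ := Choice.on tens.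

Definition tens_class (u : seq (M * N)) : tens := \pi_{eq_quot tens_rel} u.
Definition tens_repr (t : tens) : seq (M * N) :=
  repr (t : {eq_quot tens_rel}).

Definition tens_pure (x : M) (y : N) : tens := tens_class [:: (x, y)].

(* Computed on a chosen representative \sum_i x_i ⊗ y_i of [t]; it does not
   depend on the choice when [f] is balanced, see [tens_lift_pure] and
   [tens_lift_linear]. *)
Definition tens_lift (V : lmodType k) (f : M -> N -> V) (t : tens) : V :=
  eval_sum f (tens_repr t).

Lemma tens_repr_class (V : lmodType k) (f : M -> N -> V) u :
  balanced f -> eval_sum f (tens_repr (tens_class u)) = eval_sum f u.
Proof.
move=> fb; have /eqmodP/asboolP h : (\pi_{eq_quot tens_rel}
   (tens_repr (tens_class u)) = \pi_{eq_quot tens_rel} u).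
  by rewrite /tens_repr reprK.
exact: h.
Qed.

Lemma tens_ext (t u : tens) :
  (forall (V : lmodType k) (f : M -> N -> V),
     balanced f -> tens_lift f t = tens_lift f u) -> t = u.
Proof.
move=> h; rewrite -[t](@reprK _ {eq_quot tens_rel}).
rewrite -[u](@reprK _ {eq_quot tens_rel}).
exact/eqmodP/asboolP.
Qed.

Definition tens_add (t u : tens) : tens :=
  tens_class (tens_repr t ++ tens_repr u).
Definition tens_scale (c : k) (t : tens) : tens :=
  tens_class [seq (c *: p.1, p.2) | p <- tens_repr t].

Section LiftTheory.
Variables (V : lmodType k) (f : M -> N -> V).
Hypothesis fb : balanced f.

Let f0l y : f 0 y = 0.
Proof.
by case: fb => _ fl _; have := fl y (-1) 0 0; rewrite !scaleN1r /= oppr0 addr0 addNr.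
Qed.

Let fZl c x y : f (c *: x) y = c *: f x y.
Proof. by case: fb => _ fl _; have := fl y c x 0; rewrite /= f0l !addr0. Qed.

Lemma lift_add t u : tens_lift f (tens_add t u) = tens_lift f t + tens_lift f u.
Proof. by rewrite /tens_lift tens_repr_class // /eval_sum big_cat. Qed.

Lemma lift_scale c t : tens_lift f (tens_scale c t) = c *: tens_lift f t.
Proof.
rewrite /tens_lift tens_repr_class // /eval_sum big_map scaler_sumr.
by apply: eq_bigr => p _ /=; rewrite fZl.
Qed.

Lemma lift_zero : tens_lift f (tens_class [::]) = 0.
Proof. by rewrite /tens_lift tens_repr_class // /eval_sum big_nil. Qed.

Lemma tens_lift_pure x y : tens_lift f (tens_pure x y) = f x y.
Proof.
by rewrite /tens_lift tens_repr_class // /eval_sum big_cons big_nil addr0.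
Qed.

End LiftTheory.

Let tens_addA : associative tens_add.
Proof. by move=> t u v; apply: tens_ext => V f fb; rewrite !lift_add ?addrA. Qed.

Let tens_addC : commutative tens_add.
Proof. by move=> t u; apply: tens_ext => V f fb; rewrite !lift_add // addrC. Qed.

Let tens_add0 : left_id (tens_class [::]) tens_add.
Proof.
by move=> t; apply: tens_ext => V f fb; rewrite lift_add // lift_zero ?add0r.
Qed.

Let tens_addN : left_inverse (tens_class [::]) (tens_scale (-1)) tens_add.
Proof.
move=> t; apply: tens_ext => V f fb.
by rewrite lift_add // lift_scale // lift_zero // scaleN1r addNr.
Qed.

HB.instance Definition _ := GRing.isZmodule.Build tens
  tens_addA tens_addC tens_add0 tens_addN.

Let tens_scaleA a b t : tens_scale a (tens_scale b t) = tens_scale (a * b) t.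
Proof.
by apply: tens_ext => V f fb; rewrite !lift_scale // scalerA.
Qed.

Let tens_scale1 : left_id 1 tens_scale.
Proof. by move=> t; apply: tens_ext => V f fb; rewrite lift_scale ?scale1r. Qed.

Let tens_scaleDr : right_distributive tens_scale +%R.
Proof.
move=> a t u; apply: tens_ext => V f fb.
by rewrite lift_scale // !lift_add // !lift_scale // scalerDr.
Qed.

Let tens_scaleDl t : {morph tens_scale^~ t : a b / a + b}.
Proof.
move=> a b; apply: tens_ext => V f fb.
by rewrite lift_scale // !lift_add // !lift_scale // scalerDl.
Qed.

HB.instance Definition _ := GRing.Zmodule_isLmodule.Build k tens
  tens_scaleA tens_scale1 tens_scaleDr tens_scaleDl.

Lemma tens_lift_linear (V : lmodType k) (f : M -> N -> V) :
  balanced f -> linear (tens_lift f).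
Proof. by move=> fb a t u; rewrite lift_add // lift_scale. Qed.

Lemma tens_pure_balanced : balanced tens_pure.
Proof.
split=> [x a y z|y a x z|x s y]; apply: tens_ext => V f fb.
- rewrite lift_add // lift_scale // !tens_lift_pure //.
  by case: fb => ->.
- rewrite lift_add // lift_scale // !tens_lift_pure //.
  by case: fb => _ fl _; exact: fl.
- rewrite !tens_lift_pure //.
  by case: fb => _ _ ->.
Qed.

Lemma tens_span (t : tens) :
  t = \sum_(p <- tens_repr t) tens_pure p.1 p.2.
Proof.
apply: tens_ext => V f fb; rewrite {1}/tens_lift /eval_sum.
pose L : {linear tens -> V} :=
  HB.pack (tens_lift f) (GRing.isLinear.Build _ _ _ _ _ (tens_lift_linear fb)).
rewrite -[RHS]/(L _) linear_sum; apply: eq_bigr => p _.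
by rewrite /L /= tens_lift_pure.
Qed.

Lemma tens_ind (P : tens -> Prop) :
  P 0 -> (forall t u, P t -> P u -> P (t + u)) ->
  (forall x y, P (tens_pure x y)) -> forall t, P t.
Proof. by move=> P0 PD Pp t; rewrite [t]tens_span; apply: big_ind. Qed.

Lemma eq_tens_lift (V : lmodType k) (f g : M -> N -> V) :
  f =2 g -> tens_lift f =1 tens_lift g.
Proof. by move=> fg t; apply: eq_bigr => p _; exact: fg. Qed.

Lemma tens_lift_unique (V : lmodType k) (f : M -> N -> V) (g : {linear tens -> V}) :
  (forall x y, g (tens_pure x y) = f x y) -> tens_lift f =1 g.
Proof.
move=> gf t; rewrite [in RHS](tens_span t) linear_sum.
by apply: eq_bigr => p _; rewrite gf.
Qed.

End Tensor.

(* M ⊗_k N: the case S = void, where bilinearity is the only condition. *)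
Section PlainTensor.
Variables (k : fieldType) (M N : lmodType k).

Definition otimes := tens (fun (x : M) (_ : void) => x) (fun (_ : void) (y : N) => y).
HB.instance Definition _ := GRing.Lmodule.on otimes.

Definition pure (x : M) (y : N) : otimes := tens_pure _ _ x y.

Lemma pure_linear_r x : linear (pure x).
Proof. by case: (tens_pure_balanced (fun (x : M) (_ : void) => x)
  (fun (_ : void) (y : N) => y)) => h _ _; exact: h. Qed.

Lemma pure_linear_l y : linear (pure^~ y).
Proof. by case: (tens_pure_balanced (fun (x : M) (_ : void) => x)
  (fun (_ : void) (y : N) => y)) => _ h _; exact: h. Qed.

Lemma otimes_ind (P : otimes -> Prop) :
  P 0 -> (forall t u, P t -> P u -> P (t + u)) ->
  (forall x y, P (pure x y)) -> forall t, P t.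
Proof. by move=> P0 PD Pp; apply: tens_ind. Qed.

Section Lift.
Variables (V : lmodType k) (f : M -> N -> V).

Definition lift (t : otimes) : V := tens_lift f t.

Hypothesis fr : forall x, linear (f x).
Hypothesis fl : forall y, linear (f^~ y).

Let fb : balanced (fun (x : M) (_ : void) => x) (fun (_ : void) (y : N) => y) f.
Proof. by split. Qed.

Lemma lift_linear : linear lift.
Proof. exact: tens_lift_linear fb. Qed.

Lemma lift_pure x y : lift (pure x y) = f x y.
Proof. exact: (tens_lift_pure fb). Qed.

End Lift.

End PlainTensor.

Arguments otimes {k} (M N)%_type.

Notation "M ⊗ N" := (otimes M N) (at level 40, left associativity) : type_scope.
Notation "x ⊗ y" := (pure x y) (at level 40, left associativity) : ring_scope.

(* Used only to see that 1 ⊗ 1 is nonzero in A ⊗ B, as [algType] requires. *)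
Section Functional.
Variables (k : fieldType) (V : lmodType k) (v : V).
Hypothesis v0 : v != 0.
Local Open Scope classical_set_scope.

Lemma exists_functional : exists2 f : V -> k^o, linear f & f v = 1.
Proof.
pose P (X : set V) := ~ X v /\ forall a x y, X x -> X y -> X (a *: x + y).
have [|A [[Av AP] Amax]] := @Zorn_bigcup V P.
  move=> F FP Ftot; split=> [[X FX Xv]|a x y [X FX Xx] [Y FY Yy]].
    by case: (FP _ FX).
  case: (Ftot _ _ FX FY) => [XY|YX].
    by exists Y => //; apply: (FP _ FY).2 => //; exact: XY.
  by exists X => //; apply: (FP _ FX).2 => //; exact: YX.
have A0 : A 0.
  apply: contrapT => nA0.
  have AE x : ~ A x.
    by move=> Ax; apply: nA0; rewrite -(addNr x) -scaleN1r; exact: AP.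
  apply: (Amax [set 0]).
    split=> [x /AE//|h]; exact/nA0/h.
  by split=> [/= /eqP|a x y /= -> ->]; [exact/negP | rewrite scaler0 addr0].
have AZ a x : A x -> A (a *: x) by move=> Ax; rewrite -[_ *: _]addr0; exact: AP.
have ex x : exists c, A (x - c *: v).
  apply: contrapT => nx.
  apply: (Amax [set y | exists e, A (y - e *: x)]).
    split=> [y Ay|h]; first by exists 0; rewrite scale0r subr0.
    by apply: nx; exists 0; rewrite scale0r subr0; apply: h; exists 1;
      rewrite scale1r subrr.
  split=> [[e Ae]|a y z [e Ae] [e' Ae']].
    have e0 : e != 0 by apply/eqP=> e0; apply: Av; rewrite e0 scale0r subr0 in Ae.
    apply: nx; exists e^-1; move/(AZ (- e^-1)): Ae.
    by rewrite scalerBr scalerA mulNr mulVf // !scaleNr scale1r opprK addrC.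
  exists (a * e + e'); move: (AP a _ _ Ae Ae').
  by rewrite scalerBr scalerA scalerDl opprD addrACA.
have uniq x c d : A (x - c *: v) -> A (x - d *: v) -> c = d.
  move=> Ac Ad; apply/eqP; rewrite -subr_eq0; apply/negP => /negP cd; apply: Av.
  have: A ((c - d) *: v).
    by have := AP (-1) _ _ Ac Ad; rewrite scaleN1r opprB subrKA -scalerBl.
  by move/(AZ (c - d)^-1); rewrite scalerA mulVf // scale1r.
pose f x : k^o := projT1 (cid (ex x)).
have fP x : A (x - f x *: v) by rewrite /f; case: cid.
exists f => [a x y|].
  apply: (uniq _ _ _ (fP _)); have := AP a _ _ (fP x) (fP y).
  by rewrite scalerBr scalerA addrACA -opprD -scalerDl.
by apply: (uniq _ _ _ (fP _)); rewrite scale1r subrr.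
Qed.

End Functional.

Section LiftComb.
Variables (k : fieldType) (S : Type) (M N : lmodType k).
Variables (ra : M -> S -> M) (la : S -> N -> N) (V : lmodType k).

Lemma tens_lift_comb (f g h : M -> N -> V) a :
  (forall x y, h x y = a *: f x y + g x y) ->
  forall t : tens ra la,
    tens_lift h t = a *: tens_lift f t + tens_lift g t.
Proof.
move=> hE t; rewrite /tens_lift /eval_sum scaler_sumr -big_split /=.
by apply: eq_bigr => p _.
Qed.

End LiftComb.

Section TensorAlgebra.
Variables (k : fieldType) (A B : algType k).
Implicit Types t u v : A ⊗ B.

Definition otimes_mul t u : A ⊗ B :=
  lift (fun a b => lift (fun a' b' => (a * a') ⊗ (b * b')) u) t.

Let inner_r (a : A) (b : B) a' : linear (fun b' => (a * a') ⊗ (b * b')).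
Proof. by move=> c x y; rewrite mulrDr -scalerAr pure_linear_r. Qed.

Let inner_l (a : A) (b b' : B) : linear (fun a' => (a * a') ⊗ (b * b')).
Proof. by move=> c x y; rewrite mulrDr -scalerAr pure_linear_l. Qed.

Let outer_r u (a : A) :
  linear (fun b => lift (fun a' b' => (a * a') ⊗ (b * b')) u).
Proof.
move=> c x y; apply: tens_lift_comb => a' b'.
by rewrite mulrDl -scalerAl pure_linear_r.
Qed.

Let outer_l u (b : B) :
  linear (fun a => lift (fun a' b' => (a * a') ⊗ (b * b')) u).
Proof.
move=> c x y; apply: tens_lift_comb => a' b'.
by rewrite mulrDl -scalerAl pure_linear_l.
Qed.

Let mul_linear_l u : linear (otimes_mul^~ u).
Proof. by move=> c t v; rewrite /otimes_mul lift_linear. Qed.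

Let mul_linear_r t : linear (otimes_mul t).
Proof.
by move=> c u v; apply: tens_lift_comb => a b; rewrite lift_linear.
Qed.

Let mul_pure a b a' b' : otimes_mul (a ⊗ b) (a' ⊗ b') = (a * a') ⊗ (b * b').
Proof. by rewrite /otimes_mul lift_pure // lift_pure. Qed.

Let mulDl : left_distributive otimes_mul +%R.
Proof. by move=> t u v; have := mul_linear_l v 1 t u; rewrite !scale1r. Qed.

Let mulDr : right_distributive otimes_mul +%R.
Proof. by move=> t u v; have := mul_linear_r t 1 u v; rewrite !scale1r. Qed.

Let mul0l t : otimes_mul 0 t = 0.
Proof. by apply: (addrI (otimes_mul 0 t)); rewrite -mulDl !addr0. Qed.

Let mul0r t : otimes_mul t 0 = 0.
Proof. by apply: (addrI (otimes_mul t 0)); rewrite -mulDr !addr0. Qed.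

Let mulA : associative otimes_mul.
Proof.
move=> t u v; move: t; apply: otimes_ind.
- by rewrite !mul0l.
- by move=> t t' ht ht'; rewrite !mulDl ht ht'.
move=> a b; move: u; apply: otimes_ind.
- by rewrite mul0l mul0r mul0l.
- by move=> t t' ht ht'; rewrite mulDl !mulDr mulDl ht ht'.
move=> a' b'; move: v; apply: otimes_ind.
- by rewrite !mul0r.
- by move=> t t' ht ht'; rewrite !mulDr ht ht'.
by move=> a'' b''; rewrite !mul_pure !mulrA.
Qed.

Let mul1l : left_id (1 ⊗ 1) otimes_mul.
Proof.
apply: otimes_ind; first exact: mul0r.
  by move=> t t' ht ht'; rewrite mulDr ht ht'.
by move=> a b; rewrite mul_pure !mul1r.
Qed.

Let mul1r : right_id (1 ⊗ 1) otimes_mul.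
Proof.
apply: otimes_ind; first exact: mul0l.
  by move=> t t' ht ht'; rewrite mulDl ht ht'.
by move=> a b; rewrite mul_pure !mulr1.
Qed.

Let one_neq0 : (1 ⊗ 1 : A ⊗ B) != 0.
Proof.
have [f fl f1] := exists_functional (oner_neq0 A).
apply/eqP => h.
have gr (x : A) : linear (fun y : B => (f x : k) *: y).
  by move=> c y z; rewrite scalerDr !scalerA mulrC.
have gl (y : B) : linear (fun x : A => (f x : k) *: y).
  by move=> c x z; rewrite fl scalerDl -scalerA.
have := lift_pure gr gl 1 1.
rewrite h f1 scale1r => /eqP; apply/negP.
suff -> : lift (fun (x : A) (y : B) => (f x : k) *: y) 0 = 0.
  by rewrite eq_sym oner_neq0.
have := lift_linear gr gl (-1) 0 0.
by rewrite !scaleN1r oppr0 addr0 addNr.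
Qed.

HB.instance Definition _ := GRing.Zmodule_isNzRing.Build (otimes A B)
  mulA mul1l mul1r mulDl mulDr one_neq0.

Let scaleAl c t u : c *: (t * u) = (c *: t) * u.
Proof. by have := mul_linear_l u c t 0; rewrite mul0l !addr0. Qed.

HB.instance Definition _ := GRing.Lmodule_isLalgebra.Build k (otimes A B) scaleAl.

Let scaleAr c t u : c *: (t * u) = t * (c *: u).
Proof. by have := mul_linear_r t c u 0; rewrite mul0r !addr0. Qed.

HB.instance Definition _ := GRing.Lalgebra_isAlgebra.Build k (otimes A B) scaleAr.

Lemma mul_pureE (a a' : A) (b b' : B) :
  (a ⊗ b) * (a' ⊗ b') = (a * a') ⊗ (b * b').
Proof. exact: mul_pure. Qed.

End TensorAlgebra.

(* MathComp provides A^c, the algebra with the product x, y |-> y x, only as a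
   ring. *)
Section Opposite.
Variables (k : fieldType) (A : algType k).

HB.instance Definition _ := GRing.Lmodule.copy A^c A.

Let scaleAl (c : k) (x y : A) : c *: (y * x) = y * (c *: x).
Proof. exact: scalerAr. Qed.

HB.instance Definition _ := GRing.Lmodule_isLalgebra.Build k A^c scaleAl.

Let scaleAr (c : k) (x y : A) : c *: (y * x) = (c *: y) * x.
Proof. exact: scalerAl. Qed.

HB.instance Definition _ := GRing.Lalgebra_isAlgebra.Build k A^c scaleAr.

End Opposite.

Lemma linear_big (k : fieldType) (U V : lmodType k) (f : U -> V) (I : Type)
    (r : seq I) (F : I -> U) :
  linear f -> f (\sum_(i <- r) F i) = \sum_(i <- r) f (F i).
Proof.
move=> fl; pose L : {linear U -> V} :=
  HB.pack f (GRing.isLinear.Build _ _ _ _ _ fl).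
by rewrite -[LHS]/(L _) linear_sum.
Qed.

Lemma linear_tens_lift (k : fieldType) (S : Type) (M N U V : lmodType k)
    (ra : M -> S -> M) (la : S -> N -> N) (f : M -> N -> U) (L : U -> V)
    (t : tens ra la) :
  linear L -> L (tens_lift f t) = tens_lift (fun x y => L (f x y)) t.
Proof. exact: linear_big. Qed.

Section TensorMaps.
Variable k : fieldType.
Implicit Types M N P : lmodType k.

Definition tmap M N M' N' (f : M -> M') (g : N -> N') : M ⊗ N -> M' ⊗ N' :=
  lift (fun x y => f x ⊗ g y).

Definition tassoc M N P : (M ⊗ N) ⊗ P -> M ⊗ (N ⊗ P) :=
  lift (fun t z => lift (fun x y => x ⊗ (y ⊗ z)) t).

End TensorMaps.

Record hopf_algebra (k : fieldType) := HopfAlgebra {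
  hopf_alg :> algType k;
  comul : hopf_alg -> hopf_alg ⊗ hopf_alg;
  hcounit : hopf_alg -> k;
  antipode : hopf_alg -> hopf_alg;
  comul_linear : linear comul;
  comul_morph : GRing.monoid_morphism comul;
  hcounit_linear : scalar hcounit;
  hcounit_morph : GRing.monoid_morphism hcounit;
  antipode_linear : linear antipode;
  comulA : forall h,
    tassoc (tmap comul id (comul h)) = tmap id comul (comul h);
  comul_counit_l : forall h,
    lift (fun h1 h2 => hcounit h1 *: h2) (comul h) = h;
  comul_counit_r : forall h,
    lift (fun h1 h2 => hcounit h2 *: h1) (comul h) = h;
  antipode_l : forall h,
    lift (fun h1 h2 => antipode h1 * h2) (comul h) = (hcounit h)%:A;
  antipode_r : forall h,
    lift (fun h1 h2 => h1 * antipode h2) (comul h) = (hcounit h)%:A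
}.

Arguments comul {k} H _ : rename.
Arguments hcounit {k} H _ : rename.
Arguments antipode {k} H _ : rename.

Record comodule_algebra (k : fieldType) (H : hopf_algebra k) := ComoduleAlgebra {
  comod_alg :> algType k;
  coact : comod_alg -> comod_alg ⊗ H;
  coact_linear : linear coact;
  coact_morph : GRing.monoid_morphism coact;
  coactA : forall a,
    tassoc (tmap coact id (coact a)) = tmap id (comul H) (coact a);
  coact_counit : forall a,
    lift (fun a0 a1 => hcounit H a1 *: a0) (coact a) = a
}.

Arguments coact {k H} A _ : rename.
Arguments coact_linear {k H} A : rename.
Arguments coact_morph {k H} A : rename.

Section Coinvariants.
Variables (k : fieldType) (H : hopf_algebra k) (A : comodule_algebra H).

Definition coinv : {pred A} := [pred a : A | coact A a == a ⊗ 1].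

Lemma coinvP a : reflect (coact A a = a ⊗ 1) (a \in coinv).
Proof. exact: eqP. Qed.

Lemma coinv_subalg : subalg_closed coinv.
Proof.
split=> [|c x y /coinvP hx /coinvP hy|x y /coinvP hx /coinvP hy]; apply/coinvP.
- by rewrite (coact_morph A).1.
- by rewrite coact_linear hx hy pure_linear_l.
- by rewrite (coact_morph A).2 hx hy mul_pureE mulr1.
Qed.

HB.instance Definition _ := GRing.isSubalgClosed.Build k A coinv coinv_subalg.

(* B = A^{co H} *)
Record base := Base { base_val :> A; _ : base_val \in coinv }.
HB.instance Definition _ := [isSub for base_val].
HB.instance Definition _ := [Choice of base by <:].
HB.instance Definition _ := [SubChoice_isSubAlgebra of base by <:].

End Coinvariants.

Section EhresmannSchauenburg.
Variables (k : fieldType) (H : hopf_algebra k) (A : comodule_algebra H).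
Local Notation B := (base A).
Local Notation δ := (coact A).

Definition coact2_pair (t u : A ⊗ H) : (A ⊗ A^c) ⊗ H :=
  lift (fun (a0 : A) (a1 : H) =>
    lift (fun (b0 : A) (b1 : H) => (a0 ⊗ (b0 : A^c)) ⊗ (a1 * b1)) u) t.

(* The codiagonal coaction a ⊗ b |-> a_(0) ⊗ b_(0) ⊗ a_(1) b_(1).  The second
   leg is written in A^c so that the algebra A ⊗ A^c carries the product
   (x ⊗ x') (y ⊗ y') = x y ⊗ y' x' of the bialgebroid. *)
Definition coact2 (X : A ⊗ A^c) : (A ⊗ A^c) ⊗ H :=
  lift (fun a b : A => coact2_pair (δ a) (δ b)) X.

Let pair_linear_l u : linear (coact2_pair^~ u).
Proof.
move=> c t t'; apply: lift_linear => [a|h] d x y; apply: tens_lift_comb => b h'.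
  by rewrite mulrDl -scalerAl pure_linear_r.
by rewrite pure_linear_l pure_linear_l.
Qed.

Let pair_linear_r t : linear (coact2_pair t).
Proof.
move=> c u u'; apply: tens_lift_comb => a h.
apply: lift_linear => [b|h'] d x y.
  by rewrite mulrDr -scalerAr pure_linear_r.
by rewrite pure_linear_r pure_linear_l.
Qed.

Lemma coact2_pair_pure (a b : A) (g h : H) :
  coact2_pair (a ⊗ g) (b ⊗ h) = (a ⊗ (b : A^c)) ⊗ (g * h).
Proof.
rewrite /coact2_pair lift_pure; first 1 [rewrite lift_pure //].
- by move=> x c y z; rewrite mulrDr -scalerAr pure_linear_r.
- by move=> x c y z; rewrite pure_linear_r pure_linear_l.
- move=> x c y z; apply: tens_lift_comb => b' h'.
  by rewrite mulrDl -scalerAl pure_linear_r.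
- move=> x c y z; apply: tens_lift_comb => b' h'.
  by rewrite pure_linear_l pure_linear_l.
Qed.

Let coact2_r (a : A) : linear (fun b : A^c => coact2_pair (δ a) (δ b)).
Proof. by move=> c x y; rewrite coact_linear pair_linear_r. Qed.

Let coact2_l (b : A^c) : linear (fun a : A => coact2_pair (δ a) (δ b)).
Proof. by move=> c x y; rewrite coact_linear pair_linear_l. Qed.

Lemma coact2_linear : linear coact2.
Proof. exact: lift_linear coact2_r coact2_l. Qed.

Lemma coact2_pure (a : A) (b : A) :
  coact2 (a ⊗ (b : A^c)) = coact2_pair (δ a) (δ b).
Proof. exact: lift_pure coact2_r coact2_l _ _. Qed.

Definition conj_pair (t u : A ⊗ H) (W : (A ⊗ A^c) ⊗ H) : (A ⊗ A^c) ⊗ H :=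
  lift (fun (a0 : A) (a1 : H) => lift (fun (b0 : A) (b1 : H) =>
    ((a0 ⊗ (b0 : A^c)) ⊗ a1) * W * (1 ⊗ b1)) u) t.

Let conj_linear t u : linear (conj_pair t u).
Proof.
move=> c W W'; apply: tens_lift_comb => a h; apply: tens_lift_comb => b h'.
by rewrite mulrDr mulrDl -scalerAr -scalerAl.
Qed.

Let conj_inv t u (Z : A ⊗ A^c) :
  conj_pair t u (Z ⊗ 1) = coact2_pair t u * (Z ⊗ 1).
Proof.
rewrite /conj_pair /coact2_pair /lift /tens_lift /eval_sum mulr_suml.
apply: eq_bigr => p _; rewrite mulr_suml; apply: eq_bigr => q _.
by rewrite !mul_pureE !mulr1.
Qed.

Let conj_mul (t u t' u' : A ⊗ H) :
  conj_pair t u (coact2_pair t' u') = coact2_pair (t * t') (u' * u).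
Proof.
have e1 : t * t' = \sum_(p <- tens_repr t) \sum_(p' <- tens_repr t')
  (p.1 * p'.1) ⊗ (p.2 * p'.2) by [].
have e2 : u' * u = \sum_(q' <- tens_repr u') \sum_(q <- tens_repr u)
  (q'.1 * q.1) ⊗ (q'.2 * q.2) by [].
rewrite e1 (linear_big _ _ (pair_linear_l _)).
apply: eq_bigr => p _.
rewrite (linear_big _ _ (pair_linear_l _)).
rewrite -[lift _ _]/(\sum_(q <- tens_repr u) _).
under eq_bigr => q _.
  rewrite -[coact2_pair t' u']/(\sum_(p' <- tens_repr t')
    \sum_(q' <- tens_repr u') (p'.1 ⊗ (q'.1 : A^c)) ⊗ (p'.2 * q'.2)).
  rewrite mulr_sumr mulr_suml.
  over.
rewrite exchange_big /=; apply: eq_bigr => p' _.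
under eq_bigr => q _ do rewrite mulr_sumr mulr_suml.
rewrite exchange_big /= e2 (linear_big _ _ (pair_linear_r _)).
apply: eq_bigr => q' _; rewrite (linear_big _ _ (pair_linear_r _)).
apply: eq_bigr => q _.
rewrite coact2_pair_pure !mul_pureE mulr1.
by apply: congr2; [apply: congr2; rewrite // (mulr1 (_ : A^c)) | rewrite !mulrA].
Qed.

Let coact2_mul (a b : A) (Y : A ⊗ A^c) :
  coact2 ((a ⊗ (b : A^c)) * Y) = conj_pair (δ a) (δ b) (coact2 Y).
Proof.
rewrite [Y]tens_span mulr_sumr !(linear_big _ _ coact2_linear).
rewrite (linear_big _ _ (conj_linear _ _)); apply: eq_bigr => p _.
rewrite [coact2 (tens_pure _ _ _ _)]coact2_pure conj_mul mul_pureE.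
by rewrite coact2_pure -!(coact_morph A).2.
Qed.

Definition coinv2 : {pred (A ⊗ A^c)%type} := [pred X : (A ⊗ A^c)%type | coact2 X == X ⊗ 1].

Lemma coinv2P X : reflect (coact2 X = X ⊗ 1) (X \in coinv2).
Proof. exact: eqP. Qed.

Lemma coinv2_subalg : subalg_closed coinv2.
Proof.
split=> [|c x y /coinv2P hx /coinv2P hy|x y /coinv2P hx /coinv2P hy].
- apply/coinv2P; rewrite coact2_pure.
  by rewrite (coact_morph A).1 coact2_pair_pure mulr1.
- by apply/coinv2P; rewrite coact2_linear hx hy pure_linear_l.
apply/coinv2P.
rewrite {1}[x]tens_span mulr_suml (linear_big _ _ coact2_linear).
under eq_bigr => p _ do rewrite coact2_mul hy conj_inv -coact2_pure.
rewrite -mulr_suml -(linear_big _ _ coact2_linear) -tens_span hx.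
by rewrite mul_pureE mulr1.
Qed.

HB.instance Definition _ :=
  GRing.isSubalgClosed.Build k (A ⊗ A^c)%type coinv2 coinv2_subalg.

End EhresmannSchauenburg.

Arguments coact2 {k H} A _ : rename.
Arguments coinv2 {k H} A _ : rename.
Arguments coinv {k H} A _ : rename.

Section Bialgebroid.
Variables (k : fieldType) (H : hopf_algebra k) (A : comodule_algebra H).
Local Notation B := (base A).
Local Notation δ := (coact A).
Implicit Types (a : A) (b : B) (h : H).

(* The Ehresmann-Schauenburg bialgebroid C(A, H) = (A ⊗ A)^{co H} *)
Record ES := Es { es_val :> (A ⊗ A^c)%type; _ : es_val \in coinv2 A }.
HB.instance Definition _ := [isSub for es_val].
HB.instance Definition _ := [Choice of ES by <:].
HB.instance Definition _ := [SubChoice_isSubAlgebra of ES by <:].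
Implicit Types X Y : ES.

Lemma src_subproof b : (b : A) ⊗ (1 : A^c) \in coinv2 A.
Proof.
apply/coinv2P; rewrite coact2_pure (coact_morph A).1 (coinvP _ (valP b)).
by rewrite coact2_pair_pure mulr1.
Qed.
Definition src b : ES := Es (src_subproof b).

Lemma tgt_subproof b : (1 : A) ⊗ ((b : A) : A^c) \in coinv2 A.
Proof.
apply/coinv2P; rewrite coact2_pure (coact_morph A).1 (coinvP _ (valP b)).
by rewrite coact2_pair_pure mulr1.
Qed.
Definition tgt b : ES := Es (tgt_subproof b).

Definition opp_mul (X : A ⊗ A^c) : A := lift (fun a a' : A => a * a') X.

Let opp_mul_r a : linear (fun a' : A^c => a * (a' : A)).
Proof. by move=> c x y; rewrite mulrDr -scalerAr. Qed.

Let opp_mul_l (a' : A^c) : linear (fun a => a * (a' : A)).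
Proof. by move=> c x y; rewrite mulrDl -scalerAl. Qed.

Lemma opp_mul_linear : linear opp_mul.
Proof. exact: lift_linear opp_mul_r opp_mul_l. Qed.

Lemma opp_mul_pure a a' : opp_mul (a ⊗ (a' : A^c)) = a * a'.
Proof. exact: lift_pure opp_mul_r opp_mul_l _ _. Qed.

Let coact_opp_mul (X : A ⊗ A^c) : δ (opp_mul X) = tmap opp_mul id (coact2 A X).
Proof.
have tr x : linear (fun h : H => opp_mul x ⊗ h) by exact: pure_linear_r.
have tl h : linear (fun x => opp_mul x ⊗ h).
  by move=> c x y; rewrite opp_mul_linear pure_linear_l.
have tlin : linear (tmap opp_mul (@id H)) := lift_linear tr tl.
rewrite [X]tens_span (linear_big _ _ opp_mul_linear).
rewrite (linear_big _ _ (coact_linear A)) (linear_big _ _ (@coact2_linear k H A)).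
rewrite (linear_big _ _ tlin); apply: eq_bigr => p _.
rewrite [opp_mul _]opp_mul_pure (coact_morph A).2.
rewrite [coact2 A _]coact2_pure.
rewrite /coact2_pair (linear_big _ _ tlin); apply: eq_bigr => q _.
rewrite (linear_big _ _ tlin); apply: eq_bigr => r _.
by rewrite [RHS](lift_pure tr tl) opp_mul_pure.
Qed.

Lemma counit_subproof X : opp_mul X \in coinv A.
Proof.
apply/coinvP; rewrite coact_opp_mul (coinv2P _ (valP X)).
apply: lift_pure => [x|h]; first exact: pure_linear_r.
by move=> c x y; rewrite opp_mul_linear pure_linear_l.
Qed.
Definition counit X : B := Base (counit_subproof X).

(* A ⊗_B A *)
Definition AoverB := tens (fun a b => a * (b : A) : A) (fun b a => (b : A) * a : A).
HB.instance Definition _ := GRing.Lmodule.on AoverB.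

Definition canonical_map : AoverB -> A ⊗ H :=
  tens_lift (fun a' a => lift (fun a0 h => (a' * a0) ⊗ h) (δ a)).

Lemma canonical_map_balanced :
  balanced (fun a b => a * (b : A) : A) (fun b a => (b : A) * a : A)
    (fun a' a => lift (fun a0 h => (a' * a0) ⊗ h) (δ a)).
Proof.
have fr a' a0 : linear (fun h => (a' * a0) ⊗ h : (A ⊗ H)%type).
  exact: pure_linear_r.
have fl a' h : linear (fun a0 => (a' * a0) ⊗ h : (A ⊗ H)%type).
  by move=> c x y; rewrite mulrDr -scalerAr pure_linear_l.
split=> [a' c x y|a c x y|a' b a].
- by rewrite coact_linear (lift_linear (fr a') (fl a')).
- apply: tens_lift_comb => a0 h.
  by rewrite mulrDl -scalerAl pure_linear_l.
rewrite (coact_morph A).2 (coinvP _ (valP b)) [δ a in RHS]tens_span mulr_sumr.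
rewrite (linear_big _ _ (lift_linear (fr a') (fl a'))).
rewrite {1}/lift /tens_lift /eval_sum; apply: eq_bigr => p _.
rewrite [X in lift _ X](mul_pureE (b : A) p.1 1 p.2) mul1r.
by rewrite (lift_pure (fr a') (fl a')) mulrA.
Qed.

Lemma canonical_map_linear : linear canonical_map.
Proof. exact: tens_lift_linear canonical_map_balanced. Qed.

Definition hopf_galois : Prop := bijective canonical_map.

(* The inverse image of 1 ⊗ h; the default value 0 is never used under
   [hopf_galois]. *)
Definition translation h : AoverB := xget 0 [set t | canonical_map t = 1 ⊗ h]%classic.

Lemma translation_spec h : hopf_galois -> canonical_map (translation h) = 1 ⊗ h.
Proof.
case=> g _ gK; rewrite /translation; case: xgetP => [t _ //|].
by move=> /(_ (g (1 ⊗ h))) []; apply: gK.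
Qed.

Lemma translation_linear : hopf_galois -> linear translation.
Proof.
move=> hg c x y; apply: (bij_inj hg).
rewrite canonical_map_linear !translation_spec //.
exact: pure_linear_r.
Qed.

(* C ⊗_B C, for the B-bimodule structure b |> X <| b' = s(b) t(b') X *)
Definition ESoverB := tens (fun X b => tgt b * X : ES) (fun b X => src b * X : ES).
HB.instance Definition _ := GRing.Lmodule.on ESoverB.

(* The canonical map C ⊗_B C -> A ⊗ (A ⊗_B A) ⊗ A,
   (x ⊗ x') ⊗_B (y ⊗ y') |-> x ⊗ (x' ⊗_B y) ⊗ y'. *)
Definition ESoverB_incl : ESoverB -> A ⊗ (AoverB ⊗ A) :=
  tens_lift (fun X Y =>
    lift (fun x x' : A => lift (fun y y' : A =>
      (x : A) ⊗ ((tens_pure _ _ x' y : AoverB) ⊗ y')) Y) X).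

Lemma ESoverB_incl_balanced :
  balanced (fun X b => tgt b * X : ES) (fun b X => src b * X : ES)
    (fun X Y => lift (fun x x' : A => lift (fun y y' : A =>
      (x : A) ⊗ ((tens_pure _ _ x' y : AoverB) ⊗ y')) Y) X).
Proof.
pose F (x x' y y' : A) := x ⊗ ((tens_pure _ _ x' y : AoverB) ⊗ y').
have [pr pl pb] := tens_pure_balanced
  (fun a b => a * (b : A) : A) (fun b a => (b : A) * a : A).
have Fyr x x' y : linear (fun y' : A^c => F x x' y y').
  by move=> c u v; rewrite /F pure_linear_r pure_linear_r.
have Fyl x x' (y' : A^c) : linear (fun y => F x x' y y').
  move=> c u v; rewrite /F -pure_linear_r -pure_linear_l.
  by congr (_ ⊗ (_ ⊗ _)); exact: pr.
have Fl x x' := lift_linear (Fyr x x') (Fyl x x').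
have Gr (Y : A ⊗ A^c) x : linear (fun x' : A^c => lift (F x x') Y).
  move=> c u v; apply: tens_lift_comb => y y'.
  rewrite /F -pure_linear_r -pure_linear_l.
  by congr (_ ⊗ (_ ⊗ _)); exact: pl.
have Gl (Y : A ⊗ A^c) (x' : A^c) : linear (fun x => lift (F x x') Y).
  by move=> c u v; apply: tens_lift_comb => y y'; rewrite /F pure_linear_l.
have Gl2 Y := lift_linear (Gr Y) (Gl Y).
split=> [X c Y Z|Y c X Z|X b Y].
- by apply: tens_lift_comb => x x'; rewrite Fl.
- by rewrite Gl2.
have -> : (tgt b * X : A ⊗ A^c) =
    \sum_(p <- tens_repr (X : A ⊗ A^c)) p.1 ⊗ ((p.2 : A) * (b : A) : A^c).
  transitivity (es_val (tgt b) * es_val X) => //.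
  rewrite {1}[es_val X]tens_span mulr_sumr.
  by apply: eq_bigr => p _; rewrite [LHS]mul_pureE mul1r.
have -> : (src b * Y : A ⊗ A^c) =
    \sum_(p <- tens_repr (Y : A ⊗ A^c)) ((b : A) * (p.1 : A)) ⊗ (p.2 : A^c).
  transitivity (es_val (src b) * es_val Y) => //.
  rewrite {1}[es_val Y]tens_span mulr_sumr.
  by apply: eq_bigr => p _; rewrite [LHS]mul_pureE mul1r.
rewrite (linear_big _ _ (Gl2 Y)); apply: eq_bigr => p _.
rewrite (lift_pure (Gr Y) (Gl Y)) (linear_big _ _ (Fl _ _)).
apply: eq_bigr => q _; rewrite (lift_pure (Fyr _ _) (Fyl _ _)).
by congr (_ ⊗ (_ ⊗ _)); exact: pb.
Qed.

Definition coproduct_formula X : A ⊗ (AoverB ⊗ A) :=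
  lift (fun a a' : A => lift (fun a0 h => a0 ⊗ (translation h ⊗ a')) (δ a)) X.

(* The element of C ⊗_B C that the canonical map sends to
   a_(0) ⊗ tau(a_(1)) ⊗ a'.  For a faithfully flat Hopf-Galois extension that
   map is injective and such an element exists. *)
Definition coproduct X : ESoverB :=
  xget 0 [set T | ESoverB_incl T = coproduct_formula X]%classic.

Record is_bisection (sigma : ES -> B) : Prop := IsBisection {
  bis_linear : linear sigma;
  bis_unit : sigma 1 = 1;
  bis_bimod : forall b b' X, sigma (src b * (tgt b' * X)) = b * sigma X * b';
  bis_mul : forall X Y, sigma (X * src (sigma Y)) = sigma (X * Y)
}.

Record bisection := Bisection {
  bis_map :> ES -> B; bisP : is_bisection bis_map }.

Definition convolution (sigma1 sigma2 : ES -> B) X : B :=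
  tens_lift (fun X1 X2 => sigma1 X1 * sigma2 X2) (coproduct X).

Lemma convolution_balanced (sigma1 sigma2 : ES -> B) :
  is_bisection sigma1 -> is_bisection sigma2 ->
  balanced (fun X b => tgt b * X : ES) (fun b X => src b * X : ES)
    (fun X1 X2 => sigma1 X1 * sigma2 X2).
Proof.
move=> h1 h2.
have src1 : src 1 = 1 by apply: val_inj.
have tgt1 : tgt 1 = 1 by apply: val_inj.
split=> [X c Y Z|Y c X Z|X b Y].
- by rewrite (bis_linear h2) mulrDr -scalerAr.
- by rewrite (bis_linear h1) mulrDl -scalerAl.
have := bis_bimod h1 1 b X; rewrite src1 !mul1r => ->.
by have := bis_bimod h2 b 1 Y; rewrite tgt1 mul1r mulr1 => ->; rewrite mulrA.
Qed.

Record is_automorphism (Phi : ES -> ES) (phi : B -> B) : Prop :=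
  IsAutomorphism {
  aut_bij : bijective Phi;
  aut_linear : linear Phi;
  aut_morph : GRing.monoid_morphism Phi;
  base_aut_bij : bijective phi;
  base_aut_linear : linear phi;
  base_aut_morph : GRing.monoid_morphism phi;
  aut_src : forall b, Phi (src b) = src (phi b);
  aut_tgt : forall b, Phi (tgt b) = tgt (phi b);
  aut_coproduct : forall X,
    tens_lift (fun X1 X2 => tens_pure _ _ (Phi X1) (Phi X2) : ESoverB)
      (coproduct X) = coproduct (Phi X);
  aut_counit : forall X, counit (Phi X) = phi (counit X)
}.

Record automorphism := Automorphism {
  aut_map : ES -> ES; aut_base : B -> B;
  autP : is_automorphism aut_map aut_base }.

End Bialgebroid.

Section FaithfullyFlat.
Variables (k : fieldType) (B : algType k).

(* A left B-module regarded as a k-vector space *)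
Definition restrict (M : lmodType B) : Type := M.
HB.instance Definition _ (M : lmodType B) := GRing.Zmodule.on (restrict M).

Section Restrict.
Variable M : lmodType B.

Let scale (c : k) (m : restrict M) : restrict M := (c%:A : B) *: (m : M).

Let scaleA a b v : scale a (scale b v) = scale (a * b) v.
Proof. by rewrite /scale scalerA -scalerAl mul1r scalerA. Qed.

Let scale1 : left_id 1 scale.
Proof. by move=> v; rewrite /scale !scale1r. Qed.

Let scaleDr : right_distributive scale +%R.
Proof. by move=> a u v; rewrite /scale scalerDr. Qed.

Let scaleDl v : {morph scale^~ v : a b / a + b}.
Proof. by move=> a b; rewrite /scale !scalerDl. Qed.

HB.instance Definition _ := GRing.Zmodule_isLmodule.Build k (restrict M)
  scaleA scale1 scaleDr scaleDl.
End Restrict.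

Variables (E : lmodType k) (ra : E -> B -> E).

(* E is a right B-module through [ra]; [base_tens M] is E ⊗_B M. *)
Definition base_tens (M : lmodType B) :=
  tens ra (fun (b : B) (m : restrict M) => (b *: (m : M) : restrict M)).

Definition base_tens_map (M N : lmodType B) (f : M -> N) :
    base_tens M -> base_tens N :=
  tens_lift (fun (x : E) (m : restrict M) =>
    (tens_pure _ _ x (f m : restrict N) : base_tens N)).

Lemma base_tens_map_balanced (M N : lmodType B) (f : {linear M -> N}) :
  balanced ra (fun (b : B) (m : restrict M) => (b *: (m : M) : restrict M))
    (fun (x : E) (m : restrict M) =>
      (tens_pure _ _ x (f m : restrict N) : base_tens N)).
Proof.
have [pr pl pb] := tens_pure_balanced ra
  (fun (b : B) (n : restrict N) => (b *: (n : N) : restrict N)).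
split=> [x c m n|m c x y|x b m] /=.
- have -> : f (c *: m + n) = (c *: (f m : restrict N) + f n : restrict N).
    exact: linearP.
  exact: pr.
- exact: pl.
- by rewrite [LHS]pb linearZ.
Qed.

(* Exactness of U -> V -> W at V *)
Definition exact (U V W : zmodType) (f : U -> V) (g : V -> W) : Prop :=
  forall y, g y = 0 <-> exists x, f x = y.

Definition faithfully_flat : Prop :=
  forall (M N P : lmodType B) (f : {linear M -> N}) (g : {linear N -> P}),
    exact f g <-> exact (base_tens_map f) (base_tens_map g).

End FaithfullyFlat.

Definition crossed_module (M N : groupType) (mu : M -> N) (alpha : N -> M -> M) : Prop :=
  [/\ {morph mu : x y / (x * y)%g},
      forall n, bijective (alpha n) /\ {morph alpha n : x y / (x * y)%g},
      forall n n' m, alpha (n * n')%g m = alpha n (alpha n' m),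
      forall n m, mu (alpha n m) = (n * mu m * n^-1)%g
    & forall m m', alpha (mu m) m' = (m * m' * m^-1)%g].

Section AutomorphismGroup.
Variables (k : fieldType) (H : hopf_algebra k) (A : comodule_algebra H).
Implicit Types f g : automorphism A.

HB.instance Definition _ := gen_eqMixin (automorphism A).
HB.instance Definition _ := gen_choiceMixin (automorphism A).

Let pureT (X Y : ES A) : ESoverB A := tens_pure _ _ X Y.

Let pureT_balanced : balanced (fun X b => tgt b * X : ES A)
  (fun b X => src b * X : ES A) pureT.
Proof. exact: tens_pure_balanced. Qed.

Lemma automorphism_balanced (Phi : ES A -> ES A) (phi : base A -> base A) :
  is_automorphism Phi phi ->
  balanced (fun X b => tgt b * X : ES A) (fun b X => src b * X : ES A)
    (fun X1 X2 => tens_pure _ _ (Phi X1) (Phi X2) : ESoverB A).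
Proof.
move=> h; have [br bl bb] := pureT_balanced.
split=> [x c y z|y c x z|x s y] /=.
- by rewrite (aut_linear h) [LHS]br.
- by rewrite (aut_linear h) [LHS]bl.
by rewrite !(aut_morph h).2 (aut_src h) (aut_tgt h) [LHS]bb.
Qed.

Lemma automorphism_eq f g :
  aut_map f =1 aut_map g -> aut_base f =1 aut_base g -> f = g.
Proof.
case: f g => [F p Fp] [G q Gq] /= /funext FG /funext pq.
by move: Fp Gq; rewrite FG pq => Fp Gq; congr Automorphism.
Qed.

Lemma id_is_automorphism : is_automorphism (@id (ES A)) (@id (base A)).
Proof.
split=> //; try by exists id.
move=> X; have := tens_lift_unique (g := idfun : {linear ESoverB A -> ESoverB A}).
by move=> /(_ pureT) -> .
Qed.

Lemma comp_is_automorphism f g :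
  is_automorphism (aut_map f \o aut_map g) (aut_base f \o aut_base g).
Proof.
case: f g => [F p Fp] [G q Gq] /=.
split.
- exact: bij_comp (aut_bij Fp) (aut_bij Gq).
- by move=> c x y /=; rewrite (aut_linear Gq) (aut_linear Fp).
- split=> [|x y] /=; first by rewrite (aut_morph Gq).1 (aut_morph Fp).1.
  by rewrite (aut_morph Gq).2 (aut_morph Fp).2.
- exact: bij_comp (base_aut_bij Fp) (base_aut_bij Gq).
- by move=> c x y /=; rewrite (base_aut_linear Gq) (base_aut_linear Fp).
- split=> [|x y] /=; first by rewrite (base_aut_morph Gq).1 (base_aut_morph Fp).1.
  by rewrite (base_aut_morph Gq).2 (base_aut_morph Fp).2.
- by move=> b /=; rewrite (aut_src Gq) (aut_src Fp).
- by move=> b /=; rewrite (aut_tgt Gq) (aut_tgt Fp).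
- move=> X /=; rewrite -(aut_coproduct Fp) -(aut_coproduct Gq).
  have bF := automorphism_balanced Fp.
  rewrite (linear_tens_lift _ _ (tens_lift_linear bF)).
  by apply: eq_tens_lift => Y Z; rewrite tens_lift_pure.
by move=> X /=; rewrite (aut_counit Fp) (aut_counit Gq).
Qed.

Lemma inv_is_automorphism (F F' : ES A -> ES A) (p p' : base A -> base A) :
  is_automorphism F p -> cancel F F' -> cancel F' F ->
  cancel p p' -> cancel p' p -> is_automorphism F' p'.
Proof.
move=> h FK F'K pK p'K; have [Fi pi] := (can_inj FK, can_inj pK).
split.
- by exists F.
- by move=> c x y; apply: Fi; rewrite (aut_linear h) !F'K.
- by split=> [|x y]; apply: Fi; rewrite ?(aut_morph h).1 ?(aut_morph h).2 !F'K.
- by exists p.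
- by move=> c x y; apply: pi; rewrite (base_aut_linear h) !p'K.
- by split=> [|x y]; apply: pi;
    rewrite ?(base_aut_morph h).1 ?(base_aut_morph h).2 !p'K.
- by move=> b; apply: Fi; rewrite F'K (aut_src h) p'K.
- by move=> b; apply: Fi; rewrite F'K (aut_tgt h) p'K.
- move=> X; rewrite -{1}[X]F'K -(aut_coproduct h).
  have b' : balanced (fun X b => tgt b * X : ES A) (fun b X => src b * X : ES A)
      (fun X1 X2 => pureT (F' X1) (F' X2)).
    have [br bl bb] := pureT_balanced.
    have F'l : linear F' by move=> c x y; apply: Fi; rewrite (aut_linear h) !F'K.
    split=> [x c y z|y c x z|x s y] /=.
    + by rewrite F'l [LHS]br.
    + by rewrite F'l [LHS]bl.
    have -> : F' (tgt s * x) = tgt (p' s) * F' x.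
      by apply: Fi; rewrite (aut_morph h).2 (aut_tgt h) !F'K p'K.
    have -> : F' (src s * y) = src (p' s) * F' y.
      by apply: Fi; rewrite (aut_morph h).2 (aut_src h) !F'K p'K.
    exact: bb.
  rewrite (linear_tens_lift _ _ (tens_lift_linear b')).
  rewrite [RHS]tens_span; apply: eq_bigr => r _.
  by rewrite tens_lift_pure // /pureT !FK.
by move=> X; apply: pi; rewrite p'K -(aut_counit h) F'K.
Qed.

Definition aut_one : automorphism A := Automorphism id_is_automorphism.

Definition aut_mul f g : automorphism A :=
  Automorphism (comp_is_automorphism f g).

Lemma aut_inv_exists f :
  exists g : automorphism A, aut_mul g f = aut_one /\ aut_mul f g = aut_one.
Proof.
have [F' FK F'K] := aut_bij (autP f); have [p' pK p'K] := base_aut_bij (autP f).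
exists (Automorphism (inv_is_automorphism (autP f) FK F'K pK p'K)).
by split; apply: automorphism_eq => x /=.
Qed.

Definition aut_inv f : automorphism A := projT1 (cid (aut_inv_exists f)).

Let aut_mulA : associative aut_mul.
Proof. by move=> f g h; apply: automorphism_eq. Qed.

Let aut_mul1 : left_id aut_one aut_mul.
Proof. by move=> f; apply: automorphism_eq. Qed.

Let aut_mulr1 : right_id aut_one aut_mul.
Proof. by move=> f; apply: automorphism_eq. Qed.

Let aut_mulV : left_inverse aut_one aut_inv aut_mul.
Proof. by move=> f; rewrite /aut_inv; case: cid => g []. Qed.

Let aut_mulrV : right_inverse aut_one aut_inv aut_mul.
Proof. by move=> f; rewrite /aut_inv; case: cid => g []. Qed.

HB.instance Definition _ := isGroup.Build (automorphism A)
  aut_mulA aut_mul1 aut_mulr1 aut_mulV aut_mulrV.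

End AutomorphismGroup.

(* Main.v *)
(* Bisections sigma of C = C(A, H) correspond to gauge transformations: unital
   algebra maps F : A -> A that are H-colinear and fix B, through
   sigma (x ⊗ x') = F(x) x'.  Under this correspondence convolution becomes
   reversed composition, F is inverted by a |-> a_(0) F(h<1>) h<2> with
   h<1> ⊗_B h<2> = tau(a_(1)), an automorphism is attached to F by F ⊗ F, and
   Aut(C) acts on bisections by sigma |-> phi sigma Phi^-1.  The map F ⊗ F is
   the composite of X |-> s(sigma(X_(1))) X_(2) and of the inverse of
   X |-> t(sigma(X_(2))) X_(1), which makes it natural under Aut(C).

   To recover F from sigma one needs that (x ⊗ x') ⊗_B a |-> x ⊗ x' a is a
   bijection theta : C ⊗_B A -> A ⊗ A; then F(x) is the image of
   theta^-1 (x ⊗ 1) under X ⊗_B a |-> sigma(X) a.  The coproduct is controlled by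
   kappa : C ⊗_B C -> A ⊗ A ⊗ A, (x ⊗ x') ⊗_B (y ⊗ y') |-> x ⊗ x' y ⊗ y': it is
   injective and Delta (x ⊗ x') is the only preimage of x ⊗ 1 ⊗ x'.

   Faithful flatness is on the right while both statements concern functors
   - ⊗_B A.  The way out is that C is also a left B-module by multiplication on
   its last leg, x ⊗ b x'.  As C = {x_(0) ⊗ S(x_(1)) ⊗ x' = x ⊗ x'_(1) ⊗ x'_(0)},
   flatness gives A ⊗_B C = A ⊗ A by a ⊗_B (x ⊗ x') |-> x ⊗ a x', with inverse
   w ⊗ c |-> c tau(S(w_(1))) having w_(0) inserted in the middle.  Hence theta
   and kappa become explicitly invertible after applying A ⊗_B -; the antipode
   need not be bijective. *)
Require Import Defs.
From HB Require Import structures.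
From mathcomp Require Import all_boot all_algebra.
From mathcomp Require Import boolp classical_sets.
From mathcomp Require Import reals complex.
(* Shadows [fintype.lift] by the [lift] of tensor products. *)
Import Defs.

Set Implicit Arguments.
Unset Strict Implicit.
Unset Printing Implicit Defensive.

Import GRing.Theory.

Local Open Scope ring_scope.

(** * Linear and balanced maps *)

Section LinearMaps.
Variable k : fieldType.
Implicit Types U V W M N : lmodType k.

Lemma lin0 U V (f : U -> V) : linear f -> f 0 = 0.
Proof. by move=> fl; have := fl (-1) 0 0; rewrite !scaleN1r oppr0 addr0 addNr. Qed.

Lemma linD U V (f : U -> V) x y : linear f -> f (x + y) = f x + f y.
Proof. by move=> fl; have := fl 1 x y; rewrite !scale1r. Qed.

Lemma linZ U V (f : U -> V) c x : linear f -> f (c *: x) = c *: f x.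
Proof. by move=> fl; have := fl c x 0; rewrite addr0 (lin0 fl) addr0. Qed.

Lemma lin_id U : linear (fun x : U => x).
Proof. by []. Qed.

Lemma lin_comp U V W (g : V -> W) (f : U -> V) :
  linear g -> linear f -> linear (fun x => g (f x)).
Proof. by move=> gl fl c x y; rewrite fl gl. Qed.

Lemma lin_add U V (f g : U -> V) :
  linear f -> linear g -> linear (fun x => f x + g x).
Proof. by move=> fl gl c x y; rewrite fl gl scalerDr addrACA. Qed.

Lemma lin_opp U V (f : U -> V) : linear f -> linear (fun x => - f x).
Proof. by move=> fl c x y; rewrite fl opprD scalerN. Qed.

Lemma lin_scale U V (a : k) (f : U -> V) :
  linear f -> linear (fun x => a *: f x).
Proof. by move=> fl c x y; rewrite fl scalerDr !scalerA mulrC. Qed.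

Lemma lin_scalar U V (f : U -> k) (v : V) :
  scalar f -> linear (fun x => f x *: v).
Proof. by move=> fl c x y; rewrite fl scalerDl scalerA. Qed.

Lemma lin_mul_l U (R : algType k) (f : U -> R) (a : R) :
  linear f -> linear (fun x => f x * a).
Proof. by move=> fl c x y; rewrite fl mulrDl -scalerAl. Qed.

Lemma lin_mul_r U (R : algType k) (f : U -> R) (a : R) :
  linear f -> linear (fun x => a * f x).
Proof. by move=> fl c x y; rewrite fl mulrDr -scalerAr. Qed.

Lemma lin_pure_l U M N (f : U -> M) (y : N) :
  linear f -> linear (fun x => f x ⊗ y).
Proof. by move=> fl c u v; rewrite fl pure_linear_l. Qed.

Lemma lin_pure_r U M N (f : U -> N) (x : M) :
  linear f -> linear (fun u => x ⊗ f u).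
Proof. by move=> fl c u v; rewrite fl pure_linear_r. Qed.

Lemma lin_lift U M N V (g : M -> N -> V) (f : U -> M ⊗ N) :
  (forall x, linear (g x)) -> (forall y, linear (fun x => g x y)) ->
  linear f -> linear (fun u => lift g (f u)).
Proof. by move=> g1 g2 fl c u v; rewrite fl (lift_linear g1 g2). Qed.

Lemma lin_lift_fun U M N V (g : U -> M -> N -> V) (t : M ⊗ N) :
  (forall x y, linear (fun u => g u x y)) -> linear (fun u => lift (g u) t).
Proof. by move=> gl c u v; apply: tens_lift_comb => x y; rewrite gl. Qed.

Section Balanced.
Variables (S : Type) (M N : lmodType k) (ra : M -> S -> M) (la : S -> N -> N).

Lemma lin_tpure_l U (f : U -> M) (y : N) :
  linear f -> linear (fun x => tens_pure ra la (f x) y).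
Proof.
have [_ pl _] := tens_pure_balanced ra la.
by move=> fl c u v; rewrite fl; exact: pl.
Qed.

Lemma lin_tpure_r U (f : U -> N) (x : M) :
  linear f -> linear (fun u => tens_pure ra la x (f u)).
Proof.
have [pr _ _] := tens_pure_balanced ra la.
by move=> fl c u v; rewrite fl; exact: pr.
Qed.

Lemma tpure_bal x s y : tens_pure ra la (ra x s) y = tens_pure ra la x (la s y).
Proof. by have [_ _ pb] := tens_pure_balanced ra la; exact: pb. Qed.

Lemma lin_tlift U V (g : M -> N -> V) (f : U -> tens ra la) :
  balanced ra la g -> linear f -> linear (fun u => tens_lift g (f u)).
Proof. by move=> gb fl c u v; rewrite fl (tens_lift_linear gb). Qed.

Lemma lin_tlift_fun U V (g : U -> M -> N -> V) (t : tens ra la) :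
  (forall x y, linear (fun u => g u x y)) -> linear (fun u => tens_lift (g u) t).
Proof. by move=> gl c u v; apply: tens_lift_comb => x y; rewrite gl. Qed.

Lemma tens_eq V (f g : tens ra la -> V) : linear f -> linear g ->
  (forall x y, f (tens_pure ra la x y) = g (tens_pure ra la x y)) -> f =1 g.
Proof.
move=> fl gl fg; apply: tens_ind => [|t u ft fu|//].
  by rewrite (lin0 fl) (lin0 gl).
by rewrite (linD _ _ fl) (linD _ _ gl) ft fu.
Qed.

End Balanced.

Lemma otimes_eq M N V (f g : M ⊗ N -> V) : linear f -> linear g ->
  (forall x y, f (x ⊗ y) = g (x ⊗ y)) -> f =1 g.
Proof. by move=> fl gl fg; apply: tens_eq. Qed.

Lemma eq_lift M N V (f g : M -> N -> V) : f =2 g -> lift f =1 lift g.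
Proof. exact: eq_tens_lift. Qed.

Lemma lin_of_lift M N V W (L : V -> W) (f : M -> N -> V) (t : M ⊗ N) :
  linear L -> L (lift f t) = lift (fun x y => L (f x y)) t.
Proof. exact: linear_tens_lift. Qed.

Lemma lift_pureE M N (t : M ⊗ N) : lift (fun x y => x ⊗ y) t = t.
Proof. by rewrite [RHS]tens_span. Qed.

Lemma lift_lin M N V (L : M ⊗ N -> V) t : linear L ->
  lift (fun x y => L (x ⊗ y)) t = L t.
Proof. by move=> Ll; rewrite -[t in RHS]lift_pureE lin_of_lift. Qed.

(* Unlike [lin_mul_l] and [lin_mul_r], these use the module structure of the
   tensor product itself; unifying it with that of the algebra is very slow. *)
Lemma lin_omul_l U (R Q : algType k) (f : U -> R ⊗ Q) (a : R ⊗ Q) :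
  linear f -> linear (fun x => f x * a).
Proof. by move=> fl c x y; rewrite fl mulrDl -scalerAl. Qed.

Lemma lin_omul_r U (R Q : algType k) (f : U -> R ⊗ Q) (a : R ⊗ Q) :
  linear f -> linear (fun x => a * f x).
Proof. by move=> fl c x y; rewrite fl mulrDr -scalerAr. Qed.

Lemma lift_swap M N M' N' V (f : M -> N -> M' -> N' -> V) t u :
  lift (fun x y => lift (fun x' y' => f x y x' y') u) t =
  lift (fun x' y' => lift (fun x y => f x y x' y') t) u.
Proof. by rewrite /lift /tens_lift /eval_sum exchange_big. Qed.

End LinearMaps.

Create HintDb lin.

(* Decides [linear (fun x => E)] by recursion on the expression [E]; linearity
   of named maps is looked up in the context and in the database [lin]. *)
Ltac lin :=
  cbn beta;
  lazymatch goal with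
  | |- forall _, _ => intro; lin
  | |- GRing.linear_for ?s ?f =>
  lazymatch f with
  | fun x => _ => idtac
  | _ => change (GRing.linear_for s (fun x => f x))
  end;
  first
  [ match goal with
    | H : GRing.linear_for _ ?F |- GRing.linear_for _ ?F => exact H
    end
  | match goal with
    | |- GRing.linear_for _ (fun x => x) => apply: lin_id
    | |- GRing.linear_for _ (fun x => _ x + _ x) => apply: lin_add; lin
    | |- GRing.linear_for _ (fun x => - _ x) => apply: lin_opp; lin
    | |- GRing.linear_for _ (fun x => pure _ ?y) => apply: lin_pure_l; lin
    | |- GRing.linear_for _ (fun x => pure ?y _) => apply: lin_pure_r; lin
    | |- GRing.linear_for _ (fun x => tens_pure _ _ _ ?y) => apply: lin_tpure_l; lin
    | |- GRing.linear_for _ (fun x => tens_pure _ _ ?y _) => apply: lin_tpure_r; lin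
    | |- GRing.linear_for _ (fun x => lift ?g _) => apply: lin_lift; lin
    | |- GRing.linear_for _ (fun x => lift _ ?t) => apply: lin_lift_fun; lin
    | |- GRing.linear_for _ (fun x => tens_lift _ ?t) => apply: lin_tlift_fun; lin
    | |- GRing.linear_for _ (fun x => tens_lift ?g _) =>
         apply: lin_tlift; [solve [auto with lin nocore]|lin]
    | |- GRing.linear_for _ (fun x => @GRing.mul ?T _ ?y) =>
      lazymatch T with context [otimes] => apply: lin_omul_l; lin
      | _ => apply: lin_mul_l; lin end
    | |- GRing.linear_for _ (fun x => @GRing.mul ?T ?y _) =>
      lazymatch T with context [otimes] => apply: lin_omul_r; lin
      | _ => apply: lin_mul_r; lin end
    | |- GRing.linear_for _ (fun x => ?a *: _) => apply: lin_scale; lin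
    | |- GRing.linear_for _ (fun x => _ *: ?v) => apply: lin_scalar; assumption
    | H : forall a, GRing.linear_for _ (?g a)
      |- GRing.linear_for _ (fun x => ?g ?a (@?f x)) =>
         refine (@lin_comp _ _ _ _ (g a) f (H a) _); lin
    | H : forall b, GRing.linear_for _ (fun y => ?g y b)
      |- GRing.linear_for _ (fun x => ?g (@?f x) ?b) =>
         refine (@lin_comp _ _ _ _ (fun y => g y b) f (H b) _); lin
    | H : forall a b, GRing.linear_for _ (?g a b)
      |- GRing.linear_for _ (fun x => ?g ?a ?b (@?f x)) =>
         refine (@lin_comp _ _ _ _ (g a b) f (H a b) _); lin
    | H : forall a c, GRing.linear_for _ (fun y => ?g a y c)
      |- GRing.linear_for _ (fun x => ?g ?a (@?f x) ?c) =>
         refine (@lin_comp _ _ _ _ (fun y => g a y c) f (H a c) _); lin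
    | H : forall b c, GRing.linear_for _ (fun y => ?g y b c)
      |- GRing.linear_for _ (fun x => ?g (@?f x) ?b ?c) =>
         refine (@lin_comp _ _ _ _ (fun y => g y b c) f (H b c) _); lin
    | |- GRing.linear_for _ (fun x => ?F (@?f x)) =>
         refine (@lin_comp _ _ _ _ F f _ _);
         [first [ match goal with
           | H : GRing.linear_for _ ?F |- GRing.linear_for _ ?F => exact H
           end | solve [auto with lin nocore]] | lin]
    end
  | solve [auto with lin nocore] ]
  end.

(** The kernels of [g] and [g'] correspond under [b], since [c'] is injective and fixes 0; the
    images of [f] and [f'] correspond under [b'], since [a] is onto. *)
Lemma exact_transfer (U V W U' V' W' : zmodType)
    (f : U -> V) (g : V -> W) (f' : U' -> V') (g' : V' -> W')
    (a : U' -> U) (a' : U -> U') (b : V' -> V) (b' : V -> V')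
    (c : W' -> W) (c' : W -> W') :
  cancel a a' -> cancel a' a -> cancel b b' -> cancel b' b ->
  cancel c' c -> c' 0 = 0 ->
  (forall x, f' x = b' (f (a x))) -> (forall y, g' y = c' (g (b y))) ->
  exact f' g' <-> exact f g.
Proof.
move=> aK a'K bK b'K c'K c0 ef eg; split=> ex y.
  have := ex (b' y); rewrite eg b'K => exy; split=> [y0|[x <-]].
    have [|x] := exy.1; first by rewrite y0 c0.
    by rewrite ef => /(can_inj b'K) <-; exists (a x).
  apply: (can_inj c'K); rewrite c0 -[f x]b'K -eg; apply/(ex _).2.
  by exists (a' x); rewrite ef a'K.
have := ex (b y); rewrite eg => exy; split=> [y0|[x xy]].
  have [|x xy] := exy.1; first by apply: (can_inj c'K); rewrite c0.
  by exists (a' x); rewrite ef a'K xy bK.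
by rewrite exy.2 ?c0 //; exists (a x); rewrite -xy ef b'K.
Qed.

(** * Faithfully flat descent *)

Section FibreProduct.
Variables (k : fieldType) (V W P : lmodType k).
Variables (f : {linear V -> P}) (g : {linear W -> P}).

Definition in_fibre_product : {pred V * W} := [pred x | f x.1 == g x.2].

Lemma fibre_product_closed : subsemimod_closed in_fibre_product.
Proof.
split; first split=> [|x y /eqP hx /eqP hy].
- by apply/eqP; rewrite /= !linear0.
- by apply/eqP; rewrite /= !linearD hx hy.
by move=> c x /eqP hx; apply/eqP; rewrite /= !linearZ hx.
Qed.

HB.instance Definition _ :=
  GRing.isSubmodClosed.Build k (V * W)%type in_fibre_product fibre_product_closed.

Record fibre_product := FibreProduct {
  fibre_val :> V * W; _ : fibre_val \in in_fibre_product }.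
HB.instance Definition _ := [isSub for fibre_val].
HB.instance Definition _ := [Choice of fibre_product by <:].
HB.instance Definition _ := [SubChoice_isSubLmodule of fibre_product by <:].

Lemma fibre_val_linear : linear fibre_val.
Proof. by []. Qed.

End FibreProduct.

(** * Flatness for vector spaces carrying a left action *)

Section FlatDescent.
Variables (k : fieldType) (B : algType k) (E : lmodType k) (ra : E -> B -> E).

(** The vector space comes first and the action is data, so that one space such as C can carry
    several actions of B. Linearity in the scalar ties the action to the given k-structure. *)
Record is_action (V : lmodType k) (act : B -> V -> V) : Prop := IsAction {
  act_linear : forall b, linear (act b);
  act_linear_l : forall v, linear (act^~ v);
  act1 : forall v, act 1 v = v;
  actM : forall a b v, act (a * b) v = act a (act b v) }.

Definition action_module (V : lmodType k) (act : B -> V -> V)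
  (h : is_action act) : Type := V.

Section ActionModule.
Variables (V : lmodType k) (act : B -> V -> V) (h : is_action act).

HB.instance Definition _ := GRing.Zmodule.on (action_module h).

Let scale (b : B) (v : action_module h) : action_module h := act b v.

Let scaleA a b v : scale a (scale b v) = scale (a * b) v.
Proof. by rewrite /scale (actM h). Qed.

Let scale1 : left_id 1 scale.
Proof. exact: act1 h. Qed.

Let scaleDr : right_distributive scale +%R.
Proof. by move=> a u v; exact: linD (act_linear h a). Qed.

Let scaleDl v : {morph scale^~ v : a b / a + b}.
Proof. by move=> a b; exact: (linD (f := act^~ v) a b (act_linear_l h v)). Qed.

HB.instance Definition _ := GRing.Zmodule_isLmodule.Build B (action_module h)
  scaleA scale1 scaleDr scaleDl.

(** [restrict] rebuilds the scalars of k through B, as the action of c 1. Linearity of the action in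
    its scalar shows that nothing has changed. *)
Lemma restrict_scale (c : k) (v : restrict (action_module h)) :
  (c *: v : V) = c *: (v : V).
Proof.
rewrite -[LHS]/(act (c *: 1) v).
by rewrite (linZ (f := act^~ v) c 1 (act_linear_l h v)) (act1 h).
Qed.

(** The two tensor products have the same pure tensors, but their k-structures on the second factor
    agree only by [restrict_scale]; hence an explicit isomorphism. *)
Definition of_base_tens : base_tens ra (action_module h) -> tens ra act :=
  tens_lift (fun x (v : restrict (action_module h)) =>
    tens_pure ra act x (v : V)).

Definition to_base_tens : tens ra act -> base_tens ra (action_module h) :=
  tens_lift (fun x (v : V) => (tens_pure _ _ x
    (v : restrict (action_module h)) : base_tens ra (action_module h))).

Let of_balanced : balanced ra
    (fun (b : B) (v : restrict (action_module h)) =>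
       (b *: (v : action_module h) : restrict (action_module h)))
    (fun x (v : restrict (action_module h)) => tens_pure ra act x (v : V)).
Proof.
have [pr pl pb] := tens_pure_balanced ra act.
split=> [x c u v|v|x b v]; last exact: pb; last exact: pl.
by rewrite -[RHS]pr; congr tens_pure; rewrite -restrict_scale.
Qed.

Let to_balanced : balanced ra act (fun x (v : V) => (tens_pure _ _ x
    (v : restrict (action_module h)) : base_tens ra (action_module h))).
Proof.
have [pr pl pb] := tens_pure_balanced ra
  (fun (b : B) (v : restrict (action_module h)) =>
     (b *: (v : action_module h) : restrict (action_module h))).
split=> [x c u v|v|x b v]; last exact: pb; last exact: pl.
by rewrite -[RHS]pr; congr tens_pure; rewrite -restrict_scale.
Qed.

Lemma of_base_tens_linear : linear of_base_tens.
Proof. exact: tens_lift_linear of_balanced. Qed.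

Lemma to_base_tens_linear : linear to_base_tens.
Proof. exact: tens_lift_linear to_balanced. Qed.

Lemma of_base_tens_pure x (v : V) :
  of_base_tens (tens_pure _ _ x (v : restrict (action_module h))) =
  tens_pure ra act x v.
Proof. exact: tens_lift_pure of_balanced _ _. Qed.

Lemma to_base_tens_pure x (v : V) :
  to_base_tens (tens_pure ra act x v) =
  tens_pure _ _ x (v : restrict (action_module h)).
Proof. exact: tens_lift_pure to_balanced _ _. Qed.

Lemma of_base_tensK : cancel of_base_tens to_base_tens.
Proof.
apply: tens_eq => [||x v]; last by rewrite of_base_tens_pure to_base_tens_pure.
  exact: lin_comp to_base_tens_linear of_base_tens_linear.
exact: lin_id.
Qed.

Lemma to_base_tensK : cancel to_base_tens of_base_tens.
Proof.
apply: tens_eq => [||x v]; last by rewrite to_base_tens_pure of_base_tens_pure.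
  exact: lin_comp of_base_tens_linear to_base_tens_linear.
exact: lin_id.
Qed.

End ActionModule.

Arguments of_base_tens_linear {V act} h.
Arguments of_base_tensK {V act} h.
Arguments to_base_tensK {V act} h.
Arguments to_base_tens_linear {V act} h.
Arguments of_base_tens {V act} h.
Arguments to_base_tens {V act} h.

Section Map.
Variables (V W : lmodType k) (actV : B -> V -> V) (actW : B -> W -> W).
Variable f : V -> W.
Hypotheses (fl : linear f) (fB : forall b v, f (actV b v) = actW b (f v)).

Definition etens : tens ra actV -> tens ra actW :=
  tens_lift (fun x v => tens_pure ra actW x (f v)).

Lemma etens_balanced :
  balanced ra actV (fun x v => tens_pure ra actW x (f v)).
Proof. by split=> [||x b v]; rewrite ?fB ?tpure_bal //; lin. Qed.

Lemma etens_linear : linear etens.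
Proof. exact: tens_lift_linear etens_balanced. Qed.

Lemma etens_pure x v : etens (tens_pure _ _ x v) = tens_pure _ _ x (f v).
Proof. exact: tens_lift_pure etens_balanced _ _. Qed.

Lemma etens_base (hV : is_action actV) (hW : is_action actW)
    (g : {linear action_module hV -> action_module hW}) t :
  (g : V -> W) =1 f ->
  base_tens_map g t = to_base_tens hW (etens (of_base_tens hV t)).
Proof.
move=> gf; move: t; apply: tens_eq => [||x v].
- exact: tens_lift_linear (base_tens_map_balanced _ g).
- exact: lin_comp (to_base_tens_linear hW)
    (lin_comp etens_linear (of_base_tens_linear hV)).
rewrite [LHS](tens_lift_pure (base_tens_map_balanced _ g)) of_base_tens_pure.
by rewrite etens_pure to_base_tens_pure; congr tens_pure; exact: gf.
Qed.

End Map.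

Arguments etens {V W} actV actW f.

Lemma etens_comp (U V W : lmodType k) (actU : B -> U -> U) (actV : B -> V -> V)
    (actW : B -> W -> W) (f : U -> V) (g : V -> W) :
  linear f -> (forall b u, f (actU b u) = actV b (f u)) ->
  linear g -> (forall b v, g (actV b v) = actW b (g v)) ->
  forall t, etens actU actW (g \o f) t = etens actV actW g (etens actU actV f t).
Proof.
move=> fl fB gl gB.
have gfl : linear (g \o f) := lin_comp gl fl.
have gfB b u : (g \o f) (actU b u) = actW b ((g \o f) u) by rewrite /= fB gB.
apply: tens_eq => [||x v]; first exact: etens_linear gfl gfB.
  exact: lin_comp (etens_linear gl gB) (etens_linear fl fB).
by rewrite (etens_pure gfl gfB) (etens_pure fl fB) (etens_pure gl gB).
Qed.

Hypothesis ff : faithfully_flat ra.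

Section Exact.
Variables (U V W : lmodType k).
Variables (actU : B -> U -> U) (actV : B -> V -> V) (actW : B -> W -> W).
Hypotheses (hU : is_action actU) (hV : is_action actV) (hW : is_action actW).

(** This is the hypothesis [ff] conjugated by the isomorphisms [of_base_tens] and [to_base_tens]. *)
Lemma exact_etens (f : U -> V) (g : V -> W) :
  linear f -> (forall b u, f (actU b u) = actV b (f u)) ->
  linear g -> (forall b v, g (actV b v) = actW b (g v)) ->
  exact f g <-> exact (etens actU actV f) (etens actV actW g).
Proof.
move=> fl fB gl gB.
have fl' : linear (f : action_module hU -> action_module hV).
  by move=> b u v; rewrite -[RHS]/(actV b (f u) + f v) -fB; exact: linD fl.
have gl' : linear (g : action_module hV -> action_module hW).
  by move=> b u v; rewrite -[RHS]/(actW b (g u) + g v) -gB; exact: linD gl.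
pose F : {linear action_module hU -> action_module hV} :=
  HB.pack f (GRing.isLinear.Build _ _ _ _ _ fl').
pose G : {linear action_module hV -> action_module hW} :=
  HB.pack g (GRing.isLinear.Build _ _ _ _ _ gl').
have eF := etens_base (hV := hU) (hW := hV) fl fB (g := F) ^~ (fun=> erefl).
have eG := etens_base (hV := hV) (hW := hW) gl gB (g := G) ^~ (fun=> erefl).
have := exact_transfer (of_base_tensK hU) (to_base_tensK hU)
  (of_base_tensK hV) (to_base_tensK hV)
  (to_base_tensK hW) (lin0 (to_base_tens_linear hW)) eF eG.
by move=> <-; exact: (ff F G).
Qed.

End Exact.

Section Consequences.
Variables (V W P : lmodType k).
Variables (actV : B -> V -> V) (actW : B -> W -> W) (actP : B -> P -> P).
Hypotheses (hV : is_action actV) (hW : is_action actW) (hP : is_action actP).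

(** The zero module, realised as row vectors of length 0. Exactness of 0 -> V -> W and of V -> W ->
    0 yields the statements on injectivity and surjectivity. *)
Let act0 (b : B) (v : 'rV[k]_0) := v.

Let act0P : is_action act0.
Proof.
split=> // v c x y; rewrite /act0.
by apply/matrixP => i [].
Qed.

Let rV0 (v : 'rV[k]_0) : v = 0.
Proof. by apply/matrixP => i []. Qed.

Let tens0 (t : tens ra act0) : t = 0.
Proof.
move: t; apply: tens_ind => // [t u -> ->|x v]; first by rewrite addr0.
have [pr _ _] := tens_pure_balanced ra act0.
by rewrite [v]rV0; exact: lin0 (pr x).
Qed.

Let zero_linear (U U' : lmodType k) : linear (fun _ : U => 0 : U').
Proof. by move=> c x y; rewrite scaler0 addr0. Qed.

Variable f : V -> W.
Hypotheses (fl : linear f) (fB : forall b v, f (actV b v) = actW b (f v)).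

Let exact0 (Z X Y : lmodType k) (z : Z -> X) (g : X -> Y) :
  (forall u : Z, u = 0) -> linear z -> linear g -> exact z g <-> injective g.
Proof.
move=> Z0 zl gl; split=> [ex x y gxy|gi y].
  apply/eqP; rewrite -subr_eq0; apply/eqP.
  have [|u <-] := (ex (x - y)).1; last by rewrite (Z0 u) (lin0 zl).
  have gN : linear (fun x => - g x) by exact: lin_opp.
  by rewrite (linD _ _ gl) -scaleN1r (linZ _ _ gl) gxy scaleN1r addrN.
split=> [y0|[u <-]]; last by rewrite (Z0 u) (lin0 zl) (lin0 gl).
by exists 0; rewrite (lin0 zl); apply: gi; rewrite y0 (lin0 gl).
Qed.

Lemma injective_etens : injective f <-> injective (etens actV actW f).
Proof.
have zB b (u : 'rV[k]_0) : (0 : V) = actV b 0.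
  by rewrite (lin0 (act_linear hV b)).
pose z (u : 'rV[k]_0) : V := 0.
have zl : linear z by exact: zero_linear.
have := exact_etens act0P hV hW zl (fun b u => zB b u) fl fB.
rewrite !exact0 //; first exact: etens_linear.
exact: etens_linear.
Qed.

Lemma surjective_etens :
  (forall y, exists x, f x = y) <->
  (forall y, exists x, etens actV actW f x = y).
Proof.
pose z (u : W) : 'rV[k]_0 := 0.
have zl : linear z by exact: zero_linear.
have := exact_etens hV hW act0P fl fB zl (fun _ _ => erefl).
case=> h1 h2; split=> h y.
  have [|+ _] := h1 _ y; last by apply; exact: tens0.
  by move=> x; split=> // _; exact: h.
have [|+ _] := h2 _ y; last by apply.
by move=> x; split=> [_|_]; [exact: h | exact: tens0].
Qed.

End Consequences.

Section Image.
Variables (V W P : lmodType k).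
Variables (actV : B -> V -> V) (actW : B -> W -> W) (actP : B -> P -> P).
Hypotheses (hV : is_action actV) (hW : is_action actW) (hP : is_action actP).
Variables (f : {linear V -> P}) (g : {linear W -> P}).
Hypotheses (fB : forall b v, f (actV b v) = actP b (f v)).
Hypotheses (gB : forall b w, g (actW b w) = actP b (g w)).

(* Exactness is applied to the fibre product of [f] and [g]. *)
Let Z := fibre_product f g.

Let actVW b (x : V * W) := (actV b x.1, actW b x.2).

Let actVW_P : is_action actVW.
Proof.
split.
- by move=> b c x y; rewrite /actVW /= (act_linear hV) (act_linear hW).
- move=> v c x y; have h1 := act_linear_l hV v.1 c x y.
  by have h2 := act_linear_l hW v.2 c x y; rewrite /actVW h1 h2.
- by move=> [v w]; rewrite /actVW /= (act1 hV) (act1 hW).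
by move=> a b v; rewrite /actVW /= (actM hV) (actM hW).
Qed.

Let actZ_subproof b (z : Z) : actVW b z \in in_fibre_product f g.
Proof. by apply/eqP; rewrite /= fB gB (eqP (valP z)). Qed.

Let actZ b (z : Z) : Z := FibreProduct (actZ_subproof b z).

Let actZ_P : is_action actZ.
Proof.
have vi : injective (@fibre_val _ _ _ _ f g) by exact: val_inj.
split.
- by move=> b c x y; apply: vi; exact: (act_linear actVW_P).
- by move=> v c x y; apply: vi; exact: (act_linear_l actVW_P).
- by move=> v; apply: vi; exact: (act1 actVW_P).
by move=> a b v; apply: vi; exact: (actM actVW_P).
Qed.

(** Inclusion of images descends. The conclusion says that the projection Z -> W of the fibre
    product is onto, which may be tested after E ⊗_B -. Since Z is the kernel of f - g on V × W, E
    ⊗_B Z maps onto the kernel of the tensored difference, which contains every pair (u, t) with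
    equal images. *)
Lemma image_etens :
  (forall t, exists u, etens actV actP f u = etens actW actP g t) ->
  forall w, exists v, f v = g w.
Proof.
move=> sub; pose i (z : Z) : V * W := z.
have il : linear i by exact: fibre_val_linear.
have vB b z : i (actZ b z) = actVW b (i z) by [].
pose d (x : V * W) := f x.1 - g x.2.
have dl : linear d.
  move=> c x y; rewrite /d /= (linearP f) (linearP g) scalerBr opprD.
  by rewrite addrACA.
have dB b x : d (actVW b x) = actP b (d x).
  rewrite /d /= fB gB (linD _ _ (act_linear hP b)).
  by rewrite -[- g x.2]scaleN1r (linZ _ _ (act_linear hP b)) scaleN1r.
pose p (x : V * W) := x.2.
have pl : linear p by [].
have pB b x : p (actVW b x) = actW b (p x) by [].
have ex := exact_etens actZ_P actVW_P hP il vB dl dB.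
have exid : exact i d.
  move=> x; split=> [/eqP|[z <-]].
    by rewrite subr_eq0 => x0; exists (FibreProduct x0).
  by apply/eqP; rewrite subr_eq0; exact: (valP z).
pose j1 (v : V) : V * W := (v, 0); pose j2 (w : W) : V * W := (0, w).
have j1l : linear j1.
  by move=> c x y; apply: injective_projections; rewrite //= scaler0 addr0.
have j2l : linear j2.
  by move=> c x y; apply: injective_projections; rewrite //= scaler0 addr0.
have j1B b v : j1 (actV b v) = actVW b (j1 v).
  by rewrite /j1 /actVW /= (lin0 (act_linear hW b)).
have j2B b v : j2 (actW b v) = actVW b (j2 v).
  by rewrite /j2 /actVW /= (lin0 (act_linear hV b)).
have surj t : exists z, etens actZ actW (p \o i) z = t.
  have [u ut] := sub t.
  (* The pair (u, t), seen in E ⊗_B (V × W) through the two inclusions. *)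
  pose s := etens actV actVW j1 u + etens actW actVW j2 t.
  have [|z zs] := ((ex.1 exid) s).1.
    rewrite /s (linD _ _ (etens_linear dl dB)) -!etens_comp //.
    have e1 : d \o j1 = f by apply/funext => v; rewrite /d /= linear0 subr0.
    have e2 : d \o j2 = (fun w => - g w).
      by apply/funext => v; rewrite /d /= linear0 sub0r.
    rewrite e1 e2 ut.
    have gN : linear (fun w => - g w) by exact: lin_opp (linearP g).
    have gNB b w : - g (actW b w) = actP b (- g w).
      by rewrite gB -[- g w]scaleN1r (linZ _ _ (act_linear hP b)) scaleN1r.
    move: t {u ut s}; apply: tens_eq => [||x w].
    - by apply: lin_add; apply: etens_linear => //; exact: linearP.
    - by move=> c x y; rewrite scaler0 addr0.
    rewrite (etens_pure (linearP g)) // etens_pure //.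
    have xl : linear (tens_pure ra actP x) by lin.
    by rewrite -(linD _ _ xl) addrN (lin0 xl).
  exists z; rewrite (etens_comp il vB pl pB) zs /s (linD _ _ (etens_linear pl pB)).
  rewrite -!etens_comp //.
  move: u t {ut s zs} => u t.
  have -> : etens actV actW (p \o j1) u = 0.
    have c0 b (v : V) : (p \o j1) (actV b v) = actW b ((p \o j1) v).
      by rewrite /= (lin0 (act_linear hW b)).
    have l0 : linear (p \o j1) := lin_comp pl j1l.
    move: u; apply: tens_eq => [||x v]; first exact: etens_linear l0 c0.
      by move=> c x y; rewrite scaler0 addr0.
    have xl : linear (tens_pure ra actW x) by lin.
    by rewrite (etens_pure l0 c0) (lin0 xl).
  rewrite add0r; move: t; apply: tens_eq => [||x v]; last exact: etens_pure.
    exact: etens_linear.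
  exact: lin_id.
move=> w; have [z zw] := (surjective_etens actZ_P hW (lin_comp pl il)
  (fun b z => pB b (i z))).2 surj w.
by exists (fibre_val z).1; rewrite -zw; exact/eqP/(valP z).
Qed.

End Image.

End FlatDescent.
Arguments etens {k B E ra V W} actV actW f.

(** * Hopf algebra identities *)

Ltac lpure := rewrite lift_pure; [|solve [lin]|solve [lin]].

(* A and A^c have convertible module structures, but unifying tensor products
   that mix the two takes very long; these identity maps keep them apart. *)
Definition to_opp (k : fieldType) (A : algType k) (a : A) : A^c := a.
Definition of_opp (k : fieldType) (A : algType k) (a : A^c) : A := a.

Lemma to_opp_linear (k : fieldType) (A : algType k) : linear (@to_opp k A).
Proof. by []. Qed.

Lemma of_opp_linear (k : fieldType) (A : algType k) : linear (@of_opp k A).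
Proof. by []. Qed.

#[export] Hint Extern 0 (GRing.linear_for _ (@to_opp _ _)) =>
  exact: to_opp_linear : lin.
#[export] Hint Extern 0 (GRing.linear_for _ (@of_opp _ _)) =>
  exact: of_opp_linear : lin.
#[export] Hint Extern 0 (GRing.linear_for _ (coact _)) =>
  exact: coact_linear : lin.
#[export] Hint Extern 0 (GRing.linear_for _ (comul _)) =>
  exact: comul_linear : lin.
#[export] Hint Extern 0 (GRing.linear_for _ (antipode _)) =>
  exact: antipode_linear : lin.

Section HopfIdentities.
Variables (k : fieldType) (H : hopf_algebra k) (A : comodule_algebra H).
Local Notation δ := (coact A).
Local Notation Δ := (comul H).
Local Notation S := (antipode H).

Section Coassociativity.
Variable V : lmodType k.

(** Coassociativity in Sweedler form: [L] evaluates the trilinear map [f] on both sides of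
    [coactA]. *)
Lemma coact_coassoc (f : A -> H -> H -> V) a :
  (forall x g, linear (f x g)) -> (forall x h, linear (fun g => f x g h)) ->
  (forall g h, linear (fun x => f x g h)) ->
  lift (fun a0 a1 => lift (fun x h => f x h a1) (δ a0)) (δ a) =
  lift (fun a0 a1 => lift (f a0) (Δ a1)) (δ a).
Proof.
move=> f3 f2 f1; pose L := lift (fun x t => lift (f x) t).
have Ll : linear L by rewrite /L; lin.
have := congr1 L (coactA a); rewrite /tmap (lin_of_lift _ _ Ll) => e.
transitivity (L (tassoc (lift (fun x y => δ x ⊗ y) (δ a)))).
  move: (δ a); apply: otimes_eq; rewrite /tassoc; try lin.
  move=> x h; lpure; lpure; lpure; move: (δ x); apply: otimes_eq; try lin.
  by move=> y g; lpure; lpure; rewrite /L; lpure; lpure.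
rewrite e; apply: eq_lift => x h; rewrite /L; lpure; done.
Qed.

Lemma comul_coassoc (f : H -> H -> H -> V) a :
  (forall x g, linear (f x g)) -> (forall x h, linear (fun g => f x g h)) ->
  (forall g h, linear (fun x => f x g h)) ->
  lift (fun a0 a1 => lift (fun x h => f x h a1) (Δ a0)) (Δ a) =
  lift (fun a0 a1 => lift (f a0) (Δ a1)) (Δ a).
Proof.
move=> f3 f2 f1; pose L := lift (fun x t => lift (f x) t).
have Ll : linear L by rewrite /L; lin.
have := congr1 L (comulA a); rewrite /tmap (lin_of_lift _ _ Ll) => e.
transitivity (L (tassoc (lift (fun x y => Δ x ⊗ y) (Δ a)))).
  move: (Δ a); apply: otimes_eq; rewrite /tassoc; try lin.
  move=> x h; lpure; lpure; lpure; move: (Δ x); apply: otimes_eq; try lin.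
  by move=> y g; lpure; lpure; rewrite /L; lpure; lpure.
rewrite e; apply: eq_lift => x h; rewrite /L; lpure; done.
Qed.

Lemma coact_counitE (f : A -> V) a : linear f ->
  lift (fun a0 a1 => hcounit H a1 *: f a0) (δ a) = f a.
Proof.
move=> fl; rewrite -[in RHS](coact_counit a) (lin_of_lift _ _ fl).
by apply: eq_lift => x h; rewrite (linZ _ _ fl).
Qed.

End Coassociativity.

Lemma pure_mulE (R Q : algType k) (x : R) (y : Q) t :
  (x ⊗ y) * t = lift (fun u v => (x * u) ⊗ (y * v)) t.
Proof.
move: t; apply: otimes_eq; try lin.
by move=> u v; lpure; rewrite mul_pureE.
Qed.

(** The left side is S(a_(1)) a_(2) ⊗ a_(3); coassociativity groups the first two factors, which the
    antipode axiom collapses. *)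
Lemma antipode_mul_comul a :
  lift (fun c d => (S c ⊗ 1) * Δ d) (Δ a) = 1 ⊗ a.
Proof.
transitivity (lift (fun c d => lift (fun u v => (S c * u) ⊗ v) (Δ d)) (Δ a)).
  by apply: eq_lift => c d; rewrite pure_mulE; apply: eq_lift => u v; rewrite mul1r.
rewrite -comul_coassoc; try lin.
rewrite -[in RHS](comul_counit_l a) lin_of_lift; try lin.
apply: eq_lift => u v.
rewrite -(lin_of_lift (fun c d => S c * d) _ (L := fun z => z ⊗ v)); try lin.
rewrite antipode_l; have l1 : linear (fun z : H => z ⊗ v) by lin.
have l2 : linear (fun z : H => (1 : H) ⊗ z) by lin.
by rewrite (linZ _ _ l1) (linZ _ _ l2).
Qed.

(* Inserting 1 ⊗ a = S(a_(1)) a_(2) ⊗ a_(3) avoids the anticomultiplicativity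
   of the antipode. *)
Lemma antipode_comul x :
  lift (fun g h => (1 ⊗ g) * Δ (S h)) (Δ x) = S x ⊗ 1.
Proof.
transitivity (lift (fun a b => lift (fun c d =>
    (S c ⊗ 1) * Δ d * Δ (S b)) (Δ a)) (Δ x)).
  apply: eq_lift => a b; rewrite -antipode_mul_comul.
  by rewrite (lin_of_lift (L := fun t => t * Δ (S b))) //; lin.
rewrite comul_coassoc; try lin.
rewrite -[in RHS](comul_counit_r x).
have l : linear (fun x => S x ⊗ (1 : H)) by lin.
rewrite (lin_of_lift _ _ l); apply: eq_lift => c r.
rewrite (linZ _ _ l).
(* Multiplicativity of Δ merges Δ(d) Δ(S(b)) into Δ(d S(b)), to which the antipode axiom applies. *)
transitivity ((S c ⊗ 1) * Δ (lift (fun d b => d * S b) (Δ r))).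
  have l' : linear (fun t => (S c ⊗ 1) * Δ t) by lin.
  rewrite (lin_of_lift _ _ l'); apply: eq_lift => d b.
  by rewrite (comul_morph H).2 mulrA.
rewrite antipode_r (linZ _ _ (@comul_linear k H)) (comul_morph H).1.
by rewrite -scalerAr mulr1.
Qed.

Local Notation AA := (A ⊗ A^c)%type.
Local Notation co := (@to_opp k A).
Local Notation oc := (@of_opp k A).

(** Because A^c reverses products, left multiplication by [rmult a] is x ⊗ x' |-> x ⊗ x' a, and
    right multiplication by it is x ⊗ x' |-> x ⊗ a x'. *)
Definition rmult (a : A) : AA := 1 ⊗ co a.

Lemma rmult_linear : linear rmult.
Proof. by rewrite /rmult; lin. Qed.

Lemma rmult1 : rmult 1 = 1.
Proof. by []. Qed.

Lemma rmultM a b : rmult (a * b) = rmult b * rmult a.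
Proof. by rewrite /rmult mul_pureE mul1r. Qed.

Lemma rmult_mul_pure a x x' : rmult a * (x ⊗ x') = x ⊗ co (oc x' * a).
Proof. by rewrite /rmult mul_pureE mul1r. Qed.

Lemma mul_rmult_pure a x x' : (x ⊗ x') * rmult a = x ⊗ co (a * oc x').
Proof. by rewrite /rmult mul_pureE mulr1. Qed.

Lemma coact2E x x' : coact2 A (x ⊗ x') =
  lift (fun a g => lift (fun b h => (a ⊗ co b) ⊗ (g * h)) (δ (oc x'))) (δ x).
Proof. exact: coact2_pure. Qed.

#[local] Hint Extern 0 (GRing.linear_for _ rmult) =>
  exact: rmult_linear : lin.
#[local] Hint Extern 0 (GRing.linear_for _ (coact2 _)) =>
  exact: coact2_linear : lin.

Section Coinvariant.
Variables (V : lmodType k) (X : AA).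
Hypothesis coX : coact2 A X = X ⊗ 1.

Lemma coinv_ext (N : AA ⊗ H -> V) :
  linear N ->
  lift (fun x x' => lift (fun a g => lift (fun b h =>
    N ((a ⊗ co b) ⊗ (g * h))) (δ (oc x'))) (δ x)) X = N (X ⊗ 1).
Proof.
move=> Nl; rewrite -coX; move: (X); apply: otimes_eq.
- by lin.
- exact: lin_comp Nl (@coact2_linear k H A).
move=> x x'; lpure; rewrite coact2E (lin_of_lift _ _ Nl).
by apply: eq_lift => a g; rewrite (lin_of_lift _ _ Nl).
Qed.

(** The identity x_(0) ⊗ S(x_(1)) ⊗ x' = x ⊗ x'_(1) ⊗ x'_(0) on coinvariants, tested on [f]. The map
    [N] multiplies the H-component by S(x_(1)) on the left: at X ⊗ 1 it gives the left side, and at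
    the coaction of X it gives S(x_(1)) x_(2) x'_(1), which is x'_(1). *)
Lemma coinv_antipode (f : A -> H -> A -> V) :
  (forall x g, linear (f x g)) -> (forall x h, linear (fun g => f x g h)) ->
  (forall g h, linear (fun x => f x g h)) ->
  lift (fun x x' => lift (fun a g => f a (S g) (oc x')) (δ x)) X =
  lift (fun x x' => lift (fun b h => f x h b) (δ (oc x'))) X.
Proof.
move=> f3 f2 f1.
pose N (z : AA ⊗ H) := lift (fun t h => lift (fun x x' =>
  lift (fun a g => f a (S g * h) (oc x')) (δ x)) t) z.
have Nl : linear N by rewrite /N; lin.
transitivity (N (X ⊗ 1)).
  rewrite /N; lpure; apply: eq_lift => x x'; apply: eq_lift => a g.
  by rewrite mulr1.
rewrite -(coinv_ext Nl); apply: eq_lift => x x'.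
rewrite lift_swap; apply: eq_lift => b h.
transitivity (lift (fun a g => lift (fun u v => f u (S v * (g * h)) b) (δ a)) (δ x)).
  by apply: eq_lift => a g; rewrite /N; lpure; lpure.
rewrite (coact_coassoc (f := fun u v g => f u (S v * (g * h)) b)); try lin.
rewrite -[RHS](coact_counitE (f := fun x => f x h b)) //.
apply: eq_lift => a0 a1.
transitivity (f a0 (lift (fun v g => S v * g) (Δ a1) * h) b).
  have l : linear (fun y => f a0 (y * h) b) by lin.
  rewrite (lin_of_lift _ _ l); apply: eq_lift => v g.
  by rewrite mulrA.
by rewrite antipode_l -scalerAl mul1r (linZ _ _ (f2 a0 b)).
Qed.

End Coinvariant.

Lemma coact2_rmult a t : coact2 A (rmult a * t) =
  lift (fun b h => lift (fun u g => (rmult b * u) ⊗ (g * h)) (coact2 A t)) (δ a).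
Proof.
move: t; apply: otimes_eq; [lin|lin|move=> x x'].
rewrite rmult_mul_pure !coact2E (coact_morph A).2.
rewrite [RHS](eq_lift (g := fun b h => lift (fun u g => lift (fun v g' =>
  (u ⊗ co (v * b)) ⊗ (g * (g' * h))) (δ (oc x'))) (δ x))); last first.
  move=> b h; rewrite lin_of_lift; [|lin]; apply: eq_lift => u g.
  rewrite lin_of_lift; [|lin]; apply: eq_lift => v g'.
  by lpure; rewrite rmult_mul_pure mulrA.
rewrite [RHS]lift_swap; apply: eq_lift => u g.
pose L t := lift (fun b h => (u ⊗ co b) ⊗ (g * h)) t.
have Ll : linear L by rewrite /L; lin.
rewrite -[LHS]/(L _).
move: (δ (oc x')) (δ a) => p q; move: p; apply: otimes_eq; try lin.
move=> v g'; rewrite pure_mulE (lin_of_lift _ _ Ll).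
by apply: eq_lift => b h; lpure; rewrite /L; lpure.
Qed.

(** In x_(1) x'_(1) a_(1) the factor from [a] comes last, so coinvariance of [t] leaves only
    a_(1). *)
Lemma coact2_rmult_coinv a t : coact2 A t = t ⊗ 1 ->
  coact2 A (rmult a * t) = lift (fun b h => (rmult b * t) ⊗ h) (δ a).
Proof.
move=> ct; rewrite coact2_rmult ct; apply: eq_lift => b h.
by lpure; rewrite mul1r.
Qed.

(** The element b contributes 1 in the middle of x_(1) x'_(1). So the codiagonal coaction respects
    the left B-action on the last leg, and flatness can be applied to it. *)
Lemma coact2_base (b : base A) t :
  coact2 A (t * rmult (base_val b)) =
  lift (fun u g => (u * rmult (base_val b)) ⊗ g) (coact2 A t).
Proof.
move: t; apply: otimes_eq; [lin|lin|move=> x x'].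
rewrite mul_rmult_pure !coact2E (coact_morph A).2 (coinvP _ (valP b)).
rewrite lin_of_lift; [apply: eq_lift => u g|lin].
rewrite lin_of_lift; [|lin]; move: (δ (oc x')); apply: otimes_eq; [lin|lin|].
move=> v h; rewrite mul_pureE mul1r; lpure; lpure; lpure.
by rewrite mul_rmult_pure.
Qed.

End HopfIdentities.

(** * Actions on one leg of a balanced tensor product *)

Section TensorAction.
Variables (k : fieldType) (B : algType k) (S : Type) (M N : lmodType k).
Variables (ra : M -> S -> M) (la : S -> N -> N).

Section Left.
Variables (act : B -> M -> M) (h : is_action act).
Hypothesis act_ra : forall b x s, act b (ra x s) = ra (act b x) s.

(** The action of B on the last leg of C commutes with the bimodule structure used for balancing. It
    therefore survives on C ⊗_B A (as [tact_l]) and on C ⊗_B C (as [tact_r]). *)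
Definition tact_l (b : B) : tens ra la -> tens ra la :=
  tens_lift (fun x y => tens_pure _ _ (act b x) y).

Lemma tact_l_balanced b :
  balanced ra la (fun x y => tens_pure ra la (act b x) y).
Proof.
have al := act_linear h b.
by split=> [||x s y]; [lin|lin|rewrite act_ra tpure_bal].
Qed.

Lemma tact_l_pure b x y : tact_l b (tens_pure _ _ x y) = tens_pure _ _ (act b x) y.
Proof. exact: tens_lift_pure (tact_l_balanced b) _ _. Qed.

Lemma tact_lP : is_action tact_l.
Proof.
have tl b : linear (tact_l b) by exact: tens_lift_linear (tact_l_balanced b).
split=> [//|v|v|a b v].
- rewrite /tact_l; apply: lin_tlift_fun => x y; apply: lin_tpure_l.
  exact: act_linear_l h x.
- move: v; apply: tens_eq => [//||x y]; first exact: lin_id.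
  by rewrite tact_l_pure (act1 h).
- move: v; apply: tens_eq => [//||x y].
    exact: (lin_comp (tl a) (tl b)).
  by rewrite !tact_l_pure (actM h).
Qed.

End Left.

Section Right.
Variables (act : B -> N -> N) (h : is_action act).
Hypothesis act_la : forall b s y, act b (la s y) = la s (act b y).

Definition tact_r (b : B) : tens ra la -> tens ra la :=
  tens_lift (fun x y => tens_pure _ _ x (act b y)).

Lemma tact_r_balanced b :
  balanced ra la (fun x y => tens_pure ra la x (act b y)).
Proof.
have al := act_linear h b.
by split=> [||x s y]; [lin|lin|rewrite act_la tpure_bal].
Qed.

Lemma tact_r_pure b x y : tact_r b (tens_pure _ _ x y) = tens_pure _ _ x (act b y).
Proof. exact: tens_lift_pure (tact_r_balanced b) _ _. Qed.

Lemma tact_rP : is_action tact_r.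
Proof.
have tl b : linear (tact_r b) by exact: tens_lift_linear (tact_r_balanced b).
split=> [//|v|v|a b v].
- rewrite /tact_r; apply: lin_tlift_fun => x y; apply: lin_tpure_r.
  exact: act_linear_l h y.
- move: v; apply: tens_eq => [//||x y]; first exact: lin_id.
  by rewrite tact_r_pure (act1 h).
- move: v; apply: tens_eq => [//||x y].
    exact: (lin_comp (tl a) (tl b)).
  by rewrite !tact_r_pure (actM h).
Qed.

End Right.
End TensorAction.

Arguments tact_l {k B S M N} ra la act b _.
Arguments tact_r {k B S M N} ra la act b _.

#[export] Hint Extern 0 (GRing.linear_for _ (@rmult _ _ _)) =>
  exact: rmult_linear : lin.
#[export] Hint Extern 0 (GRing.linear_for _ (coact2 _)) =>
  exact: coact2_linear : lin.
Lemma base_val_linear (k : fieldType) (H : hopf_algebra k)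
  (A : comodule_algebra H) : linear (@base_val k H A).
Proof. by []. Qed.
Lemma es_val_linear (k : fieldType) (H : hopf_algebra k)
  (A : comodule_algebra H) : linear (@es_val k H A).
Proof. by []. Qed.
#[export] Hint Extern 0 (GRing.linear_for _ (@base_val _ _ _)) =>
  exact: base_val_linear : lin.
#[export] Hint Extern 0 (GRing.linear_for _ (@es_val _ _ _)) =>
  exact: es_val_linear : lin.

(** * The canonical maps of a faithfully flat Hopf-Galois extension *)

Section Galois.
Variables (k : fieldType) (H : hopf_algebra k) (A : comodule_algebra H).
Hypothesis hG : hopf_galois A.
Local Notation B := (base A).
Local Notation δ := (coact A).
Local Notation Δ := (comul H).
Local Notation S := (antipode H).
Local Notation χ := (@canonical_map k H A).
Local Notation AA := (A ⊗ A^c)%type.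
Local Notation co := (@to_opp k A).
Local Notation oc := (@of_opp k A).
Local Notation bv := (@base_val k H A).
Local Notation ES := (ES A).
Local Notation AoverB := (AoverB A).
Local Notation tB := (tens_pure (fun (a : A) (b : base A) => a * (b : A) : A)
  (fun b a => (b : A) * a : A)).
Local Notation rB := (fun (a : A) (b : base A) => a * base_val b : A).

Lemma canonical_map_pure x y : χ (tB x y) = (x ⊗ 1) * δ y.
Proof.
rewrite [LHS](tens_lift_pure (@canonical_map_balanced k H A)) pure_mulE.
by apply: eq_lift => u v; rewrite mul1r.
Qed.

(** The default 0 is never returned, as χ is onto. The form matches that of [translation], so
    [translation h] is convertible to the value at 1 ⊗ h. *)
Definition canonical_inv (z : A ⊗ H) : AoverB :=
  xget 0 [set t | χ t = z]%classic.
Local Notation χi := canonical_inv.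

Lemma canonical_invK z : χ (χi z) = z.
Proof.
case: hG => g _ gK; rewrite /canonical_inv; case: xgetP => [t _ //|].
by move=> /(_ (g z)) []; apply: gK.
Qed.

Lemma canonical_mapK t : χi (χ t) = t.
Proof. by apply: (bij_inj hG); rewrite canonical_invK. Qed.

Lemma canonical_inv_linear : linear χi.
Proof.
by move=> c x y; apply: (bij_inj hG); rewrite canonical_map_linear !canonical_invK.
Qed.

#[local] Hint Extern 0 (GRing.linear_for _ canonical_inv) =>
  exact: canonical_inv_linear : lin.
#[local] Hint Extern 0 (GRing.linear_for _ (@canonical_map _ _ _)) =>
  exact: canonical_map_linear : lin.

Lemma canonical_inv_coact x y : χi ((x ⊗ 1) * δ y) = tB x y.
Proof. by rewrite -canonical_map_pure canonical_mapK. Qed.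

(* Left multiplication by B on the last leg: x ⊗ x' |-> x ⊗ b x' is a product on
   the right in A ⊗ A^c. *)
Definition actAA (b : B) (t : AA) : AA := t * rmult (bv b).
Definition actAAH (b : B) : AA ⊗ H -> AA ⊗ H :=
  lift (fun t h => actAA b t ⊗ h).
Definition actES (b : B) (X : ES) : ES := X * tgt b.

Lemma actAA_P : is_action actAA.
Proof.
split.
- by move=> b; rewrite /actAA; lin.
- by move=> v; rewrite /actAA; lin.
- by move=> v; rewrite /actAA rmult1 mulr1.
by move=> a b v; rewrite /actAA rmultM mulrA.
Qed.

#[local] Hint Extern 0 (GRing.linear_for _ (actAA _)) =>
  exact: (act_linear actAA_P) : lin.

Lemma actAAH_P : is_action actAAH.
Proof.
have l b : linear (actAAH b) by rewrite /actAAH; lin.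
split=> // v.
- rewrite /actAAH; apply: lin_lift_fun => x y; apply: lin_pure_l.
  exact: (act_linear_l actAA_P).
- move: v; apply: otimes_eq; [exact: l|exact: lin_id|move=> t h].
  by rewrite /actAAH; lpure; rewrite (act1 actAA_P).
move=> b w; move: w.
apply: otimes_eq; [exact: l|exact: (lin_comp (l v) (l b))|move=> t h].
by rewrite /actAAH; lpure; lpure; lpure; rewrite (actM actAA_P).
Qed.

Lemma tgt_linear : linear (@tgt k H A).
Proof. by move=> c x y; apply: val_inj; exact: (rmult_linear c (bv x) (bv y)). Qed.
Lemma tgt1 : tgt (1 : B) = 1 :> ES.
Proof. exact: val_inj. Qed.
Lemma tgtM (a b : B) : tgt (a * b) = tgt b * tgt a :> ES.
Proof. by apply: val_inj; exact: (rmultM (bv a) (bv b)). Qed.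
#[local] Hint Extern 0 (GRing.linear_for _ (@tgt _ _ _)) =>
  exact: tgt_linear : lin.

Lemma actES_P : is_action actES.
Proof.
split.
- by move=> b; rewrite /actES; lin.
- by move=> v; rewrite /actES; lin.
- by move=> v; rewrite /actES tgt1 mulr1.
by move=> a b v; rewrite /actES tgtM mulrA.
Qed.

Local Notation rES := (fun (X : ES) (b : B) => tgt b * X).
Local Notation lES := (fun (b : B) (X : ES) => src b * X).
Local Notation lA := (fun (b : B) (a : A) => bv b * a).
Local Notation tS := (tens_pure rES lA).
Local Notation tE := (tens_pure rES lES).
Local Notation ESA := (tens rES lA).
Local Notation AAA := ((A ⊗ A^c) ⊗ A^c)%type.

(* q ⊗_B r |-> q ⊗_B (w ⊗ r) *)
Definition place (w : A) : AoverB -> tens rB actAA :=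
  tens_lift (fun q r => tens_pure rB actAA q (w ⊗ co r)).

Lemma place_balanced w : balanced (fun (a : A) (b : base A) => a * (b : A) : A)
  (fun b a => (b : A) * a : A) (fun q r => tens_pure rB actAA q (w ⊗ co r)).
Proof.
split=> [||q b r]; [lin|lin|].
by rewrite [LHS]tpure_bal /actAA mul_rmult_pure.
Qed.

Definition placeH (w : A) (h : H) : AoverB -> tens rB actAAH :=
  tens_lift (fun q r => tens_pure rB actAAH q ((w ⊗ co r) ⊗ h)).

Lemma placeH_balanced w h : balanced (fun (a : A) (b : base A) => a * (b : A) : A)
  (fun b a => (b : A) * a : A)
  (fun q r => tens_pure rB actAAH q ((w ⊗ co r) ⊗ h)).
Proof.
split=> [||q b r]; [lin|lin|].
rewrite [LHS]tpure_bal /actAAH; lpure.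
by rewrite /actAA mul_rmult_pure.
Qed.

#[local] Hint Extern 0 (GRing.linear_for _ (place _)) =>
  exact: (tens_lift_linear (place_balanced _)) : lin.
#[local] Hint Extern 0 (GRing.linear_for _ (placeH _ _)) =>
  exact: (tens_lift_linear (placeH_balanced _ _)) : lin.

Lemma place_pure w q r : place w (tB q r) = tens_pure rB actAA q (w ⊗ co r).
Proof. exact: tens_lift_pure (place_balanced w) _ _. Qed.

Lemma placeH_pure w h q r :
  placeH w h (tB q r) = tens_pure rB actAAH q ((w ⊗ co r) ⊗ h).
Proof. exact: tens_lift_pure (placeH_balanced w h) _ _. Qed.

Lemma place_linear_l t : linear (place^~ t).
Proof. by rewrite /place; lin. Qed.

Lemma placeH_linear_w h t : linear (fun w => placeH w h t).
Proof. by rewrite /placeH; lin. Qed.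

Lemma placeH_linear_h w t : linear (fun h => placeH w h t).
Proof. by rewrite /placeH; lin. Qed.

Let plw := placeH_linear_w.
Let plh := placeH_linear_h.
Let pl := place_linear_l.

Lemma coact2_actAA b t : coact2 A (actAA b t) = actAAH b (coact2 A t).
Proof. exact: coact2_base. Qed.

(** Through χ, the coaction on the last leg becomes the comultiplication of H: q ⊗_B r_(0) ⊗ r_(1)
    corresponds to q r_(0) ⊗ r_(1) ⊗ r_(2), by coassociativity of δ. *)
Lemma etens_coact2 w t :
  etens actAA actAAH (coact2 A) (place w t) =
  lift (fun w0 w1 => lift (fun a h =>
    lift (fun h1 h2 => placeH w0 (w1 * h2) (χi (a ⊗ h1))) (Δ h)) (χ t)) (δ w).
Proof.
have el := etens_linear (ra := rB) (@coact2_linear k H A) coact2_actAA.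
move: t; apply: tens_eq; [lin|lin|move=> q r].
rewrite place_pure (etens_pure rB (@coact2_linear k H A) coact2_actAA) coact2E.
rewrite lin_of_lift; [apply: eq_lift => w0 w1|lin].
rewrite lin_of_lift; [|lin].
rewrite canonical_map_pure pure_mulE.
rewrite (lin_of_lift (L := lift _)); [|lin].
transitivity (lift (fun u v => lift (fun h1 h2 =>
   placeH w0 (w1 * h2) (χi ((q * u) ⊗ h1))) (Δ v)) (δ r)).
  rewrite -(coact_coassoc (f := fun u v h =>
    placeH w0 (w1 * h) (χi ((q * u) ⊗ v)))); try lin.
  apply: eq_lift => r0 r1.
  rewrite -placeH_pure -canonical_inv_coact pure_mulE.
  rewrite lin_of_lift; [|lin]; rewrite lin_of_lift; [|lin].
  by apply: eq_lift => u v; rewrite mul1r.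
by apply: eq_lift => u v; lpure; rewrite mul1r.
Qed.

(* c tau(S(w_(1))) with w_(0) inserted in the middle *)
Definition psi0 (t : AA) : tens rB actAA :=
  lift (fun w c => lift (fun a g => place a (χi (oc c ⊗ S g))) (δ w)) t.

Lemma psi0_linear : linear psi0.
Proof. by rewrite /psi0; lin. Qed.
#[local] Hint Extern 0 (GRing.linear_for _ psi0) => exact: psi0_linear : lin.

Lemma psi0_pure w c :
  psi0 (w ⊗ c) = lift (fun a g => place a (χi (oc c ⊗ S g))) (δ w).
Proof. by rewrite /psi0; lpure. Qed.

Definition pure1 (t : AA) : AA ⊗ H := t ⊗ 1.

Lemma pure1_linear : linear pure1.
Proof. by rewrite /pure1; lin. Qed.

Lemma pure1_act b t : pure1 (actAA b t) = actAAH b (pure1 t).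
Proof. by rewrite /pure1 /actAAH; lpure. Qed.

Lemma etens_pure1 w t : etens actAA actAAH pure1 (place w t) = placeH w 1 t.
Proof.
have el := etens_linear (ra := rB) pure1_linear pure1_act.
move: t; apply: tens_eq; [lin|lin|move=> q r].
by rewrite place_pure placeH_pure (etens_pure rB pure1_linear pure1_act).
Qed.

(** By [etens_coact2] the coaction yields the pair S(w_(2))_(1) ⊗ w_(1) S(w_(2))_(2), which
    [antipode_comul] reduces to S(w_(1)) ⊗ 1. *)
Lemma psi0_coinv t :
  etens actAA actAAH (coact2 A) (psi0 t) = etens actAA actAAH pure1 (psi0 t).
Proof.
have el1 := etens_linear (ra := rB) pure1_linear pure1_act.
have el := etens_linear (ra := rB) (@coact2_linear k H A) coact2_actAA.
move: t; apply: otimes_eq; [lin|lin|move=> w c].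
rewrite psi0_pure (lin_of_lift _ _ el) (lin_of_lift _ _ el1).
transitivity (lift (fun w0 w1 => lift (fun u v => lift (fun h1 h2 =>
    placeH u (v * h2) (χi (oc c ⊗ h1))) (Δ (S w1))) (δ w0)) (δ w)).
  apply: eq_lift => w0 w1; rewrite etens_coact2 // canonical_invK.
  by apply: eq_lift => u v; lpure.
rewrite (coact_coassoc (f := fun u v w1 => lift (fun h1 h2 =>
    placeH u (v * h2) (χi (oc c ⊗ h1))) (Δ (S w1)))); try lin.
apply: eq_lift => w0 w1; rewrite etens_pure1.
pose L := lift (fun h1 h2 => placeH w0 h2 (χi (oc c ⊗ h1))).
have Ll : linear L by rewrite /L; lin.
transitivity (L (lift (fun g h => (1 ⊗ g) * Δ (S h)) (Δ w1))).
  rewrite (lin_of_lift _ _ Ll); apply: eq_lift => v h.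
  rewrite pure_mulE (lin_of_lift _ _ Ll); apply: eq_lift => h1 h2.
  by rewrite /L; lpure; rewrite mul1r.
by rewrite antipode_comul /L; lpure.
Qed.

(** * The isomorphism of A ⊗_B C with A ⊗ A *)

Hypothesis ff : faithfully_flat rB.

(** C is the kernel of this B-linear map, so flatness identifies A ⊗_B C with the kernel of A ⊗_B D,
    which contains the values of [psi0]. *)
Let D (t : AA) : AA ⊗ H := coact2 A t - pure1 t.

Let Dl : linear D.
Proof. by apply: lin_add; [lin|apply: lin_opp; exact: pure1_linear]. Qed.

Let DB b t : D (actAA b t) = actAAH b (D t).
Proof.
rewrite /D coact2_actAA pure1_act (linD _ _ (act_linear actAAH_P b)).
by rewrite -[- pure1 t]scaleN1r (linZ _ _ (act_linear actAAH_P b)) scaleN1r.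
Qed.

Let vB b (X : ES) : es_val (actES b X) = actAA b (es_val X).
Proof. by []. Qed.

Let exact_val : exact (@es_val k H A) D.
Proof.
move=> t; rewrite /D; split=> [/eqP|[X <-]].
  rewrite subr_eq0 => tX; exists (Es (tX : t \in coinv2 A)) => //.
by apply/eqP; rewrite subr_eq0; exact: (valP X).
Qed.

Lemma etens_val_inj :
  injective (etens actES actAA (@es_val k H A) : tens rB actES -> _).
Proof.
have := injective_etens ff actES_P actAA_P (@es_val_linear k H A) vB.
by move=> <-; exact: val_inj.
Qed.

Lemma psi_subproof t :
  exists u : tens rB actES, etens actES actAA (@es_val k H A) u = psi0 t.
Proof.
have ex := exact_etens ff actES_P actAA_P actAAH_P
  (@es_val_linear k H A) vB Dl DB.
apply/(ex.1 exact_val _).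
transitivity (etens actAA actAAH (coact2 A) (psi0 t) -
  etens actAA actAAH pure1 (psi0 t)).
  have el1 := etens_linear (ra := rB) pure1_linear pure1_act.
  have el := etens_linear (ra := rB) (@coact2_linear k H A) coact2_actAA.
  move: (psi0 t); apply: tens_eq.
  - exact: etens_linear Dl DB.
  - by apply: lin_add; [exact: el|exact: lin_opp].
  move=> x y; rewrite (etens_pure rB Dl DB) (etens_pure rB pure1_linear pure1_act).
  rewrite (etens_pure rB (@coact2_linear k H A) coact2_actAA) /D.
  have xl : linear (tens_pure rB actAAH x) by lin.
  by rewrite (linD _ _ xl) -scaleN1r (linZ _ _ xl) scaleN1r.
by rewrite psi0_coinv subrr.
Qed.

(** The lift of [psi0] to A ⊗_B C. It is unique by [etens_val_inj], so its properties can be checked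
    on [psi0]. *)
Definition psi t := projT1 (cid (psi_subproof t)).

Lemma psiE t : etens actES actAA (@es_val k H A) (psi t) = psi0 t.
Proof. by rewrite /psi; case: cid. Qed.

Lemma psi_linear : linear psi.
Proof.
move=> c x y; apply: etens_val_inj.
rewrite (etens_linear (@es_val_linear k H A) vB) !psiE; exact: psi0_linear.
Qed.

#[local] Hint Extern 0 (GRing.linear_for _ psi) => exact: psi_linear : lin.

(** On C, [coinv_antipode] turns S(x_(1)) into x'_(1), and a x'_(0) ⊗ x'_(1) is the image of a ⊗_B
    x' under χ. *)
Lemma psi_mul_rmult (X : ES) a : psi (es_val X * rmult a) = tens_pure rB actES a X.
Proof.
apply: etens_val_inj; rewrite psiE (etens_pure rB (@es_val_linear k H A) vB).
transitivity (lift (fun w c => lift (fun u g =>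
    place u (χi ((a * oc c) ⊗ S g))) (δ w)) (es_val X)).
  move: (es_val X); apply: otimes_eq; [lin|lin|move=> x x'].
  by lpure; rewrite mul_rmult_pure psi0_pure.
rewrite (coinv_antipode (coinv2P _ (valP X)) (f := fun u g x' =>
  place u (χi ((a * x') ⊗ g)))); try lin.
rewrite -(lift_lin (L := tens_pure rB actAA a)); [|lin].
apply: eq_lift => x x'; rewrite -place_pure -canonical_inv_coact pure_mulE.
rewrite lin_of_lift; [|lin]; rewrite lin_of_lift; [|lin].
by apply: eq_lift => u v; rewrite mul1r.
Qed.

Lemma rmult_actAA a b u : rmult a * actAA b u = actAA b (rmult a * u).
Proof. by rewrite /actAA mulrA. Qed.

Lemma rmult_linear_r a : linear (fun u : AA => rmult a * u).
Proof. by lin. Qed.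

(** From χ(q ⊗_B r) = (q ⊗ 1) δ(r), multiplying r by [a] on the right amounts to multiplying by
    δ(a). *)
Lemma etens_rmult a w t :
  etens actAA actAA (fun u => rmult a * u) (place w t) = place w (χi (χ t * δ a)).
Proof.
have rl := rmult_linear_r a; have rB' := rmult_actAA a.
have el := etens_linear (ra := rB) rl rB'.
move: t; apply: tens_eq; [lin|lin|move=> q r].
rewrite place_pure (etens_pure rB rl rB') rmult_mul_pure canonical_map_pure.
by rewrite -mulrA -(coact_morph A).2 canonical_inv_coact place_pure.
Qed.

Let vl := @es_val_linear k H A.

Section EquivariantPsi.
Variables (f : ES -> ES) (g : AA -> AA).
Hypotheses (fl : linear f) (fB : forall b X, f (actES b X) = actES b (f X)).
Hypotheses (gl : linear g) (gB : forall b t, g (actAA b t) = actAA b (g t)).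
Hypothesis fg : forall X, es_val (f X) = g (es_val X).

Lemma psi_equivariant t :
  etens actAA actAA g (psi0 t) = psi0 (g t) ->
  etens actES actES f (psi t) = psi (g t).
Proof.
move=> gt; apply: etens_val_inj; rewrite -etens_comp // psiE -gt.
have -> : @es_val k H A \o f = g \o @es_val k H A by apply/funext => X /=.
by rewrite (etens_comp vl vB gl gB) psiE.
Qed.

End EquivariantPsi.

Lemma etens_rmult_psi0 a w c :
  etens actAA actAA (fun u => rmult a * u) (psi0 (w ⊗ c)) =
  lift (fun u g => place u (χi ((oc c ⊗ S g) * δ a))) (δ w).
Proof.
have el := etens_linear (ra := rB) (rmult_linear_r a) (rmult_actAA a).
rewrite psi0_pure // (lin_of_lift _ _ el); apply: eq_lift => u g.
by rewrite etens_rmult canonical_invK.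
Qed.

Lemma psi_tgt b t :
  etens actES actES (fun X => tgt b * X) (psi t) = psi (rmult (bv b) * t).
Proof.
have gl := rmult_linear_r (bv b); have gB := rmult_actAA (bv b).
apply: psi_equivariant => //; [by lin|by move=> c X; rewrite /actES mulrA|].
have el := etens_linear (ra := rB) gl gB.
move: t; apply: otimes_eq; [lin|lin|move=> w c].
rewrite etens_rmult_psi0 rmult_mul_pure psi0_pure //.
apply: eq_lift => u g; rewrite (coinvP _ (valP b)).
by rewrite mul_pureE mulr1.
Qed.

Lemma psi_src b t :
  etens actES actES (fun X => src b * X) (psi t) = psi ((bv b ⊗ 1) * t).
Proof.
have gl : linear (fun t : AA => (bv b ⊗ 1) * t) by lin.
have gB c t' : (bv b ⊗ 1) * actAA c t' = actAA c ((bv b ⊗ 1) * t').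
  by rewrite /actAA mulrA.
apply: psi_equivariant => //; [by lin|by move=> c X; rewrite /actES mulrA|].
have el := etens_linear (ra := rB) gl gB.
move: t; apply: otimes_eq; [lin|lin|move=> w c].
rewrite mul_pureE mul1r !psi0_pure // (coact_morph A).2 (coinvP _ (valP b)).
rewrite pure_mulE lin_of_lift; [|lin]; rewrite lin_of_lift; [|lin].
apply: eq_lift => u g; lpure; rewrite mul1r.
move: (χi _); apply: tens_eq; [lin|lin|move=> q r].
by rewrite !place_pure (etens_pure rB gl gB) mul_pureE mul1r.
Qed.

(** * The bijection from C ⊗_B A to A ⊗ A *)

Local Notation acS := (tact_l rES lA actES).

Let acE_rES b (X : ES) c : actES b (tgt c * X) = tgt c * actES b X.
Proof. by rewrite /actES mulrA. Qed.

Let acS_P : is_action acS := tact_lP lA actES_P acE_rES.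

(* (x ⊗ x') ⊗_B a |-> x ⊗ x' a *)
Definition theta : ESA -> AA := tens_lift (fun X a => rmult a * es_val X).

Lemma theta_balanced : balanced rES lA (fun X a => rmult a * es_val X).
Proof. by split=> [||X b a]; [lin|lin|rewrite rmultM -mulrA]. Qed.

Lemma theta_linear : linear theta.
Proof. exact: tens_lift_linear theta_balanced. Qed.
#[local] Hint Extern 0 (GRing.linear_for _ theta) => exact: theta_linear : lin.

Lemma theta_pure X a : theta (tS X a) = rmult a * es_val X.
Proof. exact: tens_lift_pure theta_balanced _ _. Qed.

Lemma theta_act b u : theta (acS b u) = actAA b (theta u).
Proof.
have l1 := act_linear acS_P b.
move: u; apply: tens_eq; [lin|lin|move=> X a].
by rewrite (tact_l_pure lA actES_P acE_rES) !theta_pure /actAA -mulrA.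
Qed.

Let tSl r : linear (fun X : ES => tS X r). Proof. by lin. Qed.
Let tSB r b (X : ES) : tS (actES b X) r = acS b (tS X r).
Proof. by rewrite (tact_l_pure lA actES_P acE_rES). Qed.

(** Lifts w ⊗ q to A ⊗_B C by [psi] and appends r, giving an element of A ⊗_B (C ⊗_B A). Balancing
    over B is the content of [psi_tgt]. *)
Definition zeta (w : A) : AoverB -> tens rB acS :=
  tens_lift (fun q r => etens actES acS (fun X => tS X r) (psi (w ⊗ co q))).

Lemma zeta_balanced w : balanced (fun (a : A) (b : base A) => a * (b : A) : A)
  (fun b a => (b : A) * a : A)
  (fun q r => etens actES acS (fun X => tS X r) (psi (w ⊗ co q))).
Proof.
split=> [q|r|q b r].
- by rewrite /etens; lin.
- have el := etens_linear (ra := rB) (tSl r) (tSB r); lin.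
have -> : w ⊗ co (q * bv b) = rmult (bv b) * (w ⊗ co q).
  by rewrite rmult_mul_pure.
have tl : linear (fun X : ES => tgt b * X) by lin.
have tB' c (X : ES) : tgt b * actES c X = actES c (tgt b * X) by rewrite /actES mulrA.
rewrite -psi_tgt -(etens_comp tl tB' (tSl r) (tSB r)).
by congr (etens _ _ _ _); apply/funext => X /=; rewrite tpure_bal.
Qed.

#[local] Hint Extern 0 (GRing.linear_for _ (zeta _)) =>
  exact: (tens_lift_linear (zeta_balanced _)) : lin.

Lemma zeta_pure w q r :
  zeta w (tB q r) = etens actES acS (fun X => tS X r) (psi (w ⊗ co q)).
Proof. exact: tens_lift_pure (zeta_balanced w) _ _. Qed.

Lemma zeta_linear_l t : linear (fun w => zeta w t).
Proof.
rewrite /zeta; apply: lin_tlift_fun => q r.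
have el := etens_linear (ra := rB) (tSl r) (tSB r); lin.
Qed.

Lemma etens_theta_zeta w t : etens acS actAA theta (zeta w t) =
  lift (fun a g => place a (χi ((1 ⊗ S g) * χ t))) (δ w).
Proof.
have el := etens_linear (ra := rB) theta_linear theta_act.
move: t; apply: tens_eq; [lin|lin|move=> q r].
rewrite zeta_pure -(etens_comp (tSl r) (tSB r) theta_linear theta_act).
have -> : theta \o (fun X => tS X r) = (fun u => rmult r * u) \o @es_val k H A.
  by apply/funext => X /=; rewrite theta_pure.
rewrite (etens_comp vl vB (rmult_linear_r r) (rmult_actAA r)) psiE.
rewrite etens_rmult_psi0; apply: eq_lift => a g.
by rewrite canonical_map_pure mulrA mul_pureE mul1r mulr1.
Qed.

Let zl := zeta_linear_l.

(* a ⊗_B (x ⊗ c) |-> zeta x_(0) (a tau(x_(1)) c), the inverse of A ⊗_B theta *)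
Definition eta0 (a : A) (t : AA) : tens rB acS :=
  lift (fun x c => lift (fun x0 x1 => zeta x0 (χi ((a ⊗ x1) * δ (oc c)))) (δ x)) t.

Lemma eta_balanced : balanced rB actAA eta0.
Proof.
split=> [a|t|a b t].
- by rewrite /eta0; lin.
- by rewrite /eta0; lin.
rewrite /eta0; move: t; apply: otimes_eq; [lin|lin|move=> x c].
rewrite /actAA mul_rmult_pure; lpure; lpure; apply: eq_lift => x0 x1.
by rewrite (coact_morph A).2 (coinvP _ (valP b)) mulrA mul_pureE mulr1.
Qed.

Definition eta : tens rB actAA -> tens rB acS := tens_lift eta0.

Lemma eta_linear : linear eta.
Proof. exact: tens_lift_linear eta_balanced. Qed.

Lemma eta_pure a t : eta (tens_pure rB actAA a t) = eta0 a t.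
Proof. exact: tens_lift_pure eta_balanced _ _. Qed.

(** [eta0] inserts x_(1) and [etens_theta_zeta] puts S(x_(1)) before it; after coassociativity the
    two cancel as S(x_(1)) x_(2). *)
Lemma etaK u : etens acS actAA theta (eta u) = u.
Proof.
have el := etens_linear (ra := rB) theta_linear theta_act; have etl := eta_linear.
move: u; apply: tens_eq; [lin|lin|move=> a t].
rewrite eta_pure /eta0; move: t; apply: otimes_eq; [lin|lin|move=> x c]; lpure.
rewrite lin_of_lift; [|lin].
transitivity (lift (fun x0 x1 => lift (fun u v =>
    place u (χi ((a ⊗ (S v * x1)) * δ (oc c)))) (δ x0)) (δ x)).
  apply: eq_lift => x0 x1; rewrite etens_theta_zeta canonical_invK.
  by apply: eq_lift => u v; rewrite mulrA mul_pureE mul1r.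
rewrite (coact_coassoc (f := fun u v x1 =>
    place u (χi ((a ⊗ (S v * x1)) * δ (oc c))))); try lin.
rewrite -[RHS]place_pure -canonical_inv_coact.
rewrite -(coact_counitE (f := fun x => place x (χi ((a ⊗ 1) * δ (oc c))))); [|lin].
apply: eq_lift => x0 x1.
have l : linear (fun h => place x0 (χi ((a ⊗ h) * δ (oc c)))) by lin.
by rewrite -(linZ _ _ l) -antipode_l (lin_of_lift _ _ l).
Qed.

Lemma thetaK u : eta (etens acS actAA theta u) = u.
Proof.
have el := etens_linear (ra := rB) theta_linear theta_act; have etl := eta_linear.
move: u; apply: tens_eq; [lin|lin|move=> a u].
rewrite (etens_pure rB theta_linear theta_act) eta_pure.
move: u; apply: tens_eq; [by rewrite /eta0; lin|lin|move=> X c].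
rewrite theta_pure.
(* At the coaction of X this is [eta0] of x ⊗ x' c, since δ(x' c) supplies x'_(0) and x_(1) x'_(1).
   At X ⊗ 1 it is [zeta] of a x' ⊗_B c, that is [psi] of x ⊗ a x' with c appended, where
   [psi_mul_rmult] applies. *)
pose N (z : AA ⊗ H) := lift (fun t h => lift (fun x x' =>
  zeta x (χi ((a ⊗ 1) * ((oc x' ⊗ h) * δ c)))) t) z.
have Nl : linear N by rewrite /N; lin.
transitivity (N (es_val X ⊗ 1)).
  have cX : coact2 A (es_val X) = es_val X ⊗ 1 := coinv2P _ (valP X).
  rewrite -(coinv_ext cX Nl).
  move: (es_val X); apply: otimes_eq; [rewrite /eta0; lin|lin|move=> x x'].
  rewrite rmult_mul_pure /eta0; lpure; lpure; apply: eq_lift => x0 x1.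
  rewrite (coact_morph A).2.
  pose L z := zeta x0 (χi ((a ⊗ 1) * (((1 : A) ⊗ x1) * z * δ c))).
  have Ll : linear L by rewrite /L; lin.
  transitivity (L (δ (oc x'))); first by rewrite /L !mulrA mul_pureE mulr1 mul1r.
  rewrite -[δ (oc x') in LHS]lift_pureE (lin_of_lift _ _ Ll).
  by apply: eq_lift => b h; rewrite /L /N; lpure; lpure; rewrite mul_pureE mul1r.
rewrite /N; lpure.
have esl := etens_linear (ra := rB) (tSl c) (tSB c).
transitivity (etens actES acS (fun X => tS X c) (psi (es_val X * rmult a))); last first.
  by rewrite psi_mul_rmult (etens_pure rB (tSl c) (tSB c)).
move: (es_val X); apply: otimes_eq; [lin|lin|move=> x x'].
lpure; rewrite mul_rmult_pure -zeta_pure; congr (zeta _ _).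
by rewrite -canonical_inv_coact mulrA !mul_pureE !mulr1.
Qed.

Lemma theta_bij : bijective theta.
Proof.
have ti : injective theta.
  apply/(injective_etens ff acS_P actAA_P theta_linear theta_act).
  exact: can_inj thetaK.
have ts : forall y, exists x, theta x = y.
  apply/(surjective_etens ff acS_P actAA_P theta_linear theta_act).
  by move=> y; exists (eta y); exact: etaK.
pose g y := projT1 (cid (ts y)).
have gK : cancel g theta by move=> y; rewrite /g; case: cid.
by exists g => // x; apply: ti; rewrite gK.
Qed.

(** * The injection of C ⊗_B C into A ⊗ A ⊗ A, and the coproduct *)

Let acE_lES b c (X : ES) : actES b (src c * X) = src c * actES b X.
Proof. by rewrite /actES mulrA. Qed.

Local Notation acEE := (tact_r rES lES actES).

Let acEE_P : is_action acEE := tact_rP rES actES_P acE_lES.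

Definition actAAA (b : B) : AAA -> AAA := lift (fun t c => t ⊗ co (bv b * oc c)).

Lemma actAAA_P : is_action actAAA.
Proof.
have l b : linear (actAAA b) by rewrite /actAAA; lin.
split=> // v.
- by rewrite /actAAA; lin.
- move: v; apply: otimes_eq; [exact: l|exact: lin_id|move=> t h].
  by rewrite /actAAA; lpure; rewrite mul1r.
move=> b w; move: w.
apply: otimes_eq; [exact: l|exact: (lin_comp (l v) (l b))|move=> t h].
by rewrite /actAAA; lpure; lpure; lpure; rewrite -mulrA.
Qed.
#[local] Hint Extern 0 (GRing.linear_for _ (actAAA _)) =>
  exact: (act_linear actAAA_P) : lin.

Definition kappa_aux (X : ES) : AA -> AAA :=
  lift (fun y y' => (rmult y * es_val X) ⊗ y').

Lemma kappa_aux_linear X : linear (kappa_aux X).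
Proof. by rewrite /kappa_aux; lin. Qed.
#[local] Hint Extern 0 (GRing.linear_for _ (kappa_aux _)) =>
  exact: kappa_aux_linear : lin.

Lemma kappa_aux_pure X y y' :
  kappa_aux X (y ⊗ y') = (rmult y * es_val X) ⊗ y'.
Proof. by rewrite /kappa_aux; lpure. Qed.

Lemma kappa_aux_act X b t : kappa_aux X (actAA b t) = actAAA b (kappa_aux X t).
Proof.
move: t; apply: otimes_eq; [lin|lin|move=> y y'].
rewrite /actAA mul_rmult_pure !kappa_aux_pure /actAAA.
by lpure.
Qed.

(* (x ⊗ x') ⊗_B (y ⊗ y') |-> x ⊗ x' y ⊗ y' *)
Definition kappa : ESoverB A -> AAA :=
  tens_lift (fun X Y => kappa_aux X (es_val Y)).

Lemma kappa_balanced : balanced rES lES (fun X Y => kappa_aux X (es_val Y)).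
Proof.
split=> [X|Y|X b Y]; [lin|by rewrite /kappa_aux; lin|].
rewrite -[es_val (src b * Y)]/((bv b ⊗ 1) * es_val Y).
rewrite -[es_val Y]/(es_val Y : AA).
move: (es_val Y); apply: otimes_eq; [lin|lin|move=> y y'].
by rewrite mul_pureE mul1r !kappa_aux_pure rmultM -mulrA.
Qed.

Lemma kappa_linear : linear kappa.
Proof. exact: tens_lift_linear kappa_balanced. Qed.
#[local] Hint Extern 0 (GRing.linear_for _ kappa) => exact: kappa_linear : lin.

Lemma kappa_pure X Y : kappa (tE X Y) = kappa_aux X (es_val Y).
Proof. exact: tens_lift_pure kappa_balanced _ _. Qed.

Lemma kappa_act b u : kappa (acEE b u) = actAAA b (kappa u).
Proof.
have l1 := act_linear acEE_P b.
move: u; apply: tens_eq; [lin|lin|move=> X Y].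
by rewrite (tact_r_pure rES actES_P acE_lES) !kappa_pure -kappa_aux_act.
Qed.

(** The value of [kappa] at the coproduct, proved in [kappa_coproduct]: the inner legs of x_(0) ⊗
    tau(x_(1)) ⊗ x' multiply to a counit. *)
Definition middle_one (X : ES) : AAA :=
  lift (fun x x' => (x ⊗ co 1) ⊗ x') (es_val X).

Lemma middle_one_linear : linear middle_one.
Proof. by rewrite /middle_one; lin. Qed.

Lemma middle_one_act b X : middle_one (actES b X) = actAAA b (middle_one X).
Proof.
rewrite /middle_one -[es_val (actES b X)]/(actAA b (es_val X)).
move: (es_val X); apply: otimes_eq; [lin|lin|move=> y y'].
by rewrite /actAA mul_rmult_pure /actAAA; lpure; lpure; lpure.
Qed.

Let tEl X : linear (tE X). Proof. by lin. Qed.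
Let tEB X b (Y : ES) : tE X (actES b Y) = acEE b (tE X Y).
Proof. by rewrite (tact_r_pure rES actES_P acE_lES). Qed.

(** X ⊗_B y is completed to X ⊗_B Y by lifting y ⊗ c through [psi]; [psi_src] makes this
    balanced. *)
Definition kappa_inv_aux (c : A) : ESA -> tens rB acEE :=
  tens_lift (fun X y => etens actES acEE (fun Y => tE X Y) (psi (y ⊗ co c))).

Lemma kappa_inv_balanced c : balanced rES lA
  (fun X y => etens actES acEE (fun Y => tE X Y) (psi (y ⊗ co c))).
Proof.
split=> [X|y|X b y].
- by have el := etens_linear (ra := rB) (tEl X) (tEB X); lin.
- by rewrite /etens; lin.
have -> : (bv b * y) ⊗ co c = (bv b ⊗ 1) * (y ⊗ co c).
  by rewrite mul_pureE mul1r.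
have sl : linear (fun X : ES => src b * X) by lin.
have sB' a (Y : ES) : src b * actES a Y = actES a (src b * Y).
  by rewrite /actES mulrA.
rewrite -psi_src -(etens_comp sl sB' (tEl X) (tEB X)).
by congr (etens _ _ _ _); apply/funext => Y /=; rewrite tpure_bal.
Qed.
#[local] Hint Extern 0 (GRing.linear_for _ (kappa_inv_aux _)) =>
  exact: (tens_lift_linear (kappa_inv_balanced _)) : lin.

Lemma kappa_inv_pure c X y : kappa_inv_aux c (tS X y) =
  etens actES acEE (fun Y => tE X Y) (psi (y ⊗ co c)).
Proof. exact: tens_lift_pure (kappa_inv_balanced c) _ _. Qed.

Lemma kappa_inv_linear_l u : linear (fun c => kappa_inv_aux c u).
Proof.
rewrite /kappa_inv_aux; apply: lin_tlift_fun => X y.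
by have el := etens_linear (ra := rB) (tEl X) (tEB X); lin.
Qed.

Lemma theta_inv_subproof : exists2 g : AA -> ESA, cancel theta g & cancel g theta.
Proof. by have [g gK Kg] := theta_bij; exists g. Qed.

Definition theta_inv := projT1 (cid2 theta_inv_subproof).

Lemma theta_invK : cancel theta_inv theta.
Proof. by rewrite /theta_inv; case: cid2. Qed.

Lemma thetaVK : cancel theta theta_inv.
Proof. by rewrite /theta_inv; case: cid2. Qed.

Lemma theta_inv_linear : linear theta_inv.
Proof.
by move=> c x y; apply: (can_inj thetaVK); rewrite theta_linear !theta_invK.
Qed.
#[local] Hint Extern 0 (GRing.linear_for _ theta_inv) =>
  exact: theta_inv_linear : lin.

(** [theta_inv] splits x ⊗ x' y into X ⊗_B y, and [psi] then recovers Y from y and the last leg.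
    Preceded by [mul_last], this is a left inverse of A ⊗_B kappa. *)
Definition kappa_inv : AAA -> tens rB acEE :=
  lift (fun t c => kappa_inv_aux (oc c) (theta_inv t)).

Definition mul_last (a : A) : AAA -> AAA := lift (fun t c => t ⊗ co (a * oc c)).

Lemma mul_last_balanced : balanced rB actAAA mul_last.
Proof.
split=> [a|t|a b t]; [by rewrite /mul_last; lin|by rewrite /mul_last; lin|].
move: t; apply: otimes_eq; [by rewrite /mul_last; lin|by rewrite /mul_last; lin|].
by move=> t c; rewrite /mul_last /actAAA; lpure; lpure; lpure; rewrite -mulrA.
Qed.

Lemma kappa_invK u :
  kappa_inv (tens_lift mul_last (etens acEE actAAA kappa u)) = u.
Proof.
have el := etens_linear (ra := rB) kappa_linear kappa_act.
have kl := kappa_inv_linear_l.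
have ml := tens_lift_linear mul_last_balanced.
have kil : linear kappa_inv by rewrite /kappa_inv; lin.
move: u; apply: tens_eq; [lin|lin|move=> a u].
rewrite (etens_pure rB kappa_linear kappa_act) (tens_lift_pure mul_last_balanced).
have ml' : linear (mul_last a) by rewrite /mul_last; lin.
move: u; apply: tens_eq; [lin|lin|move=> X Y].
have eX := etens_linear (ra := rB) (tEl X) (tEB X).
rewrite kappa_pure -(etens_pure rB (tEl X) (tEB X)) -psi_mul_rmult.
move: (es_val Y); apply: otimes_eq; [lin|lin|move=> y y'].
rewrite mul_rmult_pure kappa_aux_pure /mul_last; lpure.
rewrite /kappa_inv; lpure.
by rewrite -theta_pure thetaVK kappa_inv_pure.
Qed.

Lemma kappa_inj : injective kappa.
Proof.
apply/(injective_etens ff acEE_P actAAA_P kappa_linear kappa_act).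
move=> x y /(congr1 (fun z => kappa_inv (tens_lift mul_last z))).
by rewrite !kappa_invK.
Qed.

Definition place3 (t : AA) : AoverB -> tens rB actAAA :=
  tens_lift (fun q r => tens_pure rB actAAA q (t ⊗ co r)).

Lemma place3_balanced t : balanced (fun (a : A) (b : base A) => a * (b : A) : A)
  (fun b a => (b : A) * a : A) (fun q r => tens_pure rB actAAA q (t ⊗ co r)).
Proof.
split=> [||q b r]; [lin|lin|].
by rewrite [LHS]tpure_bal /actAAA; lpure.
Qed.
#[local] Hint Extern 0 (GRing.linear_for _ (place3 _)) =>
  exact: (tens_lift_linear (place3_balanced _)) : lin.

Lemma place3_pure t q r : place3 t (tB q r) = tens_pure rB actAAA q (t ⊗ co r).
Proof. exact: tens_lift_pure (place3_balanced t) _ _. Qed.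

Lemma place3_linear_l u : linear (fun t => place3 t u).
Proof. by rewrite /place3; lin. Qed.

(** For coinvariant X, the coaction of y inside [psi] is the codiagonal coaction of x ⊗ x' y. Hence
    the result depends only on [theta v], and can be evaluated at preimages given by [theta_inv]. *)
Lemma etens_kappa_inv c v : etens acEE actAAA kappa (kappa_inv_aux c v) =
  lift (fun t g => place3 t (χi (c ⊗ S g))) (coact2 A (theta v)).
Proof.
have p3 := place3_linear_l.
have el := etens_linear (ra := rB) kappa_linear kappa_act.
move: v; apply: tens_eq; [lin|lin|move=> X y].
rewrite kappa_inv_pure -(etens_comp (tEl X) (tEB X) kappa_linear kappa_act).
have -> : kappa \o (fun Y => tE X Y) = kappa_aux X \o @es_val k H A.
  by apply/funext => Y /=; rewrite kappa_pure.
rewrite (etens_comp (@es_val_linear k H A) vB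
  (kappa_aux_linear X) (kappa_aux_act X)) psiE psi0_pure //.
have el' := etens_linear (ra := rB) (kappa_aux_linear X) (kappa_aux_act X).
have cX : coact2 A (es_val X) = es_val X ⊗ 1 := coinv2P _ (valP X).
rewrite theta_pure (coact2_rmult_coinv _ cX) (lin_of_lift _ _ el').
rewrite lin_of_lift; [|lin]; apply: eq_lift => u g; lpure.
move: (χi _); apply: tens_eq; [lin|lin|move=> q r].
rewrite place_pure place3_pure.
by rewrite (etens_pure rB (kappa_aux_linear X) (kappa_aux_act X)) kappa_aux_pure.
Qed.

(** The preimage is not written down in C ⊗_B C: it is exhibited after A ⊗_B - and descended by
    [image_etens]. *)
Lemma kappa_middle_one X : exists T, kappa T = middle_one X.
Proof.
pose kL : {linear ESoverB A -> AAA} :=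
  HB.pack kappa (GRing.isLinear.Build _ _ _ _ _ kappa_linear).
pose mL : {linear ES -> AAA} :=
  HB.pack middle_one (GRing.isLinear.Build _ _ _ _ _ middle_one_linear).
apply: (image_etens ff acEE_P actES_P actAAA_P (f := kL) (g := mL)
  kappa_act middle_one_act).
have el := etens_linear (ra := rB) kappa_linear kappa_act.
have ml := etens_linear (ra := rB) middle_one_linear middle_one_act.
apply: tens_ind => [|t u [v hv] [w hw]|a Y].
- by exists 0; rewrite (lin0 el) (lin0 ml).
- by exists (v + w); rewrite (linD _ _ el) (linD _ _ ml) hv hw.
(* The candidate inverse of A ⊗_B kappa at x ⊗ 1 ⊗ a x'. Its image contains S(x_(1)), which
   [coinv_antipode] trades for x'_(1). *)
exists (lift (fun x x' => kappa_inv_aux (a * oc x') (theta_inv (x ⊗ co 1)))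
  (es_val Y)).
rewrite (etens_pure rB middle_one_linear middle_one_act) (lin_of_lift _ _ el).
have p3 := place3_linear_l.
have cY : coact2 A (es_val Y) = es_val Y ⊗ 1 := coinv2P _ (valP Y).
transitivity (lift (fun x x' => lift (fun u g =>
    place3 (u ⊗ co 1) (χi ((a * oc x') ⊗ S g))) (δ x)) (es_val Y)).
  apply: eq_lift => x x'; rewrite etens_kappa_inv theta_invK coact2E.
  rewrite (coact_morph A).1 lin_of_lift; [|lin]; apply: eq_lift => u g.
  by lpure; lpure; rewrite mulr1.
rewrite (coinv_antipode cY (f := fun u g x' =>
  place3 (u ⊗ co 1) (χi ((a * x') ⊗ g)))); try lin.
rewrite /middle_one lin_of_lift; [|lin]; apply: eq_lift => x x'.
rewrite -place3_pure -canonical_inv_coact pure_mulE.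
rewrite lin_of_lift; [|lin]; rewrite lin_of_lift; [|lin].
by apply: eq_lift => u v; rewrite mul1r.
Qed.

(* x ⊗ y ⊗ z |-> x_(0) ⊗ tau(x_(1)) y ⊗ z *)
Definition omega : AAA -> A ⊗ (AoverB ⊗ A) :=
  lift (fun t z => lift (fun x y => lift (fun x0 x1 =>
    x0 ⊗ (χi ((1 ⊗ x1) * δ (oc y)) ⊗ oc z)) (δ x)) t).

Lemma omega_linear : linear omega.
Proof. by rewrite /omega; lin. Qed.

Lemma ESoverB_incl_pure X Y : ESoverB_incl (tE X Y) =
  lift (fun x x' => lift (fun y y' => x ⊗ (tB (oc x') y ⊗ oc y')) (es_val Y))
    (es_val X).
Proof. exact: tens_lift_pure (@ESoverB_incl_balanced k H A) _ _. Qed.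

(** Coinvariance of X reduces the factors x'_(0) ⊗ x_(1) x'_(1) to x' ⊗ 1, and (x' ⊗ 1) δ(y)
    corresponds to x' ⊗_B y. As [omega] is injective, equations for [ESoverB_incl] become equations
    for [kappa]. *)
Lemma omega_kappa T : omega (kappa T) = ESoverB_incl T.
Proof.
have ol := omega_linear.
have il : linear (@ESoverB_incl k H A).
  exact: tens_lift_linear (@ESoverB_incl_balanced k H A).
move: T; apply: tens_eq; [lin|lin|move=> X Y].
rewrite kappa_pure ESoverB_incl_pure.
move: (es_val Y); apply: otimes_eq; [lin|lin|move=> y y'].
rewrite kappa_aux_pure.
pose N (z : AA ⊗ H) : A ⊗ (AoverB ⊗ A) := lift (fun t h => lift (fun x x' =>
  x ⊗ (χi ((oc x' ⊗ h) * δ y) ⊗ oc y')) t) z.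
have Nl : linear N by rewrite /N; lin.
have cX : coact2 A (es_val X) = es_val X ⊗ 1 := coinv2P _ (valP X).
transitivity (N (es_val X ⊗ 1)).
  rewrite -(coinv_ext cX Nl) /omega; lpure.
  move: (es_val X); apply: otimes_eq; [lin|lin|move=> x x'].
  rewrite rmult_mul_pure; lpure; lpure; apply: eq_lift => x0 x1.
  rewrite (coact_morph A).2 mulrA pure_mulE.
  pose L z : A ⊗ (AoverB ⊗ A) := x0 ⊗ (χi (z * δ y) ⊗ oc y').
  have Ll : linear L by rewrite /L; lin.
  rewrite -[LHS]/(L _) (lin_of_lift _ _ Ll); apply: eq_lift => u v.
  by rewrite /L /N; lpure; lpure; rewrite mul1r.
rewrite /N; lpure; apply: eq_lift => x x'; lpure.
by rewrite canonical_inv_coact.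
Qed.

Lemma omega_middle_one X : omega (middle_one X) = coproduct_formula X.
Proof.
have ol := omega_linear.
rewrite /middle_one (lin_of_lift _ _ ol); apply: eq_lift => x x'.
rewrite /omega; lpure; lpure; apply: eq_lift => x0 x1.
(* What remains is the inverse of χ at 1 ⊗ x1, convertible to [translation x1]. *)
by rewrite (coact_morph A).1 mulr1.
Qed.

(** Multiplication A ⊗_B A -> A on the middle factor, written as χ followed by the counit of H. *)
Definition omega_inv : A ⊗ (AoverB ⊗ A) -> AAA :=
  lift (fun x => lift (fun t z =>
    lift (fun y h => hcounit H h *: ((x ⊗ co y) ⊗ co z)) (χ t))).

Lemma omegaK : cancel omega omega_inv.
Proof.
have ol := omega_linear.
have el := @hcounit_linear k H.
have il : linear omega_inv by rewrite /omega_inv; lin.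
apply: otimes_eq; [lin|lin|move=> t z].
move: t; apply: otimes_eq; [lin|lin|move=> x y].
rewrite /omega; lpure; lpure; rewrite (lin_of_lift _ _ il).
rewrite -[RHS](coact_counitE (f := fun x => x ⊗ y ⊗ z)); [|lin].
apply: eq_lift => x0 x1; rewrite /omega_inv; lpure; lpure.
rewrite canonical_invK pure_mulE.
rewrite (lin_of_lift (L := lift _)); [|lin].
rewrite -(coact_counitE (f := fun y => hcounit H x1 *: (x0 ⊗ co y ⊗ z))); [|lin].
apply: eq_lift => u v; lpure; rewrite mul1r (hcounit_morph H).2.
by rewrite scalerA mulrC.
Qed.

Lemma kappa_coproduct X : kappa (coproduct X) = middle_one X.
Proof.
have [T TX] := kappa_middle_one X.
apply: (can_inj omegaK); rewrite omega_kappa omega_middle_one /coproduct.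
(* A preimage exists, namely T, so the default value in [coproduct] is excluded. *)
case: xgetP => [T' _ //|/(_ T)[]].
by rewrite /mkset -omega_kappa TX omega_middle_one.
Qed.

(** * Gauge transformations and bisections *)

Record is_gauge (F : A -> A) : Prop := IsGauge {
  gauge_linear : linear F;
  gauge1 : F 1 = 1;
  gaugeM : forall x y, F (x * y) = F x * F y;
  gauge_coact : forall x, δ (F x) = lift (fun a h => F a ⊗ h) (δ x);
  gauge_base : forall b, F (bv b) = bv b }.

(** The two legs get independent maps so that F ⊗ F can be factored through F ⊗ 1 and 1 ⊗ F, each of
    which is determined by the bisection of F. *)
Definition tens_map (F G : A -> A) : AA -> AA :=
  lift (fun x x' => F x ⊗ co (G (oc x'))).

Section Pair.
Variables F G : A -> A.
Hypotheses (hF : is_gauge F) (hG2 : is_gauge G).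
Let Fl := gauge_linear hF.
Let Gl := gauge_linear hG2.

Lemma tens_map_linear : linear (tens_map F G).
Proof. by rewrite /tens_map; lin. Qed.

Lemma tens_map_pure x x' : tens_map F G (x ⊗ x') = F x ⊗ co (G (oc x')).
Proof. by rewrite /tens_map; lpure. Qed.

Lemma tens_map_mul t u : tens_map F G (t * u) = tens_map F G t * tens_map F G u.
Proof.
have l := tens_map_linear.
move: t; apply: otimes_eq; [lin|lin|move=> x x'].
move: u; apply: otimes_eq; [lin|lin|move=> y y'].
rewrite mul_pureE !tens_map_pure mul_pureE (gaugeM hF); congr (_ ⊗ _).
exact: (gaugeM hG2 (oc y') (oc x')).
Qed.

Lemma tens_map_coinv t : coact2 A t = t ⊗ 1 ->
  coact2 A (tens_map F G t) = tens_map F G t ⊗ 1.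
Proof.
have l := tens_map_linear => ct.
pose L := lift (fun (t : AA) (h : H) => tens_map F G t ⊗ h).
have Ll : linear L by rewrite /L; lin.
transitivity (L (coact2 A t)); last by rewrite ct /L; lpure.
move: t {ct}; apply: otimes_eq; [lin|lin|move=> x x'].
rewrite tens_map_pure !coact2E (gauge_coact hF) [in LHS](gauge_coact hG2).
rewrite (lin_of_lift _ _ Ll) (lin_of_lift (L := lift _)); [|lin].
apply: eq_lift => a g; lpure.
rewrite (lin_of_lift _ _ Ll) (lin_of_lift (L := lift _)); [|lin].
by apply: eq_lift => b h; rewrite /L; lpure; lpure; rewrite tens_map_pure.
Qed.

Lemma es_map_subproof (X : ES) : tens_map F G (es_val X) \in coinv2 A.
Proof. by apply/coinv2P; apply: tens_map_coinv; exact: coinv2P (valP X). Qed.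

Definition es_map (X : ES) : ES := Es (es_map_subproof X).

Lemma es_map_linear : linear es_map.
Proof. by move=> c X Y; apply: val_inj; exact: (tens_map_linear c (es_val X) (es_val Y)). Qed.

Lemma es_map1 : es_map 1 = 1.
Proof. by apply: val_inj; rewrite /= tens_map_pure (gauge1 hF) [G _](gauge1 hG2). Qed.

Lemma es_mapM X Y : es_map (X * Y) = es_map X * es_map Y.
Proof. by apply: val_inj; exact: (tens_map_mul (es_val X) (es_val Y)). Qed.

Lemma es_map_src b : es_map (src b) = src b.
Proof.
apply: val_inj; rewrite /= tens_map_pure (gauge_base hF).
by rewrite [G _](gauge1 hG2).
Qed.

Lemma es_map_tgt b : es_map (tgt b) = tgt b.
Proof.
apply: val_inj; rewrite /= tens_map_pure (gauge1 hF).
by rewrite [G _](gauge_base hG2).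
Qed.

End Pair.

Lemma tens_map_id t : tens_map id id t = t.
Proof.
move: t; apply: otimes_eq; [by rewrite /tens_map; lin|exact: lin_id|move=> x x'].
by rewrite /tens_map; lpure.
Qed.

Lemma tens_map_comp F G F' G' t : linear F -> linear G -> linear F' -> linear G' ->
  tens_map F G (tens_map F' G' t) = tens_map (F \o F') (G \o G') t.
Proof.
move=> Fl Gl Fl' Gl'; rewrite /tens_map lin_of_lift; [|lin].
by apply: eq_lift => x x'; lpure.
Qed.

Lemma gauge_id : is_gauge id.
Proof. by split=> // x; rewrite lift_pureE. Qed.

Lemma gauge_comp F G : is_gauge F -> is_gauge G -> is_gauge (G \o F).
Proof.
move=> hF hG2; have Fl := gauge_linear hF; have Gl := gauge_linear hG2.
split=> [||x y|x|b] /=.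
- exact: lin_comp.
- by rewrite (gauge1 hF) (gauge1 hG2).
- by rewrite (gaugeM hF) (gaugeM hG2).
- rewrite (gauge_coact hG2) (gauge_coact hF) lin_of_lift; [|lin].
  by apply: eq_lift => a h; lpure.
by rewrite (gauge_base hF) (gauge_base hG2).
Qed.

(** * Inverses of gauge transformations *)

Section Inverse.
Variable F : A -> A.
Hypothesis hF : is_gauge F.
Let Fl := gauge_linear hF.

Let N : AoverB -> A := tens_lift (fun q r => F q * r).

Let N_balanced : balanced (fun (a : A) (b : base A) => a * (b : A) : A)
  (fun b a => (b : A) * a : A) (fun q r => F q * r).
Proof.
by split=> [||q b r]; [lin|lin|rewrite (gaugeM hF) (gauge_base hF) mulrA].
Qed.

Let Nl : linear N := tens_lift_linear N_balanced.

Let N_pure q r : N (tB q r) = F q * r.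
Proof. exact: tens_lift_pure N_balanced _ _. Qed.

Let N_mul x z : N (χi ((x ⊗ 1) * z)) = F x * N (χi z).
Proof.
rewrite -[z]canonical_invK canonical_mapK.
move: (χi z); apply: tens_eq; [lin|lin|move=> q r].
rewrite canonical_map_pure mulrA mul_pureE mulr1 canonical_inv_coact !N_pure.
by rewrite (gaugeM hF) mulrA.
Qed.

(** Colinearity makes this F ⊗ id on A ⊗ H, so it fixes every tau(h); this is how F passes through
    N(tau(h)) in [gauge_Kinv]. *)
Let FF : AoverB -> AoverB := tens_lift (fun q r => tB (F q) (F r)).

Let FF_balanced : balanced (fun (a : A) (b : base A) => a * (b : A) : A)
  (fun b a => (b : A) * a : A) (fun q r => tB (F q) (F r)).
Proof.
split=> [||q b r]; [lin|lin|].
by rewrite !(gaugeM hF) (gauge_base hF) [LHS]tpure_bal.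
Qed.

Let FFl : linear FF := tens_lift_linear FF_balanced.

Let FF_pure q r : FF (tB q r) = tB (F q) (F r).
Proof. exact: tens_lift_pure FF_balanced _ _. Qed.

Let FF_canonical z : FF (χi z) = χi (lift (fun a h => F a ⊗ h) z).
Proof.
rewrite -[z in RHS]canonical_invK; move: (χi z).
apply: tens_eq; [lin|lin|move=> q r].
rewrite FF_pure canonical_map_pure -canonical_inv_coact (gauge_coact hF).
congr (χi _); move: (δ r); apply: otimes_eq; [lin|lin|move=> u v].
by lpure; rewrite !mul_pureE; lpure; rewrite (gaugeM hF).
Qed.

Definition gauge_inv (a : A) : A :=
  lift (fun a0 h => a0 * tens_lift (fun q r => F q * r) (χi (1 ⊗ h))) (δ a).

(** Since χ(1 ⊗_B a) = δ(a), the left side is N(1 ⊗_B a) = F(1) a. Both cancellation laws for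
    [gauge_inv] reduce to this. *)
Let N_coact a : lift (fun a0 h => F a0 * N (χi (1 ⊗ h))) (δ a) = a.
Proof.
transitivity (N (χi (δ a))).
  have l : linear (fun z => N (χi z)) by lin.
  rewrite -(lift_lin (δ a) l); apply: eq_lift => u v.
  by rewrite -N_mul mul_pureE mulr1 mul1r.
rewrite -[δ a]mul1r canonical_inv_coact N_pure (gauge1 hF).
by rewrite mul1r.
Qed.

Lemma gauge_invK : cancel F gauge_inv.
Proof.
move=> a; rewrite /gauge_inv -/N (gauge_coact hF) lin_of_lift; [|lin].
rewrite -[RHS]N_coact; apply: eq_lift => a0 h; by lpure.
Qed.

Lemma gauge_Kinv : cancel gauge_inv F.
Proof.
move=> a; rewrite /gauge_inv -/N (lin_of_lift _ _ Fl).
rewrite -[RHS]N_coact; apply: eq_lift => a0 h; rewrite (gaugeM hF).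
congr (_ * _).
have -> : F (N (χi (1 ⊗ h))) = N (FF (χi (1 ⊗ h))).
  move: (χi _); apply: tens_eq; [lin|lin|move=> q r].
  by rewrite FF_pure !N_pure (gaugeM hF).
by rewrite FF_canonical; lpure; rewrite (gauge1 hF).
Qed.

Lemma gauge_invP : is_gauge gauge_inv.
Proof.
have Gl : linear gauge_inv.
  by move=> c x y; apply: (can_inj gauge_invK); rewrite Fl !gauge_Kinv.
split=> [//||x y|x|b].
- by rewrite -[in LHS](gauge1 hF) gauge_invK.
- by apply: (can_inj gauge_invK); rewrite (gaugeM hF) !gauge_Kinv.
- rewrite -[in RHS](gauge_Kinv x) (gauge_coact hF) lin_of_lift; [|lin].
  rewrite -[LHS]lift_pureE; apply: eq_lift => a h; lpure.
  by rewrite gauge_invK.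
by rewrite -[in LHS](gauge_base hF) gauge_invK.
Qed.

End Inverse.

(** * Gauge transformations and bisections determine each other *)

Definition right_linear (E : AA -> A) : Prop :=
  linear E /\ forall a t, E (rmult a * t) = E t * a.

(* The right [A]-multiples of C(A, H) span A ⊗ A. *)
Lemma right_linear_ext (E E' : AA -> A) : right_linear E -> right_linear E' ->
  (forall X : ES, E (es_val X) = E' (es_val X)) -> E =1 E'.
Proof.
move=> [El Er] [El' Er'] e t; rewrite -(theta_invK t).
have tl := theta_linear.
move: (theta_inv _); apply: tens_eq; [lin|lin|move=> X a].
by rewrite theta_pure Er Er' e.
Qed.

Definition ev (F : A -> A) : AA -> A := lift (fun x x' => F x * oc x').

Lemma ev_right_linear F : linear F -> right_linear (ev F).
Proof.
move=> Fl; have l : linear (ev F) by rewrite /ev; lin.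
split=> // a t; move: t; apply: otimes_eq; [lin|lin|move=> x x'].
by rewrite rmult_mul_pure /ev; lpure; lpure; rewrite mulrA.
Qed.

Lemma ev_inj F G : linear F -> linear G ->
  (forall X : ES, ev F (es_val X) = ev G (es_val X)) -> F =1 G.
Proof.
move=> Fl Gl e x.
have := right_linear_ext (ev_right_linear Fl) (ev_right_linear Gl) e (x ⊗ co 1).
by rewrite /ev; lpure; lpure; rewrite !mulr1.
Qed.

Let bvM x y : bv (x * y) = bv x * bv y. Proof. by []. Qed.

Section OfGauge.
Variable F : A -> A.
Hypothesis hF : is_gauge F.

(** Written as the counit after F ⊗ id so that the values lie in B by construction; the formula F(x)
    x' is [gauge_sectionE]. *)
Definition gauge_section (X : ES) : B := counit (es_map hF gauge_id X).

Lemma gauge_sectionE X : bv (gauge_section X) = ev F (es_val X).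
Proof.
have Fl := gauge_linear hF.
rewrite /gauge_section /= /opp_mul /tens_map -[lift _ _]/(ev id _).
have l : linear (ev id) by rewrite /ev; lin.
rewrite (lin_of_lift _ _ l); apply: eq_lift => x x'.
by rewrite /ev; lpure.
Qed.

Lemma gauge_section_bisection : is_bisection gauge_section.
Proof.
have Fl := gauge_linear hF; have [el er] := ev_right_linear Fl.
have bi : injective bv by exact: val_inj.
split.
- move=> c X Y; apply: bi.
  rewrite gauge_sectionE [RHS](@base_val_linear k H A) !gauge_sectionE.
  exact: el.
- apply: bi; rewrite gauge_sectionE /ev; lpure.
  by rewrite (gauge1 hF) mul1r.
- move=> b b' X; apply: bi; rewrite [RHS](bvM (_ * _)) (bvM b) !gauge_sectionE.
  rewrite -[es_val (_ * _)]/((bv b ⊗ 1) * (rmult (bv b') * es_val X)).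
  rewrite /ev; move: (es_val X); apply: otimes_eq; [lin|lin|move=> x x'].
  rewrite rmult_mul_pure mul_pureE mul1r; lpure; lpure.
  by rewrite (gaugeM hF) (gauge_base hF) !mulrA.
move=> X Y; apply: bi; rewrite !gauge_sectionE.
rewrite -[es_val (X * src _)]/(es_val X * (bv (gauge_section Y) ⊗ 1)).
rewrite -[es_val (X * Y)]/(es_val X * es_val Y).
move: (es_val X); apply: otimes_eq; [lin|lin|move=> x x'].
rewrite mul_pureE; transitivity (F x * bv (gauge_section Y) * oc x').
  rewrite /ev; lpure; rewrite (gaugeM hF) (gauge_base hF).
  by rewrite [of_opp _](mul1r (oc x')).
rewrite gauge_sectionE.
move: (es_val Y); apply: otimes_eq; [lin|lin|move=> y y'].
by rewrite mul_pureE /ev; lpure; lpure; rewrite (gaugeM hF) !mulrA.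
Qed.

End OfGauge.

Section OfBisection.
Variable s : ES -> B.
Hypothesis hs : is_bisection s.
Let sl := bis_linear hs.

Let src1 : src (1 : B) = 1 :> ES. Proof. exact: val_inj. Qed.

Let s_src b X : s (src b * X) = b * s X.
Proof. by have := bis_bimod hs b 1 X; rewrite tgt1 mul1r mulr1. Qed.

Let s_tgt b X : s (tgt b * X) = s X * b.
Proof. by have := bis_bimod hs 1 b X; rewrite src1 !mul1r. Qed.

Let ext : ESA -> A := tens_lift (fun X a => bv (s X) * a).

Let ext_balanced : balanced rES lA (fun X a => bv (s X) * a).
Proof.
split=> [X|a|X b a]; [lin|lin|].
by rewrite s_tgt mulrA.
Qed.

Let ext_linear : linear ext := tens_lift_linear ext_balanced.

Let ext_pure X a : ext (tS X a) = bv (s X) * a.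
Proof. exact: tens_lift_pure ext_balanced _ _. Qed.

Let ext' (t : AA) : A := ext (theta_inv t).

Let ext'_linear : linear ext'.
Proof. by have tl := theta_inv_linear; rewrite /ext'; lin. Qed.

Let ext'_theta u : ext' (theta u) = ext u.
Proof. by rewrite /ext' thetaVK. Qed.

Let ext'_right_linear : right_linear ext'.
Proof.
have tl := theta_linear.
split=> // a t; rewrite -(theta_invK t).
move: (theta_inv _); apply: tens_eq; [lin|lin|move=> X c].
rewrite ext'_theta theta_pure mulrA -rmultM -theta_pure !ext'_theta !ext_pure.
by rewrite mulrA.
Qed.

Definition section_gauge (x : A) : A :=
  tens_lift (fun X a => bv (s X) * a) (theta_inv (x ⊗ co 1)).
Local Notation F := section_gauge.

Lemma section_gauge_linear : linear F.
Proof. by move=> c x y; rewrite -[F _]/(ext' _) pure_linear_l; exact: ext'_linear. Qed.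
Let Fl := section_gauge_linear.

Let ext'E t : ext' t = ev F t.
Proof.
have [el er] := ev_right_linear Fl.
move: t; apply: otimes_eq; [lin|lin|move=> x x'].
have -> : x ⊗ x' = rmult (oc x') * (x ⊗ co 1) by rewrite rmult_mul_pure [1 * _]mul1r.
by rewrite ext'_right_linear.2 er /ev; lpure; rewrite mulr1.
Qed.

Lemma section_gaugeE X : bv (s X) = ev F (es_val X).
Proof.
rewrite -ext'E -[es_val X]mul1r -rmult1 -theta_pure ext'_theta ext_pure.
by rewrite mulr1.
Qed.

Let F1 : F 1 = 1.
Proof.
have := section_gaugeE 1; rewrite (bis_unit hs) /ev.
by lpure; rewrite mulr1.
Qed.

Let F_base b : F (bv b) = bv b.
Proof.
have := section_gaugeE (src b); rewrite -[src b]mulr1 s_src (bis_unit hs) mulr1.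
by rewrite mulr1 /ev; lpure; rewrite mulr1.
Qed.

(** Both sides come from maps on A ⊗ A evaluated at x ⊗ 1. On [theta] of X ⊗_B a they agree, as s(X)
    and X are coinvariant and only the coaction of a remains. *)
Let F_coact x : δ (F x) = lift (fun a h => F a ⊗ h) (δ x).
Proof.
have tl := theta_linear.
transitivity (lift (fun t h => ev F t ⊗ h) (coact2 A (x ⊗ co 1))); last first.
  rewrite coact2E (coact_morph A).1.
  have el := (ev_right_linear Fl).1.
  rewrite lin_of_lift; [|lin]; apply: eq_lift => a g; lpure; lpure.
  by rewrite mulr1 /ev; lpure; rewrite mulr1.
rewrite -[F x]/(ext (theta_inv (x ⊗ co 1))).
rewrite -{2}(theta_invK (x ⊗ co 1)).
have el := (ev_right_linear Fl).1.
move: (theta_inv _); apply: tens_eq; [lin|lin|move=> X a].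
have cX : coact2 A (es_val X) = es_val X ⊗ 1 := coinv2P _ (valP X).
rewrite ext_pure theta_pure (coact2_rmult_coinv _ cX) (coact_morph A).2.
rewrite (coinvP _ (valP (s X))) pure_mulE lin_of_lift; [|lin].
apply: eq_lift => b h; lpure.
by rewrite mul1r (ev_right_linear Fl).2 -section_gaugeE.
Qed.

Let ev_scale_right_linear (g : A -> A -> A) (t : AA) :
  (forall y, linear (g y)) -> (forall x, linear (fun y => g y x)) ->
  right_linear (fun u => lift (fun x x' => lift (fun y y' =>
    g y x * oc y' * oc x') t) u).
Proof.
move=> g1 g2; split=> [|a u]; first by lin.
move: u; apply: otimes_eq; [lin|lin|move=> x x'].
rewrite rmult_mul_pure; lpure; lpure.
rewrite (lin_of_lift (L := fun z => z * a)); [|lin].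
by apply: eq_lift => y y'; rewrite mulrA.
Qed.

(** The third bisection axiom gives this only for x ⊗ x' in C. Both sides, multiplied by x', are
    right A-linear, so [right_linear_ext] extends the equality to A ⊗ A, in particular to x ⊗ 1. *)
Let F_mul_section x Y :
  F (x * bv (s Y)) = lift (fun y y' => F (x * y) * oc y') (es_val Y).
Proof.
pose E1 := ev (fun x => F (x * bv (s Y))).
pose E2 (u : AA) := lift (fun x x' => lift (fun y y' =>
  F (x * y) * oc y' * oc x') (es_val Y)) u.
have h1 : right_linear E1 by apply: ev_right_linear; lin.
have h2 : right_linear E2.
  by apply: (@ev_scale_right_linear (fun y x => F (x * y))); lin.
have e : E1 =1 E2.
  apply: right_linear_ext => // X.
  have := congr1 bv (bis_mul hs X Y); rewrite !section_gaugeE.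
  rewrite -[es_val (X * src _)]/(es_val X * (bv (s Y) ⊗ 1)).
  rewrite -[es_val (X * Y)]/(es_val X * es_val Y).
  have [el er] := ev_right_linear Fl.
  have -> : ev F (es_val X * (bv (s Y) ⊗ 1)) = E1 (es_val X).
    move: (es_val X); apply: otimes_eq; [lin|exact: h1.1|move=> x0 x'].
    rewrite mul_pureE /E1 /ev; lpure; lpure.
    by rewrite [of_opp _](mul1r (oc x')).
  move=> ->; move: (es_val X); apply: otimes_eq; [lin|exact: h2.1|move=> x0 x'].
  rewrite /E2; lpure; move: (es_val Y); apply: otimes_eq; [lin|lin|move=> y y'].
  by rewrite mul_pureE /ev; lpure; lpure; rewrite -mulrA.
have := e (x ⊗ co 1); rewrite /E1 /E2 /ev; lpure; lpure.
by rewrite mulr1 => ->; apply: eq_lift => y y'; rewrite mulr1.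
Qed.

(** Taking Y = t(b) first gives F(x b) = F(x) b. Then [F_mul_section] says that y |-> F(x y) and y
    |-> F(x) F(y) have the same [ev] on C, so [ev_inj] applies. *)
Let FM x y : F (x * y) = F x * F y.
Proof.
have F_tgt b : F (x * bv b) = F x * bv b.
  have := F_mul_section x (tgt b); rewrite -{1}[tgt b]mulr1 s_tgt (bis_unit hs).
  by rewrite mul1r => ->; rewrite /=; lpure; rewrite mulr1.
have Fx : linear (fun y => F (x * y)) by lin.
have Fx' : linear (fun y => F x * F y) by lin.
apply: (ev_inj Fx Fx') => Y.
rewrite /ev -F_mul_section F_tgt section_gaugeE /ev lin_of_lift; [|lin].
by apply: eq_lift => u u'; rewrite mulrA.
Qed.

Lemma section_gaugeP : is_gauge F.
Proof. by split. Qed.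

End OfBisection.

(** * The group of gauge transformations and convolution *)

Record gauge := Gauge { gauge_map :> A -> A; gaugeP : is_gauge gauge_map }.

Lemma gauge_eq (F G : gauge) : F =1 G -> F = G.
Proof.
case: F G => [f hf] [g hg] /= /funext fg; move: hf hg; rewrite fg => hf hg.
by congr Gauge.
Qed.

HB.instance Definition _ := gen_eqMixin gauge.
HB.instance Definition _ := gen_choiceMixin gauge.

Definition gauge_one : gauge := Gauge gauge_id.

(* Reversed composition, so that [sigma] is multiplicative. *)
Definition gauge_mul (F G : gauge) : gauge :=
  Gauge (gauge_comp (gaugeP F) (gaugeP G)).

Definition gauge_opp (F : gauge) : gauge := Gauge (gauge_invP (gaugeP F)).

Let gauge_mulA : associative gauge_mul.
Proof. by move=> F G K; apply: gauge_eq. Qed.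

Let gauge_mul1 : left_id gauge_one gauge_mul.
Proof. by move=> F; apply: gauge_eq. Qed.

Let gauge_mulr1 : right_id gauge_one gauge_mul.
Proof. by move=> F; apply: gauge_eq. Qed.

Let gauge_mulV : left_inverse gauge_one gauge_opp gauge_mul.
Proof. by move=> F; apply: gauge_eq => x; exact: (gauge_Kinv (gaugeP F)). Qed.

Let gauge_mulrV : right_inverse gauge_one gauge_opp gauge_mul.
Proof. by move=> F; apply: gauge_eq => x; exact: (gauge_invK (gaugeP F)). Qed.

HB.instance Definition _ := isGroup.Build gauge
  gauge_mulA gauge_mul1 gauge_mulr1 gauge_mulV gauge_mulrV.

Definition sigma (F : gauge) : bisection A :=
  Bisection (gauge_section_bisection (gaugeP F)).

Lemma sigmaE (F : gauge) X : bv (sigma F X) = ev F (es_val X).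
Proof. exact: gauge_sectionE. Qed.

Let bi : injective bv. Proof. exact: val_inj. Qed.
Let ei : injective (@es_val k H A). Proof. exact: val_inj. Qed.

Definition gauge_of (s : bisection A) : gauge := Gauge (section_gaugeP (bisP s)).

Lemma bisection_eq (s s' : bisection A) : s =1 s' -> s = s'.
Proof.
case: s s' => [f hf] [g hg] /= /funext fg; move: hf hg; rewrite fg => hf hg.
by congr Bisection.
Qed.

Lemma gauge_ofK : cancel gauge_of sigma.
Proof.
move=> s; apply: bisection_eq => X; apply: bi.
by rewrite sigmaE -(section_gaugeE (bisP s)).
Qed.

Lemma sigma_inj (F G : gauge) : sigma F =1 sigma G -> F = G.
Proof.
move=> e; apply: gauge_eq; apply: ev_inj.
- exact: gauge_linear (gaugeP F).
- exact: gauge_linear (gaugeP G).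
by move=> X; rewrite -!sigmaE e.
Qed.

Lemma sigma_bij : bijective sigma.
Proof.
exists gauge_of; last exact: gauge_ofK.
by move=> F; apply: sigma_inj => X; rewrite gauge_ofK.
Qed.

Lemma sigma1 : sigma (1%g : gauge) =1 @counit k H A.
Proof. by move=> X; apply: bi; rewrite sigmaE. Qed.

(** A map that factors as [L] after [kappa] is evaluated on the coproduct by putting 1 in the middle
    leg, which avoids the translation map. *)
Lemma coproduct_lift (V : lmodType k) (g : ES -> ES -> V) (L : AAA -> V) X :
  balanced rES lES g -> linear L ->
  (forall X Y, g X Y = L (kappa_aux X (es_val Y))) ->
  tens_lift g (coproduct X) = lift (fun x x' => L ((x ⊗ co 1) ⊗ x')) (es_val X).
Proof.
move=> gb Ll gL; rewrite -(lin_of_lift _ _ Ll) -[lift _ _]/(middle_one X).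
rewrite -(kappa_coproduct X).
move: (coproduct X); apply: tens_eq => [||Y Z]; [exact: tens_lift_linear|lin|].
by rewrite (tens_lift_pure gb) kappa_pure.
Qed.

Lemma sigma_mul (F G : gauge) : sigma (F * G)%g =1 convolution (sigma F) (sigma G).
Proof.
have Fl := gauge_linear (gaugeP F); have Gl := gauge_linear (gaugeP G).
move=> X; apply: bi; rewrite sigmaE /convolution.
have cb := convolution_balanced (bisP (sigma F)) (bisP (sigma G)).
rewrite (linear_tens_lift _ _ (@base_val_linear k H A)).
(* As sigma F (Y) is in B, it is fixed by G, so the product of the two values is G(F(y) y' z) z' and
   depends only on y ⊗ y' z ⊗ z'. *)
pose L : AAA -> A := lift (fun t z =>
  lift (fun x y => G (F x) * G (oc y) * oc z) t).
have Ll : linear L by rewrite /L; lin.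
rewrite (coproduct_lift (L := L)) //.
- apply: eq_lift => x x'; rewrite /L; lpure; lpure.
  by rewrite (gauge1 (gaugeP G)) mulr1.
- have [c1 c2 c3] := cb; split=> [Y|Z|Y b Z].
  + exact: (lin_comp (@base_val_linear k H A) (c1 Y)).
  + exact: (lin_comp (@base_val_linear k H A) (c2 Z)).
  + by congr (bv _); exact: c3.
move=> Y Z; rewrite bvM !sigmaE.
move: (es_val Z); apply: otimes_eq; [by rewrite /ev; lin|lin|move=> z z'].
rewrite kappa_aux_pure /L; lpure.
transitivity (G (ev F (es_val Y) * z) * oc z').
  rewrite -sigmaE (gaugeM (gaugeP G)) (gauge_base (gaugeP G)).
  by rewrite /ev; lpure; rewrite mulrA.
rewrite /ev; move: (es_val Y); apply: otimes_eq; [lin|lin|move=> y y'].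
rewrite rmult_mul_pure; lpure; lpure.
by rewrite -mulrA !(gaugeM (gaugeP G)).
Qed.

(** * Automorphisms of the bialgebroid attached to gauge transformations *)

Lemma gaugeKV (F : gauge) x : F ((F^-1)%g x) = x.
Proof. exact: (gauge_Kinv (gaugeP F)). Qed.

Lemma gaugeVK (F : gauge) x : (F^-1)%g (F x) = x.
Proof. exact: (gauge_invK (gaugeP F)). Qed.

Definition esm (F G : gauge) : ES -> ES := es_map (gaugeP F) (gaugeP G).

Lemma esm_comp F G F' G' X : esm F G (esm F' G' X) = esm (F' * F)%g (G' * G)%g X.
Proof.
apply: ei; rewrite /= tens_map_comp //; exact: gauge_linear (gaugeP _).
Qed.

Lemma esm1 X : esm 1%g 1%g X = X.
Proof. by apply: ei; rewrite /= tens_map_id. Qed.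

Lemma src_linear : linear (@src k H A).
Proof. by move=> c x y; apply: ei; exact: (pure_linear_l 1 c (bv x) (bv y)). Qed.

Lemma srcM a b : src (a * b) = src a * src b :> ES.
Proof. by apply: ei; rewrite /= mul_pureE mul1r. Qed.

Let src1 : src (1 : B) = 1 :> ES. Proof. exact: ei. Qed.

Let s_src (F : gauge) b X : sigma F (src b * X) = b * sigma F X.
Proof. by have := bis_bimod (bisP (sigma F)) b 1 X; rewrite tgt1 mul1r mulr1. Qed.

Let s_tgt (F : gauge) b X : sigma F (tgt b * X) = sigma F X * b.
Proof. by have := bis_bimod (bisP (sigma F)) 1 b X; rewrite src1 !mul1r. Qed.

Lemma source_sigma_balanced (F : gauge) :
  balanced rES lES (fun X1 X2 => src (sigma F X1) * X2).
Proof.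
have sl := src_linear; have Fl := bis_linear (bisP (sigma F)).
split=> [X|Y|X b Y]; [lin|lin|].
by rewrite s_tgt srcM mulrA.
Qed.

Lemma target_sigma_balanced (F : gauge) :
  balanced rES lES (fun X1 X2 => tgt (sigma F X2) * X1).
Proof.
have Fl := bis_linear (bisP (sigma F)).
split=> [X|Y|X b Y]; [lin|lin|].
by rewrite s_src tgtM mulrA.
Qed.

Lemma source_sigma (F : gauge) X :
  tens_lift (fun X1 X2 => src (sigma F X1) * X2) (coproduct X) = esm F 1%g X.
Proof.
have Fl := gauge_linear (gaugeP F).
have [b1 b2 b3] := source_sigma_balanced F.
apply: ei; rewrite (linear_tens_lift _ _ vl).
pose L : AAA -> AA := lift (fun t z => lift (fun x y => (F x * oc y) ⊗ z) t).
have Ll : linear L by rewrite /L; lin.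
rewrite (coproduct_lift (L := L)) //.
- apply: eq_lift => x x'; rewrite /L; lpure; lpure.
  by rewrite mulr1.
- split=> [Y|Z|Y b Z].
  + exact: (lin_comp vl (b1 Y)).
  + exact: (lin_comp vl (b2 Z)).
  + by congr (es_val _); exact: b3.
move=> Y Z; rewrite -[LHS]/((bv (sigma F Y) ⊗ 1) * es_val Z) sigmaE.
move: (es_val Z); apply: otimes_eq; [lin|lin|move=> z z'].
rewrite mul_pureE mul1r kappa_aux_pure /L; lpure.
rewrite /ev; move: (es_val Y); apply: otimes_eq; [lin|lin|move=> y y'].
by rewrite rmult_mul_pure; lpure; lpure; rewrite mulrA.
Qed.

Lemma target_sigma (F : gauge) X :
  tens_lift (fun X1 X2 => tgt (sigma F X2) * X1) (coproduct X) =
  esm 1%g F^-1%g X.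
Proof.
have Fl := gauge_linear (gaugeP F).
set G := (F^-1)%g; have Gl := gauge_linear (gaugeP G).
have [b1 b2 b3] := target_sigma_balanced F.
apply: ei; rewrite (linear_tens_lift _ _ vl).
pose L : AAA -> AA := lift (fun t z =>
  lift (fun x y => x ⊗ co (oc y * G (oc z))) t).
have Ll : linear L by rewrite /L; lin.
rewrite (coproduct_lift (L := L)) //.
- apply: eq_lift => x x'; rewrite /L; lpure; lpure.
  by rewrite mul1r.
- split=> [Y|Z|Y b Z].
  + exact: (lin_comp vl (b1 Y)).
  + exact: (lin_comp vl (b2 Z)).
  + by congr (es_val _); exact: b3.
move=> Y Z; rewrite -[LHS]/(rmult (bv (sigma F Z)) * es_val Y).
(* F sends the right side to F(z) z' and fixes the left side, which is in B. This is where the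
   inverse on the last leg comes from. *)
have -> : bv (sigma F Z) = lift (fun z z' => z * G (oc z')) (es_val Z).
  apply: (can_inj (gaugeVK F)); rewrite (gauge_base (gaugeP F)) sigmaE.
  rewrite (lin_of_lift _ _ Fl); apply: eq_lift => z z'.
  by rewrite (gaugeM (gaugeP F)) gaugeKV.
move: (es_val Z); apply: otimes_eq; [lin|lin|move=> z z'].
rewrite kappa_aux_pure /L; lpure; lpure.
move: (es_val Y); apply: otimes_eq; [lin|lin|move=> y y'].
by rewrite !rmult_mul_pure; lpure; rewrite mulrA.
Qed.

Section Diagonal.
Variable G : gauge.
Let Gl := gauge_linear (gaugeP G).
Local Notation Φ := (esm G G).

Let Φl : linear Φ. Proof. exact: es_map_linear. Qed.

(** By injectivity of [kappa] it suffices to compare elements of A ⊗ A ⊗ A, where the map becomes G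
    ⊗ G ⊗ G and preserves the middle 1. *)
Lemma esm_coproduct X :
  tens_lift (fun X1 X2 => tE (Φ X1) (Φ X2)) (coproduct X) = coproduct (Φ X).
Proof.
apply: (kappa_inj); rewrite (kappa_coproduct).
rewrite (linear_tens_lift _ _ kappa_linear).
have tl := tens_map_linear (gaugeP G) (gaugeP G).
pose L : AAA -> AAA := lift (fun t z => tens_map G G t ⊗ co (G (oc z))).
have Ll : linear L by rewrite /L; lin.
rewrite (coproduct_lift (L := L)) //.
- rewrite /middle_one -[es_val (Φ X)]/(tens_map G G (es_val X)).
  move: (es_val X); apply: otimes_eq; [lin|lin|move=> x x'].
  rewrite tens_map_pure //; last exact: gaugeP; last exact: gaugeP.
  lpure; lpure; rewrite /L; lpure; rewrite tens_map_pure; try exact: gaugeP.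
  have -> : G (oc (co 1)) = 1 by exact: gauge1 (gaugeP G).
  by [].
- split=> [Y|Z|Y b Z]; [lin|lin|].
  rewrite [Φ (tgt b * Y)]es_mapM [Φ (src b * Z)]es_mapM.
  by rewrite es_map_src es_map_tgt tpure_bal.
move=> Y Z; rewrite kappa_pure -[es_val (Φ Z)]/(tens_map G G (es_val Z)).
move: (es_val Z); apply: otimes_eq; [lin|lin|move=> z z'].
rewrite kappa_aux_pure tens_map_pure; try exact: gaugeP.
rewrite kappa_aux_pure /L; lpure; rewrite tens_map_mul; try exact: gaugeP.
rewrite /rmult tens_map_pure; try exact: gaugeP.
by rewrite (gauge1 (gaugeP G)).
Qed.

Lemma esm_automorphism : is_automorphism Φ (@id B).
Proof.
split=> //.
- exists (esm (G^-1)%g (G^-1)%g) => X; rewrite esm_comp.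
    by rewrite mulgV esm1.
  by rewrite mulVg esm1.
- by split; [exact: es_map1|move=> X Y; exact: es_mapM].
- by exists id.
- by move=> b; exact: es_map_src.
- by move=> b; exact: es_map_tgt.
- exact: esm_coproduct.
move=> X; apply: bi.
rewrite -[LHS]/(ev id (tens_map G G (es_val X))).
(* The counit lies in B, so G may be applied to it; the claim becomes G(x) G(x') = G(x x'). *)
rewrite -(gauge_base (gaugeP G)) -[bv (counit X)]/(ev id (es_val X)).
have tl := tens_map_linear (gaugeP G) (gaugeP G).
rewrite /ev; move: (es_val X); apply: otimes_eq; [lin|lin|move=> x x'].
rewrite tens_map_pure; try exact: gaugeP.
by lpure; lpure; rewrite (gaugeM (gaugeP G)).
Qed.

End Diagonal.

(** * The crossed module *)

(* The inverse compensates the reversed composition in [gauge_mul]. *)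
Definition Ad (F : gauge) : automorphism A :=
  Automorphism (esm_automorphism (F^-1)%g).

Lemma aut_mapK (f : automorphism A) X : aut_map f (aut_map (f^-1)%g X) = X.
Proof. by have := congr1 (fun g => aut_map g X) (mulgV f). Qed.

Lemma aut_mapVK (f : automorphism A) X : aut_map (f^-1)%g (aut_map f X) = X.
Proof. by have := congr1 (fun g => aut_map g X) (mulVg f). Qed.

Lemma aut_baseK (f : automorphism A) b : aut_base f (aut_base (f^-1)%g b) = b.
Proof. by have := congr1 (fun g => aut_base g b) (mulgV f). Qed.

Lemma aut_baseVK (f : automorphism A) b : aut_base (f^-1)%g (aut_base f b) = b.
Proof. by have := congr1 (fun g => aut_base g b) (mulVg f). Qed.

Lemma conj_is_bisection (f : automorphism A) (s : bisection A) :
  is_bisection (fun X => aut_base f (s (aut_map (f^-1)%g X))).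
Proof.
have hf := autP f; have hi := autP (f^-1)%g; have hs := bisP s.
split.
- by move=> c X Y; rewrite (aut_linear hi) (bis_linear hs) (base_aut_linear hf).
- by rewrite (aut_morph hi).1 (bis_unit hs) (base_aut_morph hf).1.
- move=> b b' X; rewrite !(aut_morph hi).2 (aut_src hi) (aut_tgt hi).
  by rewrite (bis_bimod hs) !(base_aut_morph hf).2 !aut_baseK.
move=> X Y; rewrite !(aut_morph hi).2 (aut_src hi) aut_baseVK.
by rewrite (bis_mul hs).
Qed.

Definition act (f : automorphism A) (F : gauge) : gauge :=
  gauge_of (Bisection (conj_is_bisection f (sigma F))).

Lemma actE f F X : sigma (act f F) X = aut_base f (sigma F (aut_map (f^-1)%g X)).
Proof. by rewrite gauge_ofK. Qed.

Lemma coproduct_aut (V : lmodType k) (g : ES -> ES -> V) (f : automorphism A) X :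
  balanced rES lES g ->
  tens_lift g (coproduct (aut_map f X)) =
  tens_lift (fun X1 X2 => g (aut_map f X1) (aut_map f X2)) (coproduct X).
Proof.
move=> gb; rewrite -(aut_coproduct (autP f)).
rewrite (linear_tens_lift _ _ (tens_lift_linear gb)).
by apply: eq_tens_lift => Y Z; rewrite (tens_lift_pure gb).
Qed.

Lemma act_mul f : {morph act f : F G / (F * G)%g}.
Proof.
move=> F G; apply: sigma_inj => X; rewrite actE !sigma_mul /convolution.
rewrite coproduct_aut; last exact: convolution_balanced (bisP _) (bisP _).
rewrite (linear_tens_lift _ _ (base_aut_linear (autP f))).
by apply: eq_tens_lift => Y Z; rewrite !actE (base_aut_morph (autP f)).2.
Qed.

Lemma act_comp f g F : act (f * g)%g F = act f (act g F).
Proof. by apply: sigma_inj => X; rewrite !actE invgM. Qed.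

Lemma act_one F : act 1%g F = F.
Proof. by apply: sigma_inj => X; rewrite actE invg1. Qed.

Lemma Ad_mul : {morph Ad : F G / (F * G)%g}.
Proof.
move=> F G; apply: automorphism_eq => [X|//].
by rewrite -[RHS]/(esm F^-1 F^-1 (esm G^-1 G^-1 X))%g esm_comp -invgM.
Qed.

(** [source_sigma] expresses F ⊗ 1 by the coproduct, the source, the product and the bisection of F;
    [f] respects the first three and [act] conjugates the last. *)
Lemma esm_act_source f F X :
  esm (act f F) 1%g X = aut_map f (esm F 1%g (aut_map (f^-1)%g X)).
Proof.
rewrite -!source_sigma coproduct_aut; last exact: source_sigma_balanced.
rewrite (linear_tens_lift _ _ (aut_linear (autP f))).
apply: eq_tens_lift => Y Z.
by rewrite (aut_morph (autP f)).2 (aut_src (autP f)) aut_mapK actE.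
Qed.

Lemma esm_act_target f F X :
  esm 1%g (act f F)^-1%g X = aut_map f (esm 1%g F^-1%g (aut_map (f^-1)%g X)).
Proof.
rewrite -!target_sigma coproduct_aut; last exact: target_sigma_balanced.
rewrite (linear_tens_lift _ _ (aut_linear (autP f))).
apply: eq_tens_lift => Y Z.
by rewrite (aut_morph (autP f)).2 (aut_tgt (autP f)) aut_mapK actE.
Qed.

Lemma Ad_act f F : Ad (act f F) = (f * Ad F * f^-1)%g.
Proof.
have actV : act f F^-1%g = (act f F)^-1%g.
  have act1 : act f 1%g = 1%g.
    by apply: (mulgI (act f 1%g)); rewrite -act_mul !mulg1.
  by apply: (mulIg (act f F)); rewrite -act_mul !mulVg.
apply: automorphism_eq => [X|b]; last by rewrite /= aut_baseK.
rewrite -[LHS]/(esm (act f F)^-1 (act f F)^-1 X)%g.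
(* The two legs are conjugated separately: the last by [esm_act_target], the first by
   [esm_act_source] for the inverse of F, using that [act f] preserves inverses. *)
transitivity (esm (act f F)^-1 1 (esm 1 (act f F)^-1 X))%g.
  by rewrite esm_comp mulg1 mul1g.
rewrite esm_act_target -actV esm_act_source aut_mapVK esm_comp.
by rewrite mulg1 mul1g.
Qed.

(** The inverse of [Ad F] is F ⊗ F and [Ad F] is the identity on B, so the new bisection is G(F(x))
    F(x'). This element of B is fixed by the inverse of F, which turns it into F^-1(G(F(x))) x'; in
    reversed composition that is the conjugate. *)
Lemma act_Ad F G : act (Ad F) G = (F * G * F^-1)%g.
Proof.
apply: sigma_inj => X; rewrite actE -[LHS]/(sigma G _).
have -> : aut_map (Ad F)^-1%g X = esm F F X.
  have := aut_mapK (Ad F) X; rewrite -[LHS]/(esm F^-1 F^-1 _)%g.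
  by move=> e; rewrite -[in RHS]e esm_comp mulVg esm1.
apply: bi; rewrite -(gauge_base (gaugeP (F^-1)%g)) !sigmaE.
rewrite -[es_val (esm F F X)]/(tens_map F F (es_val X)).
have Fl := gauge_linear (gaugeP F); have Fl' := gauge_linear (gaugeP (F^-1)%g).
have Gl := gauge_linear (gaugeP G).
have tl := tens_map_linear (gaugeP F) (gaugeP F).
have Kl := gauge_linear (gaugeP (F * G * F^-1)%g).
rewrite /ev; move: (es_val X); apply: otimes_eq.
- by lin.
- exact: (ev_right_linear Kl).1.
move=> x x'; rewrite tens_map_pure; try exact: gaugeP.
rewrite -[RHS]/(ev (F * G * F^-1)%g (x ⊗ x')) /ev.
lpure; lpure; rewrite (gaugeM (gaugeP (F^-1)%g)).
by rewrite [of_opp (to_opp _)]/(F (oc x')) gaugeVK.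
Qed.

(** The group of bisections is represented by [gauge] through [sigma], so the group laws of
    convolution come from composition of maps. *)
Lemma bisection_crossed_module :
  exists (M : groupType) (sigma : M -> bisection A),
    [/\ bijective sigma,
        sigma 1%g =1 @counit _ _ A,
        forall m m' : M, sigma (m * m')%g =1 convolution (sigma m) (sigma m')
      & exists (Ad : M -> automorphism A) (act : automorphism A -> M -> M),
          crossed_module Ad act].
Proof.
exists gauge, sigma; split; [exact: sigma_bij|exact: sigma1|exact: sigma_mul|].
exists Ad, act; split.
- exact: Ad_mul.
- move=> f; split; last exact: act_mul.
  by exists (act f^-1%g) => F; rewrite -act_comp ?mulVg ?mulgV act_one.
- exact: act_comp.
- exact: Ad_act.
exact: act_Ad.
Qed.

End Galois.

Theorem theorem7p1 (R : realType) (H : hopf_algebra R[i])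
    (A : comodule_algebra H) (hG : hopf_galois A)
    (ff : faithfully_flat (fun (a : A) (b : base A) => a * base_val b : A)) :
  exists (M : groupType) (sigma : M -> bisection A),
    [/\ bijective sigma,
        sigma 1%g =1 @counit _ _ A,
        forall m m' : M, sigma (m * m')%g =1 convolution (sigma m) (sigma m')
      & exists (Ad : M -> automorphism A) (act : automorphism A -> M -> M),
          crossed_module Ad act].
Proof. exact: bisection_crossed_module hG ff. Qed.
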